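(* Let $\zeta\in(0,1)$, $c>0$, $x_0\in\mathbb{X}$, let $P^*$ be a diffuse probability measure on $\mathbb{X}$, and set $P_0=\zeta\delta_{x_0}+(1-\zeta)P^*$. Let $\tilde P\sim\mathrm{hNRMI}(\rho;c,P_0)$ and let $X_1,X_2,\dots$ be conditionally i.i.d. from $\tilde P$ given $\tilde P$. Let $n\ge1$ and suppose the observed sample $X^{(n)}=(X_1,\dots,X_n)$ displays $k$ distinct values $x_1^*,\dots,x_k^*$ with respective frequencies $n_1,\dots,n_k$. Then the predictive distribution of $X_{n+1}$ conditionally on $X^{(n)}$ is, for measurable $A\subseteq\mathbb{X}$: (i) if $x_0\notin\{x_1^*,\dots,x_k^*\}$, $$\Pr(X_{n+1}\in A\mid X^{(n)};\zeta)=\frac cn\,\frac{\int_0^\infty u^ne^{-c\psi(u)}\tau_1(u)\prod_{m=1}^k\tau_{n_m}(u)\,du}{\int_0^\infty u^{n-1}e^{-c\psi(u)}\prod_{m=1}^k\tau_{n_m}(u)\,du}\,P_0(A)+\frac1n\sum_{l=1}^k\frac{\int_0^\infty u^ne^{-c\psi(u)}\tau_{n_l+1}(u)\prod_{m\ne l}\tau_{n_m}(u)\,du}{\int_0^\infty u^{n-1}e^{-c\psi(u)}\prod_{m=1}^k\tau_{n_m}(u)\,du}\,\delta_{x_l^*}(A);$$ (ii) if $x_0=x_j^*$ for some $j\in\{1,\dots,k\}$, $$\Pr(X_{n+1}\in A\mid X^{(n)};\zeta)=\frac{c(1-\zeta)}{n}\,\frac{\sum_{i=1}^{n_j}c^i\zeta^i\int_0^\infty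 u^ne^{-c\psi(u)}\tau_1(u)\xi_{n_j,i}(u)\prod_{m\ne j}\tau_{n_m}(u)\,du}{\sum_{i=1}^{n_j}c^i\zeta^i\int_0^\infty u^{n-1}e^{-c\psi(u)}\xi_{n_j,i}(u)\prod_{m\ne j}\tau_{n_m}(u)\,du}\,P^*(A)$$ $$+\frac1n\,\frac{\sum_{i=1}^{n_j+1}c^i\zeta^i\int_0^\infty u^ne^{-c\psi(u)}\xi_{n_j+1,i}(u)\prod_{m\ne j}\tau_{n_m}(u)\,du}{\sum_{i=1}^{n_j}c^i\zeta^i\int_0^\infty u^{n-1}e^{-c\psi(u)}\xi_{n_j,i}(u)\prod_{m\ne j}\tau_{n_m}(u)\,du}\,\delta_{x_0}(A)$$ $$+\frac1n\sum_{l\ne j}\frac{\sum_{i=1}^{n_j}c^i\zeta^i\int_0^\infty u^ne^{-c\psi(u)}\tau_{n_l+1}(u)\xi_{n_j,i}(u)\prod_{m\ne l,j}\tau_{n_m}(u)\,du}{\sum_{i=1}^{n_j}c^i\zeta^i\int_0^\infty u^{n-1}e^{-c\psi(u)}\xi_{n_j,i}(u)\prod_{m\ne j}\tau_{n_m}(u)\,du}\,\delta_{x_l^*}(A).$$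
   Context: $\mathbb{X}$ is a Polish space with its Borel $\sigma$-algebra. A completely random measure (CRM) on $\mathbb{X}$ is a random measure $\tilde\mu$ such that $\tilde\mu(A_1),\dots,\tilde\mu(A_k)$ are mutually independent for all pairwise disjoint measurable $A_1,\dots,A_k$. Let $\rho:(0,\infty)\to[0,\infty)$ be measurable with $\int_0^\infty\min(1,s)\rho(s)\,ds<\infty$ and $\int_0^\infty\rho(s)\,ds=\infty$. For $c>0$ and a probability measure $H$ on $\mathbb{X}$, let $\tilde\mu$ be the (homogeneous, almost surely finite) CRM with Lévy intensity $\rho(s)\,ds\,c\,H(dx)$, i.e. for every measurable $g:\mathbb{X}\to[0,\infty)$, $$\mathbb{E}\Big[e^{-\int g\,d\tilde\mu}\Big]=\exp\Big\{-c\int_{\mathbb{X}}\int_0^\infty(1-e^{-sg(x)})\rho(s)\,ds\,H(dx)\Big\}.$$ $\mathrm{hNRMI}(\rho;c,H)$ denotes the law of the random probability measure $\tilde\mu/\tilde\mu(\mathbb{X})$. For $u>0$ and integer $q\ge1$: $\tau_q(u)=\int_0^\infty s^q e^{-us}\rho(s)\,ds$, $\psi(u)=\int_0^\infty(1-e^{-us})\rho(s)\,ds$, and for integers $1\le i\le n$, $$\xi_{n,i}(u)=\frac1{i!}\sum_{j=0}^i(-1)^{n-j}\binom ij\psi^{i-j}(u)\frac{d^n}{du^n}\big[\psi^j(u)\big].$$ $\Pr(\cdot;\zeta)$ is probability under the model with base measure $P_0$; the predictive distribution is the (almost surely unique) regular conditional distribution of $X_{n+1}$ given $X^{(n)}$.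 Empty products equal 1 and empty sums equal 0. *)

(* Defs.v *)
From HB Require Import structures.
From mathcomp Require Import all_boot all_order all_algebra.
From mathcomp Require Import all_classical all_reals all_analysis.
From mathcomp Require Import measurable_realfun.

Set Implicit Arguments.
Unset Strict Implicit.
Unset Printing Implicit Defensive.

Import Order.TTheory GRing.Theory Num.Theory.
Import numFieldNormedType.Exports.

Local Open Scope classical_set_scope.
Local Open Scope ring_scope.

Definition metrizes {R : realType} {X : topologicalType} (dist : X -> X -> R) :=
  [/\ forall x y, dist x y = 0 <-> x = y,
      forall x y, dist x y = dist y x,
      forall x y z, dist x z <= dist x y + dist y z &
      forall (x : X) (A : set X),
        nbhs x A <-> exists2 e, 0 < e & [set y | dist x y < e] `<=` A].

Definition complete_dist {R : realType} {X : topologicalType}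
    (dist : X -> X -> R) :=
  forall u : nat -> X,
    (forall e, 0 < e -> exists N : nat, forall m n : nat,
       (N <= m)%N -> (N <= n)%N -> dist (u m) (u n) < e) ->
    exists l : X, u @ \oo --> l.

Definition polish (R : realType) (X : topologicalType) : Prop :=
  (exists2 D : set X, countable D & dense D) /\
  (exists2 dist : X -> X -> R, metrizes dist & complete_dist dist).

Definition borel (X : ptopologicalType) := g_sigma_algebraType (@open X).

Definition diffuse {R : realType} {d} {T : measurableType d}
    (H : {measure set T -> \bar R}) :=
  forall x, H [set x] = 0%E.

(* Sets with B i = setT drop the i-th variable, so the product rule below
   covers all subfamilies. *)
Definition mutually_independent {R : realType} {d dS} {Omega : measurableType d}
    {S : measurableType dS} (Pr : probability Omega R) (k : nat)
    (Y : 'I_k -> Omega -> S) :=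
  forall B : 'I_k -> set S, (forall i, measurable (B i)) ->
    Pr (\bigcap_(i in [set: 'I_k]) (Y i @^-1` B i)) =
    (\prod_(i < k) Pr (Y i @^-1` B i))%E.

(* A random measure is a kernel; its total mass may be +oo. *)
Definition completely_random {R : realType} {dO dX} {Omega : measurableType dO}
    {X : measurableType dX} (Pr : probability Omega R) (mu : R.-ker Omega ~> X) :=
  forall (k : nat) (A : 'I_k -> set X),
    (forall i, measurable (A i)) -> trivIset setT A ->
    mutually_independent Pr (fun i w => mu w (A i)).

Section levy.
Context {R : realType}.
Local Notation leb := (@lebesgue_measure R).

Definition is_homogeneous_crm {dO dX} {Omega : measurableType dO}
    {X : measurableType dX} (rho : R -> R) (c : R) (H : probability X R)
    (Pr : probability Omega R) (mu : R.-ker Omega ~> X) :=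
  [/\ completely_random Pr mu,
      \forall w \ae Pr, (mu w setT < +oo)%E &
      forall g : X -> R, measurable_fun setT g -> (forall x, 0 <= g x) ->
        (\int[Pr]_w expeR (- \int[mu w]_x (g x)%:E) =
         expeR (- (c%:E * \int[H]_x \int[leb]_(s in `]0%R, +oo[)
                     ((1 - expR (- (s * g x))) * rho s)%:E)))%E].

(* The second argument of mnormalize is only its value on the event
   mu w setT \in {0, +oo}, which has probability zero. *)
Definition is_hNRMI {dX} {X : measurableType dX} (rho : R -> R) (c : R)
    (H : probability X R) (Q : probability (pprobability X R) R) : Prop :=
  exists (dO : measure_display) (Omega : measurableType dO)
    (Pr : probability Omega R) (mu : R.-ker Omega ~> X),
    is_homogeneous_crm rho c H Pr mu /\
    forall B : set (pprobability X R), measurable B ->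
      Q B = Pr [set w | B (mnormalize (mu w) H : pprobability X R)].

(* The library's real-valued integral: it is 0 when the extended-real integral
   is infinite. Every integrand it is applied to here is integrable on
   ]0, +oo[ (for u > 0 in tau and psi). *)
Definition int0oo (f : R -> R) : R := (\int[leb]_(u in `]0%R, +oo[) f u)%R.

Definition tau (rho : R -> R) (q : nat) (u : R) : R :=
  int0oo (fun s => s ^+ q * expR (- (u * s)) * rho s).

Definition psi (rho : R -> R) (u : R) : R :=
  int0oo (fun s => (1 - expR (- (u * s))) * rho s).

(* Meaningful for 1 <= i <= n: the subtraction n - j is then not truncated. *)
Definition xi (rho : R -> R) (n i : nat) (u : R) : R :=
  (i`!%:R)^-1 * \sum_(0 <= j < i.+1)
    (-1) ^+ (n - j) * 'C(i, j)%:R * psi rho u ^+ (i - j) *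
    derive1n n (fun v => psi rho v ^+ j) u.

End levy.

Section conditional.
Context {R : realType} {dO} {Omega : measurableType dO}
  (Pr : probability Omega R).

(* f \o Z is a version of the conditional probability of E given Z *)
Definition cond_prob_version {dS} {S : measurableType dS} (E : set Omega)
    (Z : Omega -> S) (f : S -> \bar R) :=
  measurable_fun setT f /\
  forall B, measurable B ->
    Pr (E `&` Z @^-1` B) = (\int[Pr]_(w in Z @^-1` B) f (Z w))%E.

Definition is_regular_cond_dist {dS dT} {S : measurableType dS}
    {T : measurableType dT} (Y : Omega -> T) (Z : Omega -> S)
    (kappa : R.-pker S ~> T) :=
  forall A, measurable A -> cond_prob_version (Y @^-1` A) Z (kappa ^~ A).

Definition cond_iid {dT} {T : measurableType dT} (X : nat -> Omega -> T)
    (Pt : Omega -> pprobability T R) :=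
  forall (n : nat) (A : 'I_n -> set T), (forall i, measurable (A i)) ->
    cond_prob_version (\bigcap_(i in [set: 'I_n]) (X i @^-1` A i)) Pt
      (fun p : pprobability T R => (\prod_(i < n) p (A i))%E).

End conditional.

Definition sample {Omega T : Type} (X : nat -> Omega -> T) (n : nat) (w : Omega)
  : n.-tuple T := [tuple X i w | i < n].

Definition displays {T : eqType} (n k : nat) (x : n.-tuple T) (xs : 'I_k -> T)
    (nu : 'I_k -> nat) :=
  [/\ injective xs, forall y, y \in x <-> exists m, xs m = y &
      forall m, nu m = count_mem (xs m) x].

(* Main.v *)
(** Write [b = c (1 - zeta)] and [a = c zeta]. For bounded measurable [g > 0]
    bounded away from [0], the Laplace functional of the CRM [mu] at [g] is
    [exp (- b \int psi (g y) dP^*(y)) exp (- a psi (g x0))]. Differentiating it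
    along the indicators of [A_1, .., A_n] gives
    [E [mu(A_1) .. mu(A_n) exp (- \int g dmu)]]. Each differentiation either hits
    the integral, which creates a factor [b tau_1 (g y)] at a fresh [P^*]-location
    [y], or hits a factor [tau_q (g z)] of an old location [z], turning it into
    [tau_(q+1) (g z)], or hits the factor of the atom [x0], whose successive
    derivatives are [exp (- a psi)] times partial Bell polynomials in the [tau_q];
    a Leibniz-type inversion identifies these polynomials with the [xi]. So the
    moment is the integral over [A_1 x .. x A_n] of an explicit density with
    respect to the measure of an urn whose next point is drawn from [P^*], or is
    [x0], or repeats a previous point.

    Since [1 / T ^ n = \int_0^oo u^(n-1) exp (- u T) du / (n-1)!], taking [g = u]
    constant and integrating in [u] yields the density [f_n] of the law of
    [(X_1, .., X_n)] with respect to the urn measure. The conditional law of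
    [X_(n+1)] is then [J / f_n], where [J] integrates [f_(n+1)] over one urn step,
    and evaluating it gives the formulas. That the total mass of [J] is [f_n] and
    is finite holds almost surely because both are densities of the law of the
    first [n] points, and this is also what makes every integral in the formulas
    finite. *)

Require Import Defs.
From HB Require Import structures.
From mathcomp Require Import all_boot all_order all_algebra.
From mathcomp Require Import all_classical all_reals all_analysis.
From mathcomp Require Import measurable_realfun.
From mathcomp Require Import ring lra.

Set Implicit Arguments.
Unset Strict Implicit.
Unset Printing Implicit Defensive.

Import Order.TTheory GRing.Theory Num.Theory.
Import numFieldNormedType.Exports.

Local Open Scope classical_set_scope.
Local Open Scope ring_scope.

(** * Borel sets of a Polish space *)

(** Differentiation is carried out along the increments [1/(k+1)]. The functions involved are
    nonnegative, decreasing and convex in the shift, so their difference quotients increase with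
    [k], and monotone convergence passes to the limit on both sides of the moment identity, in
    [[0, +oo]] and without any bound on the derivatives. Products inherit this monotonicity.

    The urn list is seeded with [x0]. A draw of [x0] is then the repetition of a list entry, so the
    urn has only two kinds of moves, and [x0] is always a site. The urn repeats a site once for each
    of its entries, while differentiation hits the factor of the site once. A site with [p.+1]
    entries is thus reached through [p!] choices of indices, and the density compensates by
    [1 / p!]: this is the origin of the factorials in [site_weight].

    The formulas must hold for all Borel sets outside one null set. This is where the topology of
    the space enters: a countable base reduces the identity of two measures to countably many
    sets. *)

Section polish_borel.
Context {R : realType} {X : ptopologicalType}.

Definition separating_base (U : nat -> set X) :=
  (forall k, open (U k)) /\
  (forall (O : set X) x, open O -> O x -> exists2 k, U k x & U k `<=` O).

(** The base consists of the balls of radius [1/(m+1)] around the points of a countable dense set.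
    Two points are separated by a base set inside the ball around the first whose radius is their
    distance. *)
Lemma polish_base : polish R X -> exists2 U, separating_base U &
  forall x y : X, x <> y -> exists k, U k x /\ ~ U k y.
Proof.
case=> -[D cD dD] [dist [d0 dC dD3 dN] _].
have {}dN (x : X) (A : set X) : nbhs x A <->
    exists2 e : R, 0 < e & [set y | dist x y < e] `<=` A by exact: dN.
have dxx x : dist x x = 0 by apply/d0.
have dge0 x y : 0 <= dist x y.
  by have := dD3 x y x; rewrite dxx [dist y x]dC; lra.
have [f finj] : exists f : X -> nat, set_inj D f.
  exact/countable_injP.
have ballO (a : X) (e : R) : open [set y | dist a y < e].
  rewrite openE => y /= ya; apply/dN; exists (e - dist a y); first lra.
  move=> z /= yz; by have := dD3 a y z; lra.
(* As [f] is injective on [D], this union over the points of code [p.1] is a single ball or empty,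
   so no enumeration of [D] has to be chosen. *)
pose V (p : nat * nat) := [set y | exists2 a, D a /\ f a = p.1 &
  dist a y < p.2.+1%:R^-1].
pose U k := if unpickle k is Some p then V p else set0.
have Uo k : open (U k).
  rewrite /U; case: (unpickle k) => [p|]; last exact: open0.
  rewrite (_ : V p = \bigcup_(a in [set a | D a /\ f a = p.1])
     [set y | dist a y < p.2.+1%:R^-1]); last by apply/seteqP; split => y [a aD ya]; exists a.
  by apply: bigcup_open => a _; exact: ballO.
have base (O : set X) x : open O -> O x -> exists2 k, U k x & U k `<=` O.
  move=> oO Ox; have : nbhs x O by exact: open_nbhs_nbhs.
  move=> /dN[e e0 eO].
  (* Half of [e], since [x] and [y] will both lie within [1/(m+1)] of the same centre. *)
  have [m hm] : exists m, m.+1%:R^-1 < e / 2.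
    have /ltr_add_invr[m] : 0 < e / 2 by rewrite divr_gt0.
    by rewrite add0r; exists m.
  have [a [ax Da]] : [set y | dist x y < m.+1%:R^-1] `&` D !=set0.
    apply: dD; last exact: ballO.
    by exists x; rewrite /= dxx.
  exists (pickle (f a, m)).
    by rewrite /U pickleK /V; exists a => //=; rewrite dC.
  rewrite /U pickleK => y [b /= [Db fab] by_].
  have ab : a = b by apply: finj; rewrite ?inE.
  apply: eO => /=; rewrite -ab /= in by_; move: ax => /= ax.
  have ax2 : dist x a < e / 2 := lt_trans ax hm.
  have by2 : dist a y < e / 2 := lt_trans by_ hm.
  by have := dD3 x a y; lra.
exists U; first by split.
move=> x y xy.
have oy : open [set z | dist x z < dist x y] by exact: ballO.
have [|k Ukx Uk] := base _ x oy.
  by rewrite /= dxx lt_neqAle dge0 andbT; apply/eqP => /esym /d0.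
by exists k; split => // /Uk /=; rewrite ltxx.
Qed.

Lemma base_measurable U k : separating_base U -> measurable (U k : set (borel X)).
Proof. by move=> [oU _]; exact: sub_sigma_algebra. Qed.

(** Indexed by lists of numbers: a countable family, stable under intersection by concatenation. *)
Definition base_cap (U : nat -> set X) (l : seq nat) : set X :=
  foldr (fun k A => U k `&` A) setT l.

Lemma base_cap_cat U l m : base_cap U (l ++ m) = base_cap U l `&` base_cap U m.
Proof. by elim: l => [|k l ih]/=; rewrite ?setTI// ih setIA. Qed.

Lemma base_cap_measurable U l : separating_base U ->
  measurable (base_cap U l : set (borel X)).
Proof.
move=> hU; elim: l => [|k l ih]/=; first exact: measurableT.
by apply: measurableI => //; exact: base_measurable.
Qed.

(** Finite intersections of base sets form a countable pi-system that generates the Borel sets.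
    Countability lets almost sure identities pass to all Borel sets at once. *)
Lemma borel_measure_ext U (m1 m2 : {measure set (borel X) -> \bar R}) :
  separating_base U -> (m1 setT < +oo)%E ->
  (forall l, m1 (base_cap U l) = m2 (base_cap U l)) ->
  forall A : set (borel X), measurable A -> m1 A = m2 A.
Proof.
move=> hU m1T m12 A mA.
pose G : set (set (borel X)) := range (base_cap U).
apply: (measure_unique G (fun=> setT)) => //.
- rewrite eqEsubset; split.
    apply: smallest_sub; first exact: smallest_sigma_algebra.
    move=> O oO.
    have -> : O = \bigcup_(k in [set k | U k `<=` O]) U k.
      apply/seteqP; split => [x Ox|x [k kO Ukx]]; last exact: kO.
      by have [k Ukx kO] := hU.2 _ _ oO Ox; exists k.
    pose GT : measurableType _ := g_sigma_algebraType G.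
    apply: (@bigcup_measurable _ GT) => k _.
    apply: sub_sigma_algebra; exists [:: k] => //=.
    by rewrite setIT.
  apply: smallest_sub; first exact: sigma_algebra_measurable.
  by move=> _ [l _ <-]; exact: base_cap_measurable.
- by move=> _ _ [l _ <-] [m _ <-]; exists (l ++ m) => //; rewrite base_cap_cat.
- by move=> _; exists [::].
- by rewrite bigcup_const.
- by move=> _ [l _ <-]; exact: m12.
Qed.

End polish_borel.

(** * Measurability of equality *)

Section diagonal.
Context {R : realType} {X : ptopologicalType} (hX : polish R X).
Context {d} {T : measurableType d}.

(** Two points differ exactly when some base set contains the first and not the second, which writes
    the complement as a countable union. *)
Lemma measurable_eq_fun (f g : T -> borel X) :
  measurable_fun setT f -> measurable_fun setT g ->
  measurable [set t | f t = g t].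
Proof.
move=> mf mg; have [U hU sep] := polish_base hX.
rewrite -[X in measurable X]setCK; apply: measurableC.
rewrite (_ : ~` _ = \bigcup_k (f @^-1` U k `&` g @^-1` ~` U k)).
  apply: bigcup_measurable => k _; apply: measurableI;
    rewrite -[X in measurable X]setTI.
    by apply: mf => //; exact: base_measurable.
  by apply: mg => //; apply: measurableC; exact: base_measurable.
apply/seteqP; split => [t /= /sep[k [? ?]]|t [k _ [/= Uf Ug]] fg].
  by exists k.
by apply: Ug; rewrite -fg.
Qed.

Lemma measurable_eqb_fun (f g : T -> borel X) :
  measurable_fun setT f -> measurable_fun setT g ->
  measurable_fun setT (fun t => f t == g t).
Proof.
move=> mf mg; apply: (measurable_fun_bool true).
rewrite setTI (_ : _ @^-1` _ = [set t | f t = g t]); first exact: measurable_eq_fun.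
by apply/seteqP; split => t /= /eqP.
Qed.

End diagonal.

Lemma measurable_set1_borel {R : realType} {X : ptopologicalType} (x : X) :
  polish R X -> measurable ([set x] : set (borel X)).
Proof.
move=> hX; have -> : [set x] = [set t : borel X | t = x] by [].
exact: (measurable_eq_fun hX).
Qed.

(** Meant for a multiplicity [N], which selects the order of a weight. *)
Lemma measurable_fun_nat_select {d d'} {T : measurableType d}
    {S : measurableType d'} (N : T -> nat) (F : nat -> T -> S) :
  measurable_fun setT N -> (forall q, measurable_fun setT (F q)) ->
  measurable_fun setT (fun t => F (N t) t).
Proof.
move=> mN mF _ B mB; rewrite setTI.
rewrite (_ : _ @^-1` B = \bigcup_q (N @^-1` [set q] `&` F q @^-1` B)).
  apply: bigcup_measurable => q _; apply: measurableI;
    rewrite -[X in measurable X]setTI; first exact: mN.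
  exact: mF.
by apply/seteqP; split => [t Bt|t [q _ [/= <-]]] //; exists (N t).
Qed.

(** * Difference quotients of convex functions *)

Section pointwise_derivatives.
Context {R : realType}.
Implicit Types (f g : R -> R) (x df dg : R).

Lemma is_derive_mulf f g x df dg : is_derive x 1 f df -> is_derive x 1 g dg ->
  is_derive x 1 (fun v => f v * g v) (df * g x + f x * dg).
Proof.
move=> hf hg; have h := is_deriveM hf hg.
by apply: is_derive_eq; rewrite addrC /GRing.scale/= [g x * _]mulrC.
Qed.

Lemma is_derive_Zf (k : R) f x df : is_derive x 1 f df ->
  is_derive x 1 (fun v => k * f v) (k * df).
Proof. by move=> hf; have := is_deriveZ k hf; apply. Qed.

Lemma is_derive_expf (n : nat) f x df : is_derive x 1 f df ->
  is_derive x 1 (fun v => f v ^+ n) (n%:R * f x ^+ n.-1 * df).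
Proof.
move=> hf; have := is_deriveX n hf.
by rewrite /GRing.scale/= (_ : f ^+ n = (fun v => f v ^+ n))//; exact: exprfctE.
Qed.

Lemma is_derive_sumf (n : nat) (h : nat -> R -> R) (dh : nat -> R) x :
  (forall i, (i < n)%N -> is_derive x 1 (h i) (dh i)) ->
  is_derive x 1 (fun v => \sum_(i < n) h i v) (\sum_(i < n) dh i).
Proof.
move=> H; have := @is_derive_sum R _ _ n (fun i => h i) x 1 (fun i => dh i)
  (fun i => H i (ltn_ord i)).
by rewrite fct_sumE.
Qed.

Lemma derivative_differentiable f df x : is_derive x 1 f df ->
  {for x, continuous f}.
Proof.
move=> [h _]; exact/differentiable_continuous/derivable1_diffP.
Qed.

Lemma differentiable_measurable_gt0 (f : R -> R) :
  (forall x : R, 0 < x -> exists df, is_derive x 1 f df) ->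
  measurable_fun (`]0, +oo[ : set R) f.
Proof.
move=> H; apply: open_continuous_measurable_fun; first exact: interval_open.
move=> x; rewrite inE/= in_itv/= andbT => /H[df].
exact: derivative_differentiable.
Qed.

(* [f] is then convex, so its difference quotients increase to [-f' x] along
   any sequence of increments decreasing to 0. *)
Lemma mvt_gt0 (f g : R -> R) x t :
  (forall v : R, 0 < v -> is_derive v 1 f (- g v)) ->
  0 < x -> 0 < t -> exists2 y, x < y < x + t & f x - f (x + t) = g y * t.
Proof.
move=> df x0 t0; have xt : x < x + t by rewrite ltrDl.
have [z||y] := @MVT R f (fun v => - g v) x (x + t) xt.
- by rewrite in_itv/= => /andP[xz _]; apply: df; exact: lt_trans xz.
- apply: derivable_within_continuous => z; rewrite in_itv/= => /andP[xz _].
  by have [] := df z (lt_le_trans x0 xz).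
- rewrite in_itv/= => yx e; exists y => //.
  by rewrite -opprB e; ring.
Qed.

End pointwise_derivatives.

Section difference_quotients.
Context {R : realType}.

(* [a k] are the values at the increments [1/(k+1)] of a function with value
   [a0] and right derivative [-d] at the origin. *)
Definition convex_quotients (a0 : R) (a : nat -> R) (d : R) :=
  [/\ forall k, 0 <= a k <= a0,
      {homo a : k l / (k <= l)%N >-> k <= l},
      {homo (fun k => (a0 - a k) * k.+1%:R) : k l / (k <= l)%N >-> k <= l} &
      (a0 - a k) * k.+1%:R @[k --> \oo] --> d].

Lemma convex_quotients_cst (a0 : R) : 0 <= a0 ->
  convex_quotients a0 (fun=> a0) 0.
Proof.
move=> a00; split => //.
- by move=> k; rewrite a00 lexx.
- by move=> k l _; rewrite !subrr !mul0r.
- by under eq_fun do rewrite subrr mul0r; exact: cvg_cst.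
Qed.

Lemma convex_quotients_cvg a0 a d : convex_quotients a0 a d ->
  a k @[k --> \oo] --> a0.
Proof.
move=> [_ _ _ ad].
have -> : a = (fun k => a0 - (a0 - a k) * k.+1%:R * k.+1%:R^-1).
  by apply/funext => k; rewrite mulfK ?pnatr_eq0// opprB addrCA subrr addr0.
rewrite -[X in _ --> X]subr0; apply: cvgB; first exact: cvg_cst.
by rewrite -(mulr0 d); apply: cvgM => //; exact: cvg_harmonic.
Qed.

(** The Leibniz rule is used in the asymmetric form [a0 (b0 - b k) + b k (a0 - a k)]: since [b k]
    increases with [k] and all factors are nonnegative, the quotients of the product increase
    too. *)
Lemma convex_quotientsM a0 a d b0 b e :
  convex_quotients a0 a d -> convex_quotients b0 b e ->
  convex_quotients (a0 * b0) (fun k => a k * b k) (a0 * e + b0 * d).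
Proof.
move=> ha hb; have ca := convex_quotients_cvg ha; have cb := convex_quotients_cvg hb.
case: ha hb => a01 an aq ad [b01 bn bq bd].
have a0ge0 : 0 <= a0 by have /andP[] := a01 0%N; exact: le_trans.
have E k : (a0 * b0 - a k * b k) * k.+1%:R =
    a0 * ((b0 - b k) * k.+1%:R) + b k * ((a0 - a k) * k.+1%:R) by ring.
split.
- move=> k; have /andP[? ?] := a01 k; have /andP[? ?] := b01 k.
  by rewrite mulr_ge0//= ler_pM.
- move=> k l kl; have /andP[? ?] := a01 k; have /andP[? ?] := b01 k.
  by rewrite ler_pM//; [exact: an|exact: bn].
- move=> k l kl; rewrite !E lerD//; first by rewrite ler_wpM2l// bq.
  have /andP[? ?] := a01 k; have /andP[? ?] := b01 k.
  by rewrite ler_pM ?bn ?aq// mulr_ge0// subr_ge0.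
- rewrite (_ : (fun k => _) = (fun k => a0 * ((b0 - b k) * k.+1%:R) +
     b k * ((a0 - a k) * k.+1%:R))); last by apply/funext => k; exact: E.
  apply: cvgD; first by apply: cvgM => //; exact: cvg_cst.
  exact: cvgM.
Qed.

Lemma convex_quotients_prod (I : eqType) (r : seq I) (a0 : I -> R)
    (a : I -> nat -> R) (d : I -> R) : uniq r ->
  (forall i, i \in r -> convex_quotients (a0 i) (a i) (d i)) ->
  convex_quotients (\prod_(i <- r) a0 i) (fun k => \prod_(i <- r) a i k)
    (\sum_(i <- r) d i * \prod_(j <- r | j != i) a0 j).
Proof.
elim: r => [|i r ih]/=.
  move=> _ _; rewrite !big_nil (_ : (fun k => _) = fun=> 1).
    exact: convex_quotients_cst.
  by apply/funext => k; rewrite big_nil.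
move=> /andP[ir ur] H; rewrite big_cons.
rewrite (_ : (fun k => _) = fun k => a i k * \prod_(j <- r) a j k); last first.
  by apply/funext => k; rewrite big_cons.
have := convex_quotientsM (H i (mem_head _ _))
  (ih ur (fun j jr => H j (@mem_behead _ (i :: r) j jr))).
congr convex_quotients; rewrite big_cons addrC; congr +%R.
  rewrite mulrC; congr (_ * _); rewrite big_cons eqxx/= big_seq [RHS]big_seq_cond.
  apply: eq_bigl => j; case jr: (j \in r) => //=.
  by apply/esym/eqP => ji; rewrite -ji jr in ir.
rewrite big_distrr/= big_seq [RHS]big_seq; apply: eq_bigr => j jr.
rewrite big_cons ifT; first by rewrite mulrCA.
by apply: contraNneq ir => ->.
Qed.

Lemma convex_quotients_derive (f g : R -> R) x :
  (forall v : R, 0 < v -> is_derive v 1 f (- g v)) ->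
  (forall v : R, 0 < v -> 0 <= f v) -> (forall v : R, 0 < v -> 0 <= g v) ->
  (forall v w : R, 0 < v -> v <= w -> g w <= g v) -> 0 < x ->
  convex_quotients (f x) (fun k => f (x + k.+1%:R^-1)) (g x).
Proof.
move=> df f0 g0 ga x0.
have fa v t : 0 < v -> 0 <= t -> f (v + t) <= f v.
  move=> v0; rewrite le_eqVlt => /predU1P[<-|t0]; first by rewrite addr0.
  have [y /andP[vy _] e] := mvt_gt0 df v0 t0.
  by rewrite -subr_ge0 e mulr_ge0 ?g0 ?ltW// (lt_trans v0).
have t0 k : 0 < k.+1%:R^-1 :> R by [].
have tn k l : (k <= l)%N -> l.+1%:R^-1 <= k.+1%:R^-1 :> R.
  by move=> kl; rewrite lef_pV2 ?posrE// ler_nat.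
split.
- by move=> k; rewrite f0/= ?fa ?addr_gt0// ltW.
- move=> k l kl; rewrite -(subrKC l.+1%:R^-1 k.+1%:R^-1) addrA fa//.
    by rewrite addr_gt0.
  by rewrite subr_ge0 tn.
- move=> k l kl /=; set s := l.+1%:R^-1; set t := k.+1%:R^-1.
  have st : s <= t by exact: tn.
  have s0 : 0 < s by exact: t0.
  have tp : 0 < t by exact: t0.
  rewrite -(invrK l.+1%:R) -(invrK k.+1%:R) -/s -/t ler_pdivrMr// mulrAC.
  rewrite ler_pdivlMr//.
  move: st; rewrite le_eqVlt => /predU1P[->//|st].
  have xs0 : 0 < x + s by rewrite addr_gt0.
  have ts0 : 0 < t - s by rewrite subr_gt0.
  (* The mean rates of decrease over [[x, x + s]] and [[x + s, x + t]] are [g z] and [g y] with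
     [z < x + s < y]. As [g] is antitone the first is the larger, so the mean rate over [[x, x + t]]
     is at most that over [[x, x + s]]. *)
  have [y /andP[xy _] e1] := mvt_gt0 df xs0 ts0.
  have [z /andP[xz zx] e2] := mvt_gt0 df x0 (t0 l).
  rewrite -addrA subrKC -/s in e1 e2; rewrite -/s in zx.
  have h1 : g y <= g (x + s) by apply: ga => //; exact: ltW.
  have h2 : g (x + s) <= g z by apply: ga; [exact: lt_trans xz|exact: ltW].
  have -> : f x - f (x + t) = g z * s + g y * (t - s) by rewrite -e1 -e2; ring.
  rewrite mulrDl -mulrA e2 -subr_ge0.
  have -> : g z * s * t - (g z * (s * s) + g y * (t - s) * s) =
     (g z - g y) * ((t - s) * s) by ring.
  apply: mulr_ge0; last by apply: mulr_ge0; exact: ltW.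
  by rewrite subr_ge0 (le_trans h1).
- have [dx ev] := df _ x0.
  have {ev} c : (h^-1 *: (f (h *: 1 + x) - f x)) @[h --> 0^'] --> - g x.
    by rewrite -ev; exact: dx.
  have /(_ (fun k => k.+1%:R^-1)) := (cvgr_dnbhsP _ _ _).1 c.
  move=> /(_ _)/cvgN; rewrite opprK => /(_ _); rewrite (_ : - _ =
    (fun k => (f x - f (x + k.+1%:R^-1)) * k.+1%:R)).
    apply; split; first by move=> k; rewrite gt_eqF.
    exact: cvg_harmonic.
  apply/funext => k; rewrite opprfctE/= invrK /GRing.scale/= mulr1 [_ + x]addrC.
  by ring.
Qed.

End difference_quotients.

(** * Differentiation under the integral sign *)

Section derivative_under_integral.
Context {R : realType} {d} {T : measurableType d}.
Context (mu : {measure set T -> \bar R}) (B : set T) (mB : measurable B).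

(** Since [f'] is antitone in the parameter, its value at [x / 2] dominates it on []x / 2, x + 1[].
    The factor [sg] covers both signs: -1 for [tau], 1 for [psi]. *)
Lemma is_derive_antitone_integral (sg : R) (f f' : R -> T -> R) (x : R) :
  (forall v : R, 0 < v -> mu.-integrable B (EFin \o f v)) ->
  (forall (v : R) y, 0 < v -> B y -> is_derive v 1 (f ^~ y) (sg * f' v y)) ->
  (forall v : R, 0 < v -> mu.-integrable B (EFin \o f' v)) ->
  (forall (v : R) y, 0 < v -> B y -> 0 <= f' v y) ->
  (forall (v w : R) y, 0 < v -> v <= w -> B y -> f' w y <= f' v y) ->
  0 < x ->
  is_derive x 1 (fun v => \int[mu]_(y in B) f v y)%R
    (sg * (\int[mu]_(y in B) f' x y)%R).
Proof.
move=> fi df f'i f'0 f'a x0.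
have pos (v : R) : `]x / 2, x + 1[%classic v -> 0 < v.
  by rewrite /= in_itv/= => /andP[xv _]; apply: lt_trans xv; rewrite divr_gt0.
have Ix : `]x / 2, x + 1[%classic x.
  by rewrite /= in_itv/= ltrDl ltr01 andbT; lra.
have x20 : 0 < x / 2 by rewrite divr_gt0.
have G0 y : 0 <= `|sg * f' (x / 2) y| by [].
have Gi : mu.-integrable B (EFin \o (fun y => `|sg * f' (x / 2) y|)).
  by apply: integrable_norm; rewrite /comp/=; under eq_fun do rewrite EFinM;
    apply: integrableZl => //; exact: f'i.
have d1 (v : R) y : `]x / 2, x + 1[%classic v -> B y -> derivable (f ^~ y) v 1.
  by move=> /pos v0 By; have [] := df _ _ v0 By.
have d1E (v : R) y : 0 < v -> B y -> partial1of2 f v y = sg * f' v y.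
  move=> v0 By; rewrite /partial1of2 derive1E.
  by have [_ ->] := df _ _ v0 By.
have Gub (v : R) y : `]x / 2, x + 1[%classic v -> B y ->
    `|partial1of2 f v y| <= `|sg * f' (x / 2) y|.
  move=> Iv By; have v0 := pos _ Iv; rewrite d1E// !normrM ler_wpM2l//.
  rewrite !ger0_norm ?f'0// f'a//.
  by move: Iv; rewrite /= in_itv/= => /andP[/ltW].
have fi' (v : R) : `]x / 2, x + 1[%classic v -> mu.-integrable B (EFin \o f v).
  by move=> /pos; exact: fi.
split.
  exact: (derivable_under_integral mB Ix fi' d1 G0 Gi Gub).
rewrite -derive1E (differentiation_under_integral mB Ix fi' d1 G0 Gi Gub).
rewrite -RintegralZl//; last exact: f'i.
by apply: eq_Rintegral => y; rewrite inE => By; rewrite d1E.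
Qed.

End derivative_under_integral.

(** * The Laplace exponent and its derivatives *)

Section levy_intensity.
Context {R : realType} (rho : R -> R).
Context (rho_meas : measurable_fun [set s : R | 0 < s] rho)
  (rho_ge0 : forall s : R, 0 < s -> 0 <= rho s)
  (rho_levy : (\int[@lebesgue_measure R]_(s in `]0%R, +oo[)
                 (Num.min 1%R s * rho s)%:E < +oo)%E).
Local Notation leb := (@lebesgue_measure R).
Local Notation Rpos := (`]0%R, +oo[%classic : set R).

Lemma Rpos_gt0 (s : R) : Rpos s -> 0 < s.
Proof. by rewrite /= in_itv/= andbT. Qed.

Lemma Rpos_measurable : measurable Rpos.
Proof. exact: measurable_itv. Qed.

Lemma rho_measurable : measurable_fun Rpos rho.
Proof.
rewrite (_ : Rpos = [set s : R | 0 < s])//.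
by apply/seteqP; split => s /=; rewrite in_itv/= andbT.
Qed.

(** All integrands against [rho] are compared with [min(1, s) rho(s)], the integrability that the
    Levy condition provides. *)
Lemma le_min1_integrable (h : R -> R) (C : R) :
  measurable_fun Rpos h -> (forall s, 0 < s -> `|h s| <= C * Num.min 1 s) ->
  leb.-integrable Rpos (EFin \o (fun s => h s * rho s)).
Proof.
move=> mh hC.
have minm : measurable_fun Rpos (fun s : R => Num.min 1 s).
  by apply: measurable_minr => //; exact: measurable_id.
have : leb.-integrable Rpos (fun s => C%:E * (Num.min 1 s * rho s)%:E)%E.
  apply: integrableZl; first exact: Rpos_measurable.
  apply/integrableP; split.
    by apply/measurable_EFinP; apply: measurable_funM => //; exact: rho_measurable.
  apply: le_lt_trans rho_levy; apply: ge0_le_integral => //.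
  - apply: measurableT_comp => //; apply/measurable_EFinP.
    by apply: measurable_funM => //; exact: rho_measurable.
  - by apply/measurable_EFinP; apply: measurable_funM => //; exact: rho_measurable.
  - move=> s /Rpos_gt0 s0; rewrite /= ger0_norm// mulr_ge0 ?rho_ge0//.
    by rewrite le_min ler01 ltW.
apply: le_integrable => //.
  by apply/measurable_EFinP; apply: measurable_funM => //; exact: rho_measurable.
move=> s /Rpos_gt0 s0; rewrite lee_fin !normrM mulrA.
have m0 : 0 <= Num.min 1 s by rewrite le_min ler01 ltW.
have C0 : 0 <= C.
  have := le_trans (normr_ge0 _) (hC 1 ltr01).
  by rewrite minxx mulr1.
by rewrite (ger0_norm C0) (ger0_norm m0) ler_wpM2r// hC.
Qed.

Lemma measurable_exp_neg_mul (v : R) (D : set R) :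
  measurable_fun D (fun s : R => expR (- (v * s))).
Proof.
apply: measurable_funTS; apply: measurableT_comp => //.
apply: measurableT_comp => //; apply: measurable_funM => //.
Qed.

Lemma tau_integrable (q : nat) (v : R) : (0 < q)%N -> 0 < v ->
  leb.-integrable Rpos (EFin \o (fun s => s ^+ q * expR (- (v * s)) * rho s)).
Proof.
case: q => // q _ v0.
(* For [s <= 1] the factor of [rho] is at most [s], covered by the summand 1. For [s >= 1] one term
   of the exponential series bounds it by [q.+1! / v ^+ q.+1]. *)
apply: (@le_min1_integrable _ (1 + (q.+1)`!%:R / v ^+ q.+1)).
  apply: measurable_funM; last exact: measurable_exp_neg_mul.
  by apply: measurable_funX; exact: measurable_id.
move=> s s0; rewrite ger0_norm ?mulr_ge0 ?exprn_ge0 ?expR_ge0//; last exact: ltW.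
have vs0 : 0 <= v * s by rewrite mulr_ge0// ltW.
have F0 : 0 < (q.+1)`!%:R :> R by rewrite ltr0n fact_gt0.
have C0 : 0 <= (q.+1)`!%:R / v ^+ q.+1.
  by rewrite divr_ge0// ?exprn_ge0// ltW.
have [s1|s1] := leP 1 s.
  rewrite mulr1 (@le_trans _ _ ((q.+1)`!%:R / v ^+ q.+1))// ?lerDr//.
  rewrite expRN ler_pdivrMr ?expR_gt0// mulrAC ler_pdivlMr ?exprn_gt0//.
  rewrite -exprMn [s * v]mulrC -ler_pdivrMl//.
  by have := expR_ge1Dxn q vs0; apply: le_trans; rewrite [_^-1 * _]mulrC lerDr.
apply: (@le_trans _ _ s); last by rewrite mulrDl mul1r lerDl mulr_ge0// ltW.
have s1' := ltW s1; have s0' := ltW s0.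
rewrite -[leRHS]mulr1; apply: ler_pM; rewrite ?exprn_ge0 ?expR_ge0//.
  by rewrite exprS ler_piMr// exprn_ile1.
by rewrite expRN invf_le1 ?expR_gt0// -expR0 ler_expR.
Qed.

(** From [1 - exp (- y) <= min(1, y)] at [y = v s]; the constant [1 + v] serves both ranges of
    [s]. *)
Lemma one_sub_exp_bound (v s : R) : 0 <= v -> 0 < s ->
  0 <= 1 - expR (- (v * s)) <= (1 + v) * Num.min 1 s.
Proof.
move=> v0 s0; have vs0 : 0 <= v * s by rewrite mulr_ge0// ltW.
apply/andP; split; first by rewrite subr_ge0 -expR0 ler_expR oppr_le0.
have h1 : 1 - expR (- (v * s)) <= 1 by rewrite gerBl expR_ge0.
have h2 : 1 - expR (- (v * s)) <= v * s.
  by have := expR_ge1Dx (- (v * s)); lra.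
have [s1|s1] := leP 1 s; first by rewrite mulr1; lra.
by apply: (le_trans h2); rewrite mulrDl lerDr mul1r ltW.
Qed.

Lemma psi_integrable (v : R) : 0 <= v ->
  leb.-integrable Rpos (EFin \o (fun s => (1 - expR (- (v * s))) * rho s)).
Proof.
move=> v0; apply: (@le_min1_integrable _ (1 + v)).
  by apply: measurable_funB => //; exact: measurable_exp_neg_mul.
move=> s s0; have /andP[h1 h2] := one_sub_exp_bound v0 s0.
by rewrite ger0_norm.
Qed.

Let exp_neg_antitone (v w s : R) : v <= w -> 0 < s ->
  expR (- (w * s)) <= expR (- (v * s)).
Proof. by move=> vw s0; rewrite ler_expR lerN2 ler_wpM2r// ltW. Qed.

Lemma is_derive_exp_neg_mul (s v : R) :
  is_derive v 1 (fun u : R => expR (- (u * s))) (- (s * expR (- (v * s)))).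
Proof.
have h : is_derive v 1 (fun u : R => - (u * s)) (- s).
  have := @is_derive_Zf R (- s) id v 1 (is_derive_id v 1).
  by rewrite mulr1; congr is_derive; apply/funext => u; rewrite mulNr mulrC.
have := @is_derive1_comp R expR (fun u => - (u * s)) v _ _
  (is_derive_expR (- (v * s))) h.
by rewrite mulrN mulrC; apply.
Qed.

Lemma tau_derive (q : nat) (v : R) : (0 < q)%N -> 0 < v ->
  is_derive v 1 (tau rho q) (- tau rho q.+1 v).
Proof.
move=> q0 v0; rewrite -mulN1r.
apply: (is_derive_antitone_integral (mu := leb) Rpos_measurable
  (f := fun (u : R) (s : R) => s ^+ q * expR (- (u * s)) * rho s)
  (f' := fun (u : R) (s : R) => s ^+ q.+1 * expR (- (u * s)) * rho s)) => //.
- by move=> u; exact: tau_integrable.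
- move=> u s u0 /Rpos_gt0 s0.
  have := is_derive_Zf (s ^+ q * rho s) (is_derive_exp_neg_mul s u).
  rewrite (_ : (fun u : R => _) = (fun u => s ^+ q * expR (- (u * s)) * rho s)).
    by move=> h; apply: is_derive_eq; rewrite exprS; ring.
  by apply/funext => w; ring.
- by move=> u; exact: tau_integrable.
- by move=> u s u0 /Rpos_gt0 s0; rewrite !mulr_ge0 ?exprn_ge0 ?expR_ge0 ?rho_ge0// ltW.
- move=> u w s u0 uw /Rpos_gt0 s0; rewrite ler_wpM2r ?rho_ge0// ler_wpM2l//.
    by rewrite exprn_ge0// ltW.
  exact: exp_neg_antitone.
Qed.

Lemma psi_derive (v : R) : 0 < v -> is_derive v 1 (psi rho) (tau rho 1 v).
Proof.
move=> v0; rewrite -[tau _ _ _]mul1r.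
apply: (is_derive_antitone_integral (mu := leb) Rpos_measurable
  (f := fun (u : R) (s : R) => (1 - expR (- (u * s))) * rho s)
  (f' := fun (u : R) (s : R) => s ^+ 1 * expR (- (u * s)) * rho s)) => //.
- by move=> u /ltW; exact: psi_integrable.
- move=> u s u0 /Rpos_gt0 s0.
  have h := is_derive_Zf (- rho s) (is_derive_exp_neg_mul s u).
  have := is_deriveD (is_derive_cst (rho s) u 1) h.
  rewrite (_ : (_ + _)%R = (fun u => (1 - expR (- (u * s))) * rho s)).
    by move=> h'; apply: is_derive_eq; rewrite expr1; ring.
  by apply/funext => w; rewrite addrfctE /cst/=; ring.
- by move=> u; exact: tau_integrable.
- by move=> u s u0 /Rpos_gt0 s0; rewrite !mulr_ge0 ?exprn_ge0 ?expR_ge0 ?rho_ge0// ltW.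
- move=> u w s u0 uw /Rpos_gt0 s0; rewrite ler_wpM2r ?rho_ge0// ler_wpM2l//.
    by rewrite exprn_ge0// ltW.
  exact: exp_neg_antitone.
Qed.

Lemma tau_ge0 (q : nat) (v : R) : 0 <= tau rho q v.
Proof.
apply: Rintegral_ge0 => s /Rpos_gt0 s0.
by rewrite !mulr_ge0 ?exprn_ge0 ?expR_ge0 ?rho_ge0// ltW.
Qed.

Lemma tau_antitone (q : nat) (v w : R) : (0 < q)%N -> 0 < v -> v <= w ->
  tau rho q w <= tau rho q v.
Proof.
move=> q0 v0 vw; apply: le_Rintegral; first exact: Rpos_measurable.
- by apply: tau_integrable => //; exact: lt_le_trans vw.
- exact: tau_integrable.
- move=> s /Rpos_gt0 s0; rewrite ler_wpM2r ?rho_ge0// ler_wpM2l//.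
    by rewrite exprn_ge0// ltW.
  exact: exp_neg_antitone.
Qed.

Lemma psi_ge0 (v : R) : 0 <= v -> 0 <= psi rho v.
Proof.
move=> v0; apply: Rintegral_ge0 => s /Rpos_gt0 s0.
have /andP[h _] := one_sub_exp_bound v0 s0.
by rewrite mulr_ge0 ?rho_ge0.
Qed.

Lemma psi_monotone (v w : R) : 0 <= v -> v <= w -> psi rho v <= psi rho w.
Proof.
move=> v0 vw; apply: le_Rintegral; first exact: Rpos_measurable.
- exact: psi_integrable.
- by apply: psi_integrable; exact: le_trans vw.
- move=> s /Rpos_gt0 s0; rewrite ler_wpM2r ?rho_ge0// lerD2l lerN2.
  exact: exp_neg_antitone.
Qed.

Lemma psi0 : psi rho 0 = 0.
Proof.
rewrite /psi /int0oo (_ : (fun s => _) = cst 0) ?Rintegral_cst ?mul0r//.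
by apply/funext => s; rewrite mul0r oppr0 expR0 subrr mul0r.
Qed.

(** Links the real-valued [psi] to the extended integral that occurs in the Laplace functional. *)
Lemma psi_EFin (v : R) : 0 <= v -> (psi rho v)%:E =
  (\int[leb]_(s in Rpos) ((1 - expR (- (v * s))) * rho s)%:E)%E.
Proof.
move=> v0; rewrite /psi /int0oo /Rintegral fineK//.
exact: integrable_fin_num (psi_integrable v0).
Qed.

End levy_intensity.

(** * Partial Bell polynomials *)

Section bell_polynomials.
Context {R : realType}.

(* Partial Bell polynomial in [t 1], [t 2], ..: the sum over the partitions of
   an [n]-set into [i] blocks of the products of [t] of the block sizes. *)
Fixpoint bell (t : nat -> R) (i n : nat) : R :=
  if i is i'.+1 then
    \sum_(k < n) 'C(n.-1, k)%:R * t k.+1 * bell t i' (n.-1 - k)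
  else (n == 0)%:R.

Lemma bell_ge0 (t : nat -> R) i n : (forall q, 0 <= t q) -> 0 <= bell t i n.
Proof.
move=> t0; elim: i n => [|i ih] n /=; first by rewrite ler0n.
by apply: sumr_ge0 => k _; rewrite !mulr_ge0.
Qed.

Lemma bell_eq0 (t : nat -> R) i n : (n < i)%N -> bell t i n = 0.
Proof.
elim: i n => [//|i ih] [|n] ni /=; first by rewrite big_ord0.
rewrite big1// => k _; rewrite ih ?mulr0//.
by apply: leq_ltn_trans (leq_subr _ _) _.
Qed.

Lemma bell1 (t : nat -> R) : bell t 1 1 = t 1.
Proof. by rewrite /= big_ord1 /= bin0 mul1r mulr1. Qed.

(** Up to sign this is the [i]-th finite difference at 0 of a polynomial of degree [l]: zero for
    [l < i], and [i!] for [l = i]. Lowering [i] and [l] together rests on the absorption identity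
    [(j + 1) C(i + 1, j + 1) = (i + 1) C(i, j)]. *)
Lemma alternating_binomial_ffact (i l : nat) : (l <= i)%N ->
  \sum_(j < i.+1) (-1) ^+ j * 'C(i, j)%:R * (j ^_ l)%:R =
  (-1) ^+ l * (i == l)%:R * i`!%:R :> R.
Proof.
elim: l i => [|l ih] i li.
  have := exprDn (1 : R) (-1) i; rewrite subrr => e.
  rewrite expr0 mul1r; transitivity ((0 : R) ^+ i).
    rewrite e; apply: eq_bigr => j _.
    by rewrite expr1n mul1r ffactn0 mulr1 mulr_natr.
  by case: i {e li} => [|i]; rewrite ?expr0 ?mulr1// exprS !mul0r.
case: i li => // i li; rewrite big_ord_recl ffact0n mulr0 add0r.
transitivity (- i.+1%:R * \sum_(j < i.+1)
    (-1) ^+ j * 'C(i, j)%:R * (j ^_ l)%:R : R).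
  rewrite big_distrr/=; apply: eq_bigr => j _.
  rewrite /bump/= add1n ffactSS exprS.
  have : (j.+1%:R * 'C(i.+1, j.+1)%:R = i.+1%:R * 'C(i, j)%:R :> R).
    by rewrite -!natrM mul_bin_diag.
  rewrite natrM => e.
  transitivity (- (-1) ^+ j * (j.+1%:R * 'C(i.+1, j.+1)%:R) * (j ^_ l)%:R : R).
    by ring.
  by rewrite e; ring.
rewrite ih// factS natrM eqSS exprS; ring.
Qed.

End bell_polynomials.

Section bell_derivatives.
Context {R : realType} (psi : R -> R) (t : nat -> R -> R).
Context (dt : forall (q : nat) (v : R), (0 < q)%N -> 0 < v ->
    is_derive v 1 (t q) (- t q.+1 v)).
Context (dpsi : forall v : R, 0 < v -> is_derive v 1 psi (t 1 v)).
Local Notation b i n v := (bell (t ^~ v) i n).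

(** A point added to an [n]-set either forms a block of its own, which gives [t 1] times the
    polynomial with one block less, or joins an existing block. The latter raises one index of [t],
    as minus the derivative does. The two cases add up to the polynomial for [n.+1]. *)
Lemma bell_derive (i n : nat) (v : R) : 0 < v ->
  is_derive v 1 (fun u => b i n u)
    (t 1 v * (if i is i'.+1 then b i' n v else 0) - b i n.+1 v).
Proof.
move=> v0; elim: i n => [|i ih] n.
  rewrite mulr0 sub0r oppr0.
  exact: is_derive_cst.
have H : is_derive v 1 (fun u => \sum_(k < n) 'C(n.-1, k)%:R * t k.+1 u *
     b i (n.-1 - k) u)
  (\sum_(k < n) (('C(n.-1, k)%:R * - t k.+2 v) * b i (n.-1 - k) v +
     ('C(n.-1, k)%:R * t k.+1 v) *
      (t 1 v * (if i is i'.+1 then b i' (n.-1 - k) v else 0) -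
       b i (n.-1 - k).+1 v))).
  apply: (@is_derive_sumf _ n (fun k u => 'C(n.-1, k)%:R * t k.+1 u *
     b i (n.-1 - k) u) (fun k => ('C(n.-1, k)%:R * - t k.+2 v) * b i (n.-1 - k) v +
     ('C(n.-1, k)%:R * t k.+1 v) *
      (t 1 v * (if i is i'.+1 then b i' (n.-1 - k) v else 0) -
       b i (n.-1 - k).+1 v))) => k _.
  exact: (is_derive_mulf (is_derive_Zf _ (dt _ v0)) (ih _)).
refine (@is_derive_eq _ _ _ (fun u => b i.+1 n u) _ _ _ _ H _).
case: n {H} => [|n]; rewrite ?big_ord0 /=.
  rewrite big_ord1 bin0 mul1r; case: i {ih} => [|i] /=.
    by rewrite subrr.
  by rewrite !big_ord0 mulr0 subrr.
rewrite (eq_bigr (fun k : 'I_n.+1 =>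
    t 1 v * ('C(n, k)%:R * t k.+1 v *
      (if i is i'.+1 then b i' (n - k) v else 0)) -
    ('C(n, k)%:R * t k.+2 v * b i (n - k) v +
     'C(n, k)%:R * t k.+1 v * b i (n.+1 - k) v))); last first.
  move=> k _; rewrite -subSn; last by rewrite -ltnS.
  rewrite mulrN mulNr mulrBr [X in _ + (X - _)]mulrCA opprD.
  by rewrite addrCA.
rewrite big_split/= -big_distrr/= sumrN; congr (_ * _ - _).
  case: i {ih} => [|i]//=.
  by rewrite big1// => k _; rewrite mulr0.
rewrite big_split/= [RHS]big_ord_recl/= bin0 subn0 mul1r.
(* Pascal's rule: the added point lies in the distinguished block of the recursion, or outside
   it. *)
under [in RHS]eq_bigr do rewrite /bump/= add1n binS natrD !mulrDl subSS.
rewrite [in RHS]big_split/= addrA addrC; congr (_ + _).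
rewrite [LHS]big_ord_recl/= bin0 mul1r subn0; congr (_ + _).
by rewrite [RHS]big_ord_recr/= bin_small// !mul0r addr0.
Qed.

(** Faa di Bruno's formula for a power of [psi]. The derivative of order [q] of [psi] is [t q] up to
    the sign of [q - 1]; over [l] blocks of total size [n] the signs combine to that of [n - l]. *)
Lemma derive1n_powf (j n : nat) (v : R) : 0 < v ->
  derive1n n (fun u => psi u ^+ j) v =
  \sum_(l < j.+1) (j ^_ l)%:R * psi v ^+ (j - l) * ((-1) ^+ (n + l) * b l n v).
Proof.
elim: n v => [|n ih] v v0.
  rewrite derive1n0 big_ord_recl/= ffactn0 subn0 mul1r mulr1 mulr1.
  by rewrite big1 ?addr0// => l _; rewrite big_ord0 !mulr0.
rewrite derive1nS derive1E.
have pos : \forall u \near v, 0 < u by exact: lt_nbhsr.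
pose F u := \sum_(l < j.+1) (j ^_ l)%:R * psi u ^+ (j - l) *
  ((-1) ^+ (n + l) * b l n u).
(* The formula holds for [u > 0] only, so the induction hypothesis is used on a neighbourhood of
   [v]. *)
have FE : \forall u \near v, F u = derive1n n (fun u => psi u ^+ j) u.
  by apply: filterS pos => u /ih ->.
suff H : is_derive v 1 F (\sum_(l < j.+1) (j ^_ l)%:R * psi v ^+ (j - l) *
    ((-1) ^+ (n.+1 + l) * b l n.+1 v)).
  by have [_ ->] := near_eq_is_derive FE H.
have H : is_derive v 1 F (\sum_(l < j.+1)
    ((j ^_ l)%:R * ((j - l)%:R * psi v ^+ (j - l).-1 * t 1 v) *
       ((-1) ^+ (n + l) * b l n v) +
     (j ^_ l)%:R * psi v ^+ (j - l) * ((-1) ^+ (n + l) *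
       (t 1 v * (if val l is l'.+1 then b l' n v else 0) - b l n.+1 v)))).
  apply: (@is_derive_sumf _ j.+1 (fun l u => (j ^_ l)%:R * psi u ^+ (j - l) *
     ((-1) ^+ (n + l) * b l n u))
     (fun l => (j ^_ l)%:R * ((j - l)%:R * psi v ^+ (j - l).-1 * t 1 v) *
       ((-1) ^+ (n + l) * b l n v) +
     (j ^_ l)%:R * psi v ^+ (j - l) * ((-1) ^+ (n + l) *
       (t 1 v * (if l is l'.+1 then b l' n v else 0) - b l n.+1 v)))) => l _.
  exact: (is_derive_mulf (is_derive_Zf _ (is_derive_expf _ (dpsi v0)))
    (is_derive_Zf _ (bell_derive _ _ v0))).
apply: is_derive_eq H _.
(* Differentiating [psi ^+ (j - l)] raises the falling factorial to order [l.+1]. After a shift of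
   [l] these terms cancel the singleton terms of [bell_derive], which carry the opposite sign. *)
rewrite (eq_bigr (fun l : 'I_j.+1 =>
    ((j ^_ l.+1)%:R * psi v ^+ (j - l.+1) * (t 1 v * ((-1) ^+ (n + l) * b l n v)) +
     (j ^_ l)%:R * psi v ^+ (j - l) * ((-1) ^+ (n + l) *
       (t 1 v * (if val l is l'.+1 then b l' n v else 0)))) +
     (j ^_ l)%:R * psi v ^+ (j - l) * ((-1) ^+ (n.+1 + l) * b l n.+1 v))); last first.
  by move=> l _; rewrite ffactnSr natrM subnS addSn exprS; ring.
rewrite big_split/= [X in X + _](_ : _ = 0) ?add0r//.
rewrite big_split/= big_ord_recr/= ffact_small// !mul0r addr0.
rewrite [X in _ + X]big_ord_recl/= !mulr0 add0r -big_split/= big1// => l _.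
by rewrite /bump/= add1n addnS exprS; ring.
Qed.

(** Expanding the derivatives and exchanging the sums leaves, for each [l], the [i]-th finite
    difference of a falling factorial of degree [l], so only [l = i] survives. *)
Lemma bell_inversion (i n : nat) (v : R) : (i <= n)%N -> 0 < v ->
  (i`!%:R)^-1 * \sum_(0 <= j < i.+1)
    (-1) ^+ (n - j) * 'C(i, j)%:R * psi v ^+ (i - j) *
    derive1n n (fun u => psi u ^+ j) v = b i n v.
Proof.
move=> iltn v0; rewrite big_mkord.
transitivity ((i`!%:R)^-1 * \sum_(j < i.+1) \sum_(l < i.+1)
    ((-1) ^+ j * 'C(i, j)%:R * (j ^_ l)%:R) *
     (psi v ^+ (i - l) * ((-1) ^+ l * b l n v))).
  congr (_ * _); apply: eq_bigr => -[j /= ji] _; rewrite derive1n_powf//.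
  rewrite big_distrr/=.
  (* The range [l <= j] is extended to [l <= i]; the falling factorial [j ^_ l] vanishes on the
     added terms. *)
  rewrite (big_ord_widen _ (fun l => (-1) ^+ (n - j) * 'C(i, j)%:R *
    psi v ^+ (i - j) * ((j ^_ l)%:R * psi v ^+ (j - l) *
     ((-1) ^+ (n + l) * b l n v))) ji) big_mkcond/=.
  apply: eq_bigr => -[l /= li] _; case: ifPn => [lj|]; last first.
    by rewrite -leqNgt => lj; rewrite ffact_small// mulr0 mul0r.
  have -> : psi v ^+ (i - l) = psi v ^+ (i - j) * psi v ^+ (j - l).
    by rewrite -exprD; congr (_ ^+ _); rewrite addnBA// subnK.
  have -> : (-1) ^+ (n - j) = (-1) ^+ n * (-1) ^+ j :> R.
    by rewrite -signr_odd oddB ?(leq_trans _ iltn)// signr_addb !signr_odd.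
  rewrite exprD.
  have : (-1) ^+ n * (-1) ^+ n = 1 :> R by rewrite -exprD addnn -mul2n exprM sqrrN !expr1n.
  set e := (-1) ^+ n => ee.
  transitivity ((e * e) * ((-1) ^+ j * 'C(i, j)%:R * (j ^_ l)%:R *
     (psi v ^+ (i - j) * psi v ^+ (j - l) * ((-1) ^+ l * b l n v)))).
    by ring.
  by rewrite ee mul1r.
rewrite exchange_big/=.
rewrite (bigD1 ord_max)//= -big_distrl/= alternating_binomial_ffact// eqxx mulr1.
rewrite big1 ?addr0; last first.
  move=> [l /= li] /eqP lmax; rewrite -big_distrl/= alternating_binomial_ffact//.
  rewrite (_ : i == l = false) ?mulr0 ?mul0r//.
  by apply/eqP => il; apply: lmax; apply/val_inj.
rewrite subnn expr0 mul1r.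
have F0 : i`!%:R != 0 :> R by rewrite pnatr_eq0 -lt0n fact_gt0.
have : (-1) ^+ i * (-1) ^+ i = 1 :> R by rewrite -exprD addnn -mul2n exprM sqrrN !expr1n.
set e := (-1) ^+ i => ee.
transitivity ((e * e) * ((i`!%:R)^-1 * i`!%:R) * b i n v); first by ring.
by rewrite ee mulVf// !mul1r.
Qed.

(* [(-1)^n] times the [n]-th derivative of [exp (- a psi)]. *)
Definition exp_bell (a : R) (n : nat) (v : R) : R :=
  expR (- (a * psi v)) * \sum_(i < n.+1) a ^+ i * b i n v.

Lemma exp_bell0 a v : exp_bell a 0 v = expR (- (a * psi v)).
Proof. by rewrite /exp_bell big_ord1 expr0 !mulr1. Qed.

Lemma exp_bell_ge0 a n v : 0 <= a -> (forall q, 0 <= t q v) ->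
  0 <= exp_bell a n v.
Proof.
move=> a0 t0; rewrite mulr_ge0 ?expR_ge0// sumr_ge0// => i _.
by rewrite mulr_ge0 ?exprn_ge0// bell_ge0.
Qed.

(** The derivative [- a t 1] of the exponent cancels the singleton terms of [bell_derive], and what
    remains is of order [n.+1]. *)
Lemma exp_bell_derive (a : R) (n : nat) (v : R) : 0 < v ->
  is_derive v 1 (exp_bell a n) (- exp_bell a n.+1 v).
Proof.
move=> v0.
(* A zero term, [n.+1] blocks on [n] points, gives the sum the range of [exp_bell a n.+1]. *)
have -> : exp_bell a n = fun u => expR (- (a * psi u)) *
    \sum_(i < n.+2) a ^+ i * b i n u.
  apply/funext => u; rewrite /exp_bell; congr (_ * _).
  by rewrite [RHS]big_ord_recr/= -/(bell _ n.+1 n) bell_eq0// mulr0 addr0.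
have hE : is_derive v 1 (fun u => expR (- (a * psi u)))
    (expR (- (a * psi v)) * (- a * t 1 v)).
  have h1 : is_derive v 1 (fun u => - (a * psi u)) (- a * t 1 v).
    rewrite (_ : (fun u => _) = (fun u => - a * psi u)).
      exact: is_derive_Zf (dpsi v0).
    by apply/funext => u; rewrite mulNr.
  exact: (@is_derive1_comp R expR (fun u => - (a * psi u)) v _ _
    (is_derive_expR _) h1).
have hS : is_derive v 1 (fun u => \sum_(i < n.+2) a ^+ i * b i n u)
  (\sum_(i < n.+2) a ^+ i *
    (t 1 v * (if val i is i'.+1 then b i' n v else 0) - b i n.+1 v)).
  apply: (@is_derive_sumf _ n.+2 (fun i u => a ^+ i * b i n u)
    (fun i => a ^+ i *
      (t 1 v * (if i is i'.+1 then b i' n v else 0) - b i n.+1 v))) => i _.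
  exact: (is_derive_Zf _ (bell_derive _ _ v0)).
apply: is_derive_eq (is_derive_mulf hE hS) _.
rewrite /exp_bell -mulrA -mulrDr -[RHS]mulrN; congr (_ * _).
rewrite [X in _ * X + _]big_ord_recr/= -/(bell _ n.+1 n) bell_eq0// mulr0 addr0.
under [X in _ + X]eq_bigr do rewrite mulrBr.
rewrite big_split/= sumrN addrA [X in X - _](_ : _ = 0) ?sub0r//.
rewrite [X in _ + X]big_ord_recl/= !mulr0 add0r big_distrr/= -big_split/=.
by rewrite big1// => i _; rewrite exprS; ring.
Qed.

End bell_derivatives.

(** * The urn measure *)

Section urn_step.
Context {R : realType} {d} {T : measurableType d} (P : probability T R) (x0 : T).
Context (n : nat) (L : {finite_measure set (n.-tuple T) -> \bar R}).
Local Open Scope ereal_scope.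

Let pre := fun (i : nat) (x : n.-tuple T) =>
  [tuple of nth x0 (x0 :: x) i :: x] : n.+1.-tuple T.
Let new := fun (p : n.-tuple T * T) => [tuple of p.2 :: p.1] : n.+1.-tuple T.

Lemma measurable_nth_cons (i : nat) :
  measurable_fun setT (fun x : n.-tuple T => nth x0 (x0 :: x) i).
Proof.
case: i => [|i]; first exact: measurable_cst.
have [ni|ni] := ltnP i n.
  rewrite (_ : (fun _ => _) = fun x : n.-tuple T => tnth x (Ordinal ni)).
    exact: measurable_tnth.
  by apply/funext => x; rewrite (tnth_nth x0).
rewrite (_ : (fun _ => _) = cst x0); first exact: measurable_cst.
by apply/funext => x; rewrite /= nth_default// size_tuple.
Qed.

Let mpre i : measurable_fun setT (pre i).
Proof. by apply: measurable_cons => //; exact: measurable_nth_cons. Qed.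

Let mnew : measurable_fun setT new.
Proof. by apply: measurable_cons. Qed.

Let push_new : {measure set (n.+1.-tuple T) -> \bar R} :=
  measure_function_pushforward__canonical__measure_function_Measure
    (L \x P) mnew.
Let push_pre (i : nat) : {measure set (n.+1.-tuple T) -> \bar R} :=
  measure_function_pushforward__canonical__measure_function_Measure L (mpre i).

(** One step of an unnormalised urn: unit weight on a draw from [P] and on each of the [n.+1]
    entries of [x0 :: x], the seed included. The new point becomes the head of the tuple. *)
Definition urn_measure : set (n.+1.-tuple T) -> \bar R :=
  measure_add push_new (msum push_pre n.+1).

HB.instance Definition _ := Measure.on urn_measure.

Let urn_measure_finite : fin_num_fun urn_measure.
Proof.
move=> A mA; rewrite /urn_measure measure_addE/=.
have fin_push (D : set (n.-tuple T)) : measurable D -> L D \is a fin_num.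
  by move=> mD; exact: fin_num_measure.
rewrite fin_numD; apply/andP; split.
  have mA' : measurable (new @^-1` A) by rewrite -[X in measurable X]setTI; exact: mnew.
  have h1 : (L \x P) (new @^-1` A) <= (L \x P) setT.
    by apply: le_measure; rewrite ?inE.
  have h2 : (L \x P) setT < +oo.
    rewrite -setXTT product_measure1E//.
    by rewrite [X in _ * X](_ : _ = 1) ?mule1 ?ltey_eq ?fin_push//; exact: probability_setT.
  by rewrite ge0_fin_numE; [exact: le_lt_trans h2|exact: (measure_ge0 (L \x P))].
rewrite /msum; apply/sum_fin_numP => i _ _; apply: fin_push.
by rewrite -[X in measurable X]setTI; exact: mpre.
Qed.

HB.instance Definition _ :=
  Measure_isFinite.Build _ _ _ urn_measure urn_measure_finite.

Lemma integral_urn_measure (F : n.+1.-tuple T -> \bar R) :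
  measurable_fun setT F -> (forall x, 0 <= F x) ->
  \int[urn_measure]_x F x = \int[L]_x (\int[P]_y F [tuple of y :: x] +
    \sum_(i < n.+1) F [tuple of nth x0 (x0 :: x) i :: x]).
Proof.
move=> mF F0; rewrite /urn_measure ge0_integral_measure_add//.
rewrite ge0_integral_measure_sum//.
have mFp i : measurable_fun setT (F \o pre i) by exact: measurableT_comp.
have mFn : measurable_fun setT (F \o new) by exact: measurableT_comp.
have -> : \int[push_new]_x F x = \int[L]_x \int[P]_y F [tuple of y :: x].
  rewrite (ge0_integral_pushforward mnew)// preimage_setT.
  by rewrite (fubini_tonelli1 (F \o new))// => z; exact: F0.
have -> : \sum_(i < n.+1) \int[push_pre i]_x F x =
    \sum_(i < n.+1) \int[L]_x F (pre i x).
  apply: eq_bigr => i _.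
  by rewrite (ge0_integral_pushforward (mpre i))// preimage_setT.
rewrite [RHS]ge0_integralD//.
- by rewrite ge0_integral_sum//; move=> i; exact: mFp.
- by move=> x _; apply: integral_ge0 => y _; exact: F0.
- apply: (@measurable_fun_fubini_tonelli_F _ _ _ _ _ P (F \o new)) => //.
  by move=> z; exact: F0.
- by move=> x _; apply: sume_ge0.
- by apply: emeasurable_sum => i; exact: mFp.
Qed.

End urn_step.

(** * Measurability of products over the distinct values of a list *)

Section measurable_undup.
Context {R : realType} {X : ptopologicalType} (hX : polish R X).
Context {d} {T : measurableType d}.
Implicit Types (fs : seq (T -> borel X)).

Lemma measurable_count fs (f : T -> borel X) :
  (forall h, h \in fs -> measurable_fun setT h) -> measurable_fun setT f ->
  measurable_fun setT (fun t => count_mem (f t) [seq h t | h <- fs]).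
Proof.
elim: fs => [|h fs ih] mfs mf /=; first exact: measurable_cst.
apply: measurable_fun_addn; last first.
  by apply: ih => // h' h'fs; apply: mfs; rewrite inE h'fs orbT.
have mb : measurable_fun setT (fun t => h t == f t).
  by apply: (measurable_eqb_fun hX) => //; apply: mfs; rewrite mem_head.
rewrite (_ : (fun t => nat_of_bool _) = fun t => if h t == f t then 1%N else 0%N).
  by apply: measurable_fun_ifT => //; exact: measurable_cst.
by apply/funext => t; case: eqP.
Qed.

Lemma measurable_mem fs (f : T -> borel X) :
  (forall h, h \in fs -> measurable_fun setT h) -> measurable_fun setT f ->
  measurable_fun setT (fun t => f t \in [seq h t | h <- fs]).
Proof.
elim: fs => [|h fs ih] mfs mf /=; first exact: measurable_cst.
under eq_fun do rewrite inE.
apply: measurable_or.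
  by apply: (measurable_eqb_fun hX) => //; apply: mfs; rewrite mem_head.
by apply: ih => // h' h'fs; apply: mfs; rewrite inE h'fs orbT.
Qed.

Lemma measurable_prod_undup fs (W : T -> borel X -> nat -> R) :
  (forall h, h \in fs -> measurable_fun setT h) ->
  (forall h q, measurable_fun setT h -> measurable_fun setT (fun t => W t (h t) q)) ->
  measurable_fun setT (fun t => \prod_(z <- undup [seq h t | h <- fs])
    W t z (count_mem z [seq h t | h <- fs])).
Proof.
move=> mfs mW; have sfs : {subset fs <= fs} by [].
(* Only the list under [undup] shrinks in the induction; multiplicities keep referring to the whole
   list. *)
elim: {1 3}fs sfs => [|h gs ih] sgs /=.
  rewrite (_ : (fun t => _) = cst 1); first exact: measurable_cst.
  by apply/funext => t; rewrite big_nil.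
have mgs h' : h' \in gs -> measurable_fun setT h'.
  by move=> h'gs; apply/mfs/sgs; rewrite inE h'gs orbT.
have mh : measurable_fun setT h by apply/mfs/sgs; rewrite mem_head.
rewrite (_ : (fun t => _) = fun t =>
    (if h t \in [seq h t | h <- gs] then 1
     else W t (h t) (count_mem (h t) [seq h t | h <- fs])) *
    \prod_(z <- undup [seq h t | h <- gs])
      W t z (count_mem z [seq h t | h <- fs])); last first.
  by apply/funext => t; case: ifP; rewrite ?mul1r// big_cons.
apply: measurable_funM; last first.
  by apply: ih => h' h'gs; apply: sgs; rewrite inE h'gs orbT.
apply: measurable_fun_ifT; [exact: measurable_mem|exact: measurable_cst|].
apply: (measurable_fun_nat_select (F := fun q t => W t (h t) q)).
  exact: measurable_count.
by move=> q; exact: mW.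
Qed.

End measurable_undup.

(** * The gamma integral *)

Section gamma_integral.
Context {R : realType}.
Local Notation leb := (@lebesgue_measure R).

Lemma cvg_expn_mul_exp (n : nat) (x : R) : 0 < x ->
  u ^+ n * expR (- (u * x)) @[u --> +oo] --> (0 : R).
Proof.
(* The term of degree [n.+1] of the exponential series yields the bound [C / u]. *)
move=> x0; pose C := (n.+1)`!%:R / x ^+ n.+1.
have C0 : 0 <= C by rewrite divr_ge0// exprn_ge0// ltW.
apply: (@squeeze_cvgr _ _ _ _ (fun=> 0) (fun u : R => C * u^-1)).
- near=> u; have u0 : 0 < u by near: u; exact: nbhs_pinfty_gt.
  have ux0 : 0 <= u * x by rewrite mulr_ge0 ?ltW.
  rewrite mulr_ge0 ?expR_ge0 ?exprn_ge0 ?(ltW u0)//=.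
  rewrite expRN ler_pdivrMr ?expR_gt0//.
  have F0 : (n.+1)`!%:R != 0 :> R by rewrite pnatr_eq0 -lt0n fact_gt0.
  have u_neq0 : u != 0 by rewrite gt_eqF.
  have X0 : x ^+ n.+1 != 0 by rewrite expf_neq0// gt_eqF.
  have -> : u ^+ n = C / u * ((u * x) ^+ n.+1 / (n.+1)`!%:R).
    rewrite /C exprMn [u ^+ n.+1]exprS; move: F0 X0.
    set F := (n.+1)`!%:R; set X := x ^+ n.+1; set U := u ^+ n => F0 X0.
    by field; rewrite F0 X0 u_neq0.
  apply: ler_wpM2l; first by rewrite divr_ge0// ltW.
  by have := expR_ge1Dxn n ux0; apply: le_trans; rewrite lerDr.
- exact: cvg_cst.
- rewrite -(mulr0 C); apply: cvgM; first exact: cvg_cst.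
  apply/gtr0_cvgV0; [exact: nbhs_pinfty_gt|exact: cvg_id].
Unshelve. all: by end_near. Qed.

(** Repeated integration by parts of [u ^+ n * exp (- u x)]; this primitive vanishes at infinity. *)
Fixpoint gamma_primitive (n : nat) (x u : R) : R :=
  if n is m.+1 then
    - (x^-1) * (u ^+ n * expR (- (u * x))) + n%:R / x * gamma_primitive m x u
  else - (x^-1) * expR (- (u * x)).

Lemma gamma_primitive_derive n (x u : R) : 0 < x ->
  is_derive u 1 (gamma_primitive n x) (u ^+ n * expR (- (u * x))).
Proof.
move=> x0; elim: n => [|n ih].
  have := is_derive_Zf (- x^-1) (is_derive_exp_neg_mul x u).
  by rewrite mulrNN mulKf ?gt_eqF// mul1r.
have hX : is_derive u 1 (fun v : R => v ^+ n.+1) (n.+1%:R * u ^+ n).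
  have := is_derive_expf n.+1 (is_derive_id u 1).
  by rewrite mulr1.
have h := is_derive_mulf hX (is_derive_exp_neg_mul x u).
have := is_deriveD (is_derive_Zf (- x^-1) h) (is_derive_Zf (n.+1%:R / x) ih).
move=> h'; apply: is_derive_eq h' _.
have xx : x^-1 * x = 1 by rewrite mulVf// gt_eqF.
transitivity (x^-1 * x * (u ^+ n.+1 * expR (- (u * x)))); last by rewrite xx mul1r.
by ring.
Qed.

Lemma gamma_primitive0 n (x : R) :
  gamma_primitive n x 0 = - (n`!%:R / x ^+ n.+1).
Proof.
elim: n => [|n ih] /=; rewrite mul0r oppr0 expR0.
  by rewrite mulr1 expr1 mul1r.
by rewrite ih exprS mul0r mul0r mulr0 add0r factS natrM [x ^+ n.+2]exprS invfM; ring.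
Qed.

Lemma gamma_primitive_cvg n (x : R) : 0 < x ->
  gamma_primitive n x u @[u --> +oo] --> (0 : R).
Proof.
move=> x0; elim: n => [|n ih] /=.
  rewrite -[X in _ --> X](mulr0 (- x^-1)); apply: cvgM; first exact: cvg_cst.
  have := @cvg_expn_mul_exp 0 x x0.
  by under eq_fun do rewrite mul1r.
have -> : (0 : R) = - x^-1 * 0 + n.+1%:R / x * 0 by rewrite !mulr0 addr0.
apply: cvgD; apply: cvgM => //; try exact: cvg_cst.
exact: cvg_expn_mul_exp.
Qed.

Lemma gamma_integral (n : nat) (x : R) : 0 < x ->
  (\int[leb]_(u in `]0%R, +oo[) (u ^+ n * expR (- (u * x)))%:E =
   (n`!%:R / x ^+ n.+1)%:E)%E.
Proof.
move=> x0.
have cf : continuous (fun u : R => u ^+ n * expR (- (u * x))).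
  move=> u; apply: cvgM; first exact: exprn_continuous.
  exact: (derivative_differentiable (is_derive_exp_neg_mul x u)).
rewrite integral_itv_obnd_cbnd; last first.
  apply/measurable_EFinP; apply: measurable_funTS.
  exact: continuous_measurable_fun.
rewrite (@ge0_continuous_FTC2y _ _ (gamma_primitive n x) 0 0).
- by rewrite gamma_primitive0 sub0e -EFinN opprK.
- by move=> u u0; rewrite mulr_ge0 ?expR_ge0 ?exprn_ge0.
- exact: continuous_subspaceT.
- exact: gamma_primitive_cvg.
- by move=> u _; have [] := gamma_primitive_derive n u x0.
- apply: cvg_at_right_filter.
  exact: (derivative_differentiable (gamma_primitive_derive n 0 x0)).
- by move=> u _; rewrite derive1E; have [_ ->] := gamma_primitive_derive n u x0.
Qed.

End gamma_integral.

(** * The urn density *)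

Section urn_density.
Context {R : realType} {X : ptopologicalType} (hX : polish R X) (rho : R -> R).
Context (rho_meas : measurable_fun [set s : R | 0 < s] rho)
  (rho_ge0 : forall s : R, 0 < s -> 0 <= rho s)
  (rho_levy : (\int[@lebesgue_measure R]_(s in `]0%R, +oo[)
                 (Num.min 1%R s * rho s)%:E < +oo)%E).
Context (c zeta : R) (c_gt0 : 0 < c) (zeta01 : 0 < zeta < 1).
Context (x0 : borel X) (Pstar : probability (borel X) R).
Local Notation leb := (@lebesgue_measure R).
Local Notation Rpos := (`]0%R, +oo[%classic : set R).
Local Notation psi := (psi rho).
Local Notation tau := (tau rho).
Local Notation b := (c * (1 - zeta)).

Let b_ge0 : 0 <= b.
Proof. by case/andP: zeta01 => _ z1; rewrite mulr_ge0 ?(ltW c_gt0)// subr_ge0 ltW. Qed.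

Let a_ge0 : 0 <= c * zeta.
Proof. by case/andP: zeta01 => z0 _; rewrite mulr_ge0 ?(ltW c_gt0)// ltW. Qed.

(* Contribution of a location [z] carrying [p.+1] points when [z] is not [x0],
   and [p] points when [z] is [x0]. *)
Definition site_weight (z : borel X) (p : nat) (v : R) : R :=
  (if z == x0 then exp_bell psi tau (c * zeta) p v else b * tau p.+1 v) / p`!%:R.

(** Division by [p!] turns a raise of the order into the factor [p.+1], the number of entries of the
    seeded list at this site and hence of urn moves that repeat it. *)
Lemma site_weight_derive z p (v : R) : 0 < v ->
  is_derive v 1 (site_weight z p) (- (p.+1%:R * site_weight z p.+1 v)).
Proof.
move=> v0; have P0 : p`!%:R != 0 :> R by rewrite pnatr_eq0 -lt0n fact_gt0.
have Q0 : p.+1%:R != 0 :> R by rewrite pnatr_eq0.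
have E (y : R) : - (p.+1%:R * (y / p.+1`!%:R)) = (p`!%:R)^-1 * - y.
  by rewrite factS natrM invfM; field; rewrite nat1r P0 Q0.
rewrite /site_weight E; case: eqP => _.
  have := is_derive_Zf (p`!%:R)^-1 (exp_bell_derive
    (fun q v => tau_derive rho_meas rho_ge0 rho_levy (q := q) (v := v))
    (psi_derive rho_meas rho_ge0 rho_levy) (c * zeta) p v0).
  by under [X in is_derive _ _ X _]eq_fun do rewrite mulrC.
have := is_derive_Zf (p`!%:R)^-1 (is_derive_Zf b
   (tau_derive rho_meas rho_ge0 rho_levy (ltn0Sn p) v0)).
by rewrite mulrN; under [X in is_derive _ _ X _]eq_fun do rewrite mulrC.
Qed.

Lemma site_weight_ge0 z p (v : R) : 0 <= site_weight z p v.
Proof.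
rewrite divr_ge0//; case: ifP => _.
  by apply: exp_bell_ge0 => // q; exact: tau_ge0.
by rewrite mulr_ge0// tau_ge0.
Qed.

Lemma site_weight_antitone z p (v v' : R) : 0 < v -> v <= v' ->
  site_weight z p v' <= site_weight z p v.
Proof.
move=> v0; rewrite le_eqVlt => /predU1P[->//|vv'].
have t0 : 0 < v' - v by rewrite subr_gt0.
have [y _ e] := mvt_gt0 (site_weight_derive z p) v0 t0.
rewrite subrKC in e; rewrite -subr_ge0 e.
apply: mulr_ge0; last exact: ltW.
by apply: mulr_ge0; [exact: ler0n|exact: site_weight_ge0].
Qed.

Lemma site_weight_quotients z p (v : R) : 0 < v ->
  convex_quotients (site_weight z p v)
    (fun k => site_weight z p (v + k.+1%:R^-1)) (p.+1%:R * site_weight z p.+1 v).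
Proof.
move=> v0; apply: (convex_quotients_derive (site_weight_derive z p)).
- by move=> u _; exact: site_weight_ge0.
- by move=> u _; apply: mulr_ge0; [exact: ler0n|exact: site_weight_ge0].
- move=> u w u0 uw; apply: ler_wpM2l; first exact: ler0n.
  exact: site_weight_antitone.
- exact: v0.
Qed.

Lemma measurable_comp_gt0 {d} {T : measurableType d} (f : R -> R) (g : T -> R) :
  measurable_fun Rpos f -> measurable_fun setT g -> (forall y, 0 < g y) ->
  measurable_fun setT (fun y => f (g y)).
Proof.
move=> mf mg g0; apply: (measurable_comp (F := Rpos)) => //.
by move=> _ [y _ <-]; rewrite /= in_itv/= g0.
Qed.

Lemma psi_measurable : measurable_fun Rpos psi.
Proof.
apply: differentiable_measurable_gt0 => v v0.
by exists (tau 1 v); exact: psi_derive.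
Qed.

Lemma tau_measurable q : (0 < q)%N -> measurable_fun Rpos (tau q).
Proof.
move=> q0; apply: differentiable_measurable_gt0 => v v0.
by exists (- tau q.+1 v); exact: tau_derive.
Qed.

(** The lower bound [u] is explicit because it controls [tau 1 (g y)] and makes the Laplace factor
    at most [exp (- u T)] for the total mass [T]; it survives adding indicators to [g]. The upper
    bound keeps [psi (g y)] bounded and the integral of [g] against [mu] finite. *)
Definition admissible (g : borel X -> R) (u : R) :=
  [/\ measurable_fun setT g, 0 < u & exists K, forall x, u <= g x <= K].

Lemma admissible_gt0 g u x : admissible g u -> 0 < g x.
Proof. by move=> [_ u0 [K /(_ x) /andP[ug _]]]; exact: lt_le_trans ug. Qed.

Lemma admissible_shift g u (A : set (borel X)) (t : R) : measurable A ->
  0 <= t -> admissible g u -> admissible (fun x => g x + t * \1_A x) u.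
Proof.
move=> mA t0 [mg u0 [K ugK]]; split=> //.
  apply: measurable_funD => //; apply: measurable_funM => //.
exists (K + t) => x; have /andP[ug gK] := ugK x.
have i0 : 0 <= \1_A x :> R by [].
have i1 : \1_A x <= 1 :> R by rewrite indicE lern1; case: (_ \in _).
rewrite (le_trans ug) ?lerDl ?mulr_ge0//= lerD//.
by rewrite -[leRHS]mulr1 ler_wpM2l.
Qed.

Lemma bounded_integrable (f : borel X -> R) (K : R) (B : set (borel X)) :
  measurable B -> measurable_fun B f -> (forall y, B y -> 0 <= f y <= K) ->
  Pstar.-integrable B (EFin \o f).
Proof.
move=> mB mf fK; apply: measurable_bounded_integrable => //.
  by rewrite (le_lt_trans (probability_le1 _ mB))// ltry.
exists K; split; first exact: num_real.
move=> M KM y By /=; have /andP[f0 fK'] := fK y By.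
by rewrite ger0_norm// (le_trans fK')// ltW.
Qed.

Lemma psi_comp_integrable g u : admissible g u ->
  Pstar.-integrable setT (EFin \o (fun y => psi (g y))).
Proof.
move=> gu; have [mg u0 [K ugK]] := gu.
apply: (@bounded_integrable _ (psi K)) => //.
  apply: measurable_comp_gt0 => //; first exact: psi_measurable.
  by move=> y; exact: admissible_gt0 gu.
move=> y _; have g0 := admissible_gt0 y gu; have /andP[_ gK] := ugK y.
apply/andP; split; first by apply: psi_ge0 => //; exact: ltW.
by apply: psi_monotone => //; exact: ltW.
Qed.

Definition bulk_weight (g : borel X -> R) : R :=
  expR (- (b * (\int[Pstar]_y psi (g y))%R)).

Lemma bulk_weight_ge0 g : 0 <= bulk_weight g.
Proof. exact: expR_ge0. Qed.

Lemma bulk_weight_quotients g u A : admissible g u -> measurable A ->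
  convex_quotients (bulk_weight g)
    (fun k => bulk_weight (fun x => g x + k.+1%:R^-1 * \1_A x))
    (b * (\int[Pstar]_(y in A) tau 1 (g y))%R * bulk_weight g).
Proof.
move=> gu mA; have [mg u0 [K ugK]] := gu.
(* The shift is parametrised so that [g] sits at [v = u], inside the half-line on which the
   derivative exists. As [g >= u], one has [G v >= min(u, v)]. *)
pose G (v : R) (x : borel X) := g x + (v - u) * \1_A x.
have Gadm (v : R) : 0 < v -> admissible (G v) (Num.min u v).
  move=> v0; split.
  - by apply: measurable_funD => //; apply: measurable_funM.
  - by rewrite lt_min u0.
  - exists (K + v) => x; have /andP[ug gK] := ugK x.
    rewrite /G indicE; case: (_ \in _).
      by rewrite mulr1 ge_min; apply/andP; split; [apply/orP; right|]; lra.
    by rewrite mulr0 addr0 ge_min ug/=; lra.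
have i_ge0 y : 0 <= \1_A y :> R by [].
have tauG_anti (v v' : R) y : 0 < v -> v <= v' ->
    \1_A y * tau 1 (G v' y) <= \1_A y * tau 1 (G v y).
  move=> v0 vv'; apply: ler_wpM2l; first exact: i_ge0.
  apply: (tau_antitone rho_meas rho_ge0 rho_levy (q := 1%N)); [by []|exact: admissible_gt0 (Gadm v v0)|].
  by rewrite /G lerD2l ler_wpM2r// lerD2r.
have tauI (v : R) : 0 < v ->
    Pstar.-integrable setT (EFin \o (fun y => \1_A y * tau 1 (G v y))).
  move=> v0; have adm := Gadm v v0.
  apply: (@bounded_integrable _ (tau 1 (Num.min u v))) => //.
    apply: measurable_funM => //; apply: measurable_comp_gt0.
    - exact: tau_measurable.
    - by case: adm.
    - by move=> y; exact: admissible_gt0 adm.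
  move=> y _; have [_ m0 [K' /(_ y)/andP[mG _]]] := adm.
  have h : tau 1 (G v y) <= tau 1 (Num.min u v) by exact: tau_antitone.
  rewrite indicE; case: (_ \in _); first by rewrite mul1r h andbT tau_ge0.
  by rewrite mul0r lexx tau_ge0.
have dI (v : R) : 0 < v -> is_derive v 1 (fun v => (\int[Pstar]_y psi (G v y))%R)
    (1 * (\int[Pstar]_y (\1_A y * tau 1 (G v y)))%R).
  move=> v0; pose f (v : R) y := psi (G v y).
  pose f' (v : R) y := \1_A y * tau 1 (G v y).
  have h1 (w : R) : 0 < w -> Pstar.-integrable setT (EFin \o f w).
    by move=> w0; exact: psi_comp_integrable (Gadm w w0).
  have h2 (w : R) y : 0 < w -> setT y -> is_derive w 1 (f ^~ y) (1 * f' w y).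
    move=> w0 _; have adm := Gadm w w0.
    have h := psi_derive rho_meas rho_ge0 rho_levy (admissible_gt0 y adm).
    have h2 : is_derive w 1 (G ^~ y) (\1_A y).
      have := is_deriveD (is_derive_cst (g y - u * \1_A y) w 1)
        (is_derive_Zf (\1_A y) (is_derive_id w 1)).
      rewrite add0r mulr1 (_ : (_ + _)%R = G ^~ y)//.
      by apply/funext => x; rewrite addrfctE /cst /G/=; ring.
    have := @is_derive1_comp R psi (G ^~ y) w _ _ h h2.
    by rewrite mul1r mulrC.
  have h3 (w : R) y : 0 < w -> setT y -> 0 <= f' w y.
    by move=> _ _; apply: mulr_ge0 => //; exact: tau_ge0.
  have h4 (w w' : R) y : 0 < w -> w <= w' -> setT y -> f' w' y <= f' w y.
    by move=> w0 ww' _; exact: tauG_anti.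
  exact: (is_derive_antitone_integral measurableT h1 h2 tauI h3 h4 v0).
set I1 := fun v : R => (\int[Pstar]_y (\1_A y * tau 1 (G v y)))%R in dI.
have I1_ge0 (v : R) : 0 <= I1 v.
  by apply: Rintegral_ge0 => y _; rewrite mulr_ge0// tau_ge0.
have I1_anti (v v' : R) : 0 < v -> v <= v' -> I1 v' <= I1 v.
  move=> v0 vv'; apply: (le_Rintegral measurableT).
  - by apply: tauI; exact: lt_le_trans vv'.
  - exact: tauI.
  - by move=> y _; exact: tauG_anti.
have dB (v : R) : 0 < v ->
    is_derive v 1 (fun v => bulk_weight (G v)) (- (b * I1 v * bulk_weight (G v))).
  move=> v0; have h := is_derive_Zf (- b) (dI v v0).
  have := @is_derive1_comp R expR _ v _ _ (is_derive_expR _) h.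
  rewrite (_ : expR \o _ = fun v => bulk_weight (G v)); last first.
    by apply/funext => w; rewrite /bulk_weight/= mulNr.
  by move=> h'; apply: is_derive_eq h' _; rewrite /bulk_weight mul1r mulNr -/(I1 v); ring.
have b_anti (v v' : R) : 0 < v -> v <= v' ->
    bulk_weight (G v') <= bulk_weight (G v).
  move=> v0; rewrite le_eqVlt => /predU1P[->//|vv'].
  have t0 : 0 < v' - v by rewrite subr_gt0.
  have [y _ e] := mvt_gt0 dB v0 t0.
  rewrite subrKC in e; rewrite -subr_ge0 e.
  apply: mulr_ge0; last exact: ltW.
  by apply: mulr_ge0; [apply: mulr_ge0; [exact: b_ge0|exact: I1_ge0]|exact: bulk_weight_ge0].
have -> : (\int[Pstar]_(y in A) tau 1 (g y))%R = I1 u.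
  rewrite Rintegral_mkcond; apply: eq_Rintegral => y _.
  rewrite patchE indicE /G subrr mul0r addr0.
  by case: (y \in A); rewrite ?mul1r ?mul0r.
have Gu : G u = g by apply/funext => x; rewrite /G subrr mul0r addr0.
have -> : (fun k => bulk_weight (fun x => g x + k.+1%:R^-1 * \1_A x)) =
    (fun k => bulk_weight (G (u + k.+1%:R^-1))).
  by apply/funext => k; congr bulk_weight; apply/funext => x; rewrite /G addrAC subrr add0r.
have := convex_quotients_derive dB _ _ _ u0.
rewrite Gu; apply.
- by move=> v _; exact: bulk_weight_ge0.
- by move=> v _; apply: mulr_ge0; [apply: mulr_ge0; [exact: b_ge0|exact: I1_ge0]|exact: bulk_weight_ge0].
- move=> v v' v0 vv'; apply: ler_pM.
  + by apply: mulr_ge0; [exact: b_ge0|exact: I1_ge0].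
  + exact: bulk_weight_ge0.
  + by apply: ler_wpM2l; [exact: b_ge0|exact: I1_anti].
  + exact: b_anti.
Qed.

(** The predecessor fits both cases of [site_weight], because the seed adds one to the multiplicity
    of [x0]. *)
Definition sites_weight (s : seq (borel X)) (g : borel X -> R) : R :=
  \prod_(z <- undup s) site_weight z (count_mem z s).-1 (g z).

Definition urn_density (s : seq (borel X)) (g : borel X -> R) : R :=
  bulk_weight g * sites_weight s g.

Lemma sites_weight_ge0 s g : 0 <= sites_weight s g.
Proof. by apply: prodr_ge0 => z _; exact: site_weight_ge0. Qed.

Lemma urn_density_ge0 s g : 0 <= urn_density s g.
Proof. by apply: mulr_ge0; [exact: bulk_weight_ge0|exact: sites_weight_ge0]. Qed.

Lemma urn_density_perm s s' g : perm_eq s s' -> urn_density s g = urn_density s' g.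
Proof.
move=> ss'; congr (_ * _); rewrite /sites_weight.
rewrite (perm_big _ (perm_undup (perm_mem ss'))); apply: eq_bigr => z _.
by move/seq.permP : ss' => ->.
Qed.

Lemma sites_weight_new y s g : y \notin s -> y != x0 ->
  sites_weight (y :: s) g = b * tau 1 (g y) * sites_weight s g.
Proof.
move=> ys yx0; rewrite /sites_weight/= (negbTE ys) big_cons eqxx; congr (_ * _).
  by rewrite /site_weight (negbTE yx0) (count_memPn ys) divr1.
rewrite [LHS]big_seq [RHS]big_seq; apply: eq_bigr => z; rewrite mem_undup => zs.
by rewrite (_ : y == z = false)//; apply: contraNF ys => /eqP ->.
Qed.

Lemma sites_weight_old z s g : z \in s ->
  sites_weight (z :: s) g = site_weight z (count_mem z s) (g z) *
    \prod_(y <- undup s | y != z) site_weight y (count_mem y s).-1 (g y).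
Proof.
move=> zs; rewrite /sites_weight/= zs (bigD1_seq z) ?mem_undup ?undup_uniq//=.
rewrite eqxx add1n; congr (_ * _); apply: eq_bigr => y yz.
by rewrite eq_sym (negbTE yz).
Qed.

Lemma measurable_site_weight {d} {T : measurableType d} (h : T -> borel X)
    (v : T -> R) p : measurable_fun setT h -> measurable_fun setT v ->
  (forall t, 0 < v t) -> measurable_fun setT (fun t => site_weight (h t) p (v t)).
Proof.
move=> mh mv v0; rewrite /site_weight; apply: measurable_funM => //.
apply: measurable_fun_ifT.
- by apply: (measurable_eqb_fun hX) => //; exact: measurable_cst.
- apply: measurable_comp_gt0 => //.
  apply: differentiable_measurable_gt0 => u u0.
  exists (- exp_bell psi tau (c * zeta) p.+1 u).
  exact: (exp_bell_derive
    (fun q w => tau_derive rho_meas rho_ge0 rho_levy (q := q) (v := w))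
    (psi_derive rho_meas rho_ge0 rho_levy) (c * zeta) p u0).
- apply: measurable_funM; first exact: measurable_cst.
  by apply: measurable_comp_gt0 => //; exact: tau_measurable.
Qed.

Lemma measurable_sites_weight {d} {T : measurableType d}
    (fs : seq (T -> borel X)) (g : T -> borel X -> R) :
  (forall h, h \in fs -> measurable_fun setT h) ->
  (forall h, measurable_fun setT h -> measurable_fun setT (fun t => g t (h t))) ->
  (forall t z, 0 < g t z) ->
  measurable_fun setT (fun t => sites_weight [seq h t | h <- fs] (g t)).
Proof.
move=> mfs mg g0.
apply: (measurable_prod_undup hX (W := fun t z q => site_weight z q.-1 (g t z))) => //.
by move=> h q mh; apply: measurable_site_weight => //; exact: mg.
Qed.

(** Minus the derivative of [urn_density s] at [g] in the direction of the indicator of [A], by the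
    product rule. *)
Definition urn_density_drift (s : seq (borel X)) (g : borel X -> R)
    (A : set (borel X)) : R :=
  bulk_weight g * (\sum_(z <- undup s) (\1_A z * ((count_mem z s)%:R *
      site_weight z (count_mem z s) (g z))) *
    \prod_(y <- undup s | y != z) site_weight y (count_mem y s).-1 (g y)) +
  sites_weight s g * (b * (\int[Pstar]_(y in A) tau 1 (g y))%R * bulk_weight g).

Lemma urn_density_quotients s g u A : admissible g u -> measurable A ->
  convex_quotients (urn_density s g)
    (fun k => urn_density s (fun x => g x + k.+1%:R^-1 * \1_A x))
    (urn_density_drift s g A).
Proof.
move=> gu mA; apply: convex_quotientsM; first exact: bulk_weight_quotients gu mA.
apply: (@convex_quotients_prod _ _ (undup s)
  (fun z => site_weight z (count_mem z s).-1 (g z))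
  (fun z k => site_weight z (count_mem z s).-1 (g z + k.+1%:R^-1 * \1_A z))
  (fun z => \1_A z * ((count_mem z s)%:R * site_weight z (count_mem z s) (g z)))).
  exact: undup_uniq.
move=> z; rewrite mem_undup => zs.
have c0 : (0 < count_mem z s)%N by rewrite -has_count has_pred1.
rewrite indicE; case: (z \in A).
  rewrite mul1r (_ : (fun k => _) =
      fun k => site_weight z (count_mem z s).-1 (g z + k.+1%:R^-1)).
    have := site_weight_quotients z (count_mem z s).-1 (admissible_gt0 z gu).
    by rewrite prednK.
  by apply/funext => k; rewrite mulr1.
rewrite mul0r (_ : (fun k => _) = fun=> site_weight z (count_mem z s).-1 (g z)).
  by apply: convex_quotients_cst; exact: site_weight_ge0.
by apply/funext => k; rewrite mulr0 addr0.
Qed.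

Lemma diffuse_negligible_seq (s : seq (borel X)) : diffuse Pstar ->
  Pstar.-negligible [set y | y \in s].
Proof.
move=> Pd; elim: s => [|z s ih].
  rewrite (_ : [set y | _] = set0); first exact: negligible_set0.
  by rewrite -subset0 => y.
apply: (@negligibleS _ _ _ _ ([set z] `|` [set y | y \in s])).
  by move=> y /=; rewrite inE => /predU1P[->|ys]; [left|right].
apply: negligibleU => //; apply/negligibleP; last exact: Pd.
exact: measurable_set1_borel hX.
Qed.

(** Differentiating along [A] amounts to one urn step into [A]: the factor [tau 1] from the bulk is
    the weight of a fresh point, a raised order at a site that of a repetition. *)
Lemma urn_density_driftE (s : seq (borel X)) g u A : diffuse Pstar -> x0 \in s ->
  admissible g u -> measurable A ->
  ((urn_density_drift s g A)%:E =
   \int[Pstar]_(y in A) (urn_density (y :: s) g)%:E +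
   (\sum_(z <- s) \1_A z * urn_density (z :: s) g)%:E)%E.
Proof.
move=> Pd x0s gu mA; have [mg u0 [K ugK]] := gu.
have g0 y := admissible_gt0 y gu.
have mdens : measurable_fun setT (fun y => urn_density (y :: s) g).
  apply: measurable_funM; first exact: measurable_cst.
  have := @measurable_sites_weight _ (borel X)
    (id :: [seq cst z | z <- s]) (fun=> g).
  under [in X in _ -> _ -> _ -> X]eq_fun do rewrite /= -map_comp map_id.
  apply.
  - move=> h; rewrite inE => /predU1P[->|/mapP[z _ ->]]; first exact: measurable_id.
    exact: measurable_cst.
  - by move=> h mh; exact: measurableT_comp.
  - by [].
rewrite /urn_density_drift addrC EFinD; congr (_ + _)%E.
  have mtau : measurable_fun setT (fun y => tau 1 (g y)).
    by apply: measurable_comp_gt0 => //; exact: tau_measurable.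
  have itau : Pstar.-integrable A (EFin \o (fun y => tau 1 (g y))).
    apply: (@bounded_integrable _ (tau 1 u)) => //; first exact: measurable_funTS.
    move=> y _; have /andP[ug _] := ugK y.
    by apply/andP; split; [exact: tau_ge0|exact: tau_antitone].
  pose C := urn_density s g * b.
  transitivity (\int[Pstar]_(y in A) (C%:E * (tau 1 (g y))%:E))%E.
    rewrite integralZl// -[X in (_ * X)%E]fineK; last exact: integrable_fin_num itau.
    by rewrite -EFinM /C /urn_density; congr EFin; rewrite /Rintegral; ring.
  (* A point drawn from the diffuse [Pstar] almost surely avoids the list, hence [x0], so the weight
     of a fresh point applies. *)
  apply: ae_eq_integral => //.
  - by apply: emeasurable_funM => //; apply/measurable_EFinP; exact: measurable_funTS.
  - by apply/measurable_EFinP; exact: measurable_funTS.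
  apply: (negligibleS _ (diffuse_negligible_seq s Pd)).
  move=> y /= /not_implyP[Ay]; apply: contra_notP => /negP ys.
  have yx0 : y != x0 by apply: contraNneq ys => ->.
  by rewrite /urn_density sites_weight_new// -EFinM /C /urn_density; congr EFin; ring.
(* The multiplicities turn a sum over distinct values into one over list entries. *)
congr EFin; rewrite -[RHS]big_undup_iterop_count big_distrr/=.
rewrite big_seq [RHS]big_seq; apply: eq_bigr => z; rewrite mem_undup => zs.
rewrite -[iterop _ _ _ _]/(_ *+ _) /urn_density sites_weight_old// -mulr_natl.
by ring.
Qed.

End urn_density.

(** * The Palm formula *)

Section integral_quotients.
Context {R : realType} {d} {T : measurableType d} (m : {measure set T -> \bar R}).
Context (D : set T) (mD : measurable D).

(** Monotone convergence of the difference quotients. The limit may be [+oo]; finiteness of the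
    integral of [f0] gives the differences a meaning. *)
Lemma convex_quotients_integral (f0 : T -> R) (f : nat -> T -> R) (df : T -> R) :
  measurable_fun D f0 -> (forall k, measurable_fun D (f k)) ->
  (\int[m]_(x in D) (f0 x)%:E < +oo)%E ->
  (forall x, D x -> convex_quotients (f0 x) (f ^~ x) (df x)) ->
  ((\int[m]_(x in D) (f0 x)%:E - \int[m]_(x in D) (f k x)%:E) *
     k.+1%:R%:E)%E @[k --> \oo] --> (\int[m]_(x in D) (df x)%:E)%E.
Proof.
move=> mf0 mf f0oo H.
have f0_ge0 x : D x -> 0 <= f0 x.
  by move=> /H[/(_ 0%N)/andP[h1 h2] _ _ _]; exact: le_trans h2.
have if0 : m.-integrable D (EFin \o f0).
  apply/integrableP; split; first exact/measurable_EFinP.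
  rewrite (eq_integral (fun x => (f0 x)%:E))// => x; rewrite inE => Dx.
  by rewrite /= ger0_norm// f0_ge0.
have iff k : m.-integrable D (EFin \o f k).
  apply: le_integrable if0 => //; first exact/measurable_EFinP.
  move=> x Dx /=; rewrite lee_fin; have [/(_ k)/andP[h1 h2] _ _ _] := H x Dx.
  by rewrite !ger0_norm// f0_ge0.
pose q k x := ((f0 x - f k x) * k.+1%:R)%:E.
have q_int k : ((\int[m]_(x in D) (f0 x)%:E - \int[m]_(x in D) (f k x)%:E) *
     k.+1%:R%:E = \int[m]_(x in D) q k x)%E.
  rewrite -integralB_EFin// -integralZr//.
  by have := integrableB mD if0 (iff k); apply: eq_integrable.
rewrite (_ : (fun k => _) = (fun k => \int[m]_(x in D) q k x)%E); last exact/funext.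
rewrite (eq_integral (fun x => limn (q ^~ x))); last first.
  move=> x; rewrite inE => /H[_ _ _ qd]; apply/esym/cvg_lim => //.
  by apply/fine_cvgP; split; [exact: nearW|exact: qd].
apply: cvg_monotone_convergence => //.
- move=> k; apply/measurable_EFinP; apply: measurable_funM => //.
  exact: measurable_funB.
- move=> k x Dx; rewrite lee_fin; have [/(_ k)/andP[h1 h2] _ _ _] := H x Dx.
  by rewrite mulr_ge0// subr_ge0.
- by move=> x Dx k l kl; rewrite lee_fin; have [_ _ + _] := H x Dx; apply.
Qed.

End integral_quotients.

Lemma expeR_measurable {R : realType} : measurable_fun setT (@expeR R).
Proof.
have eq_meas (y : \bar R) : measurable_fun setT (fun x => x == y).
  apply: (measurable_fun_bool true); rewrite setTI.
  rewrite (_ : _ @^-1` _ = [set y]); first exact: emeasurable_set1.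
  by apply/seteqP; split => x /= /eqP.
rewrite (_ : @expeR R = fun x => if x == +oo%E then +oo%E else
    if x == -oo%E then 0%E else (expR (fine x))%:E).
  apply: measurable_fun_ifT => //; apply: measurable_fun_ifT => //.
  apply/measurable_EFinP; apply: measurableT_comp; last exact: fine_measurable.
  exact: measurable_expR.
by apply/funext; case.
Qed.

Lemma convex_quotients_exp {R : realType} (m : R) : 0 <= m ->
  convex_quotients 1 (fun k => expR (- (k.+1%:R^-1 * m))) m.
Proof.
(* The origin is moved to [v = 1], because [convex_quotients_derive] works at positive points. *)
move=> m0; pose f (v : R) := expR m * expR (- (v * m)).
have df (v : R) : 0 < v -> is_derive v 1 f (- (m * f v)).
  move=> _; have := is_derive_Zf (expR m) (is_derive_exp_neg_mul m v).
  by rewrite mulrN mulrCA.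
have f_ge0 (v : R) : 0 < v -> 0 <= f v by move=> _; rewrite mulr_ge0 ?expR_ge0.
have f1 : f 1 = 1 by rewrite /f mul1r -expRD subrr expR0.
have := convex_quotients_derive df f_ge0 _ _ ltr01.
rewrite f1 mulr1 (_ : (fun k => f _) = fun k => expR (- (k.+1%:R^-1 * m))).
  apply; first by move=> v v0; apply: mulr_ge0 => //; exact: f_ge0.
  move=> v w _ vw; rewrite /f ler_wpM2l// ler_wpM2l ?expR_ge0// ler_expR lerN2.
  by rewrite ler_wpM2r.
by apply/funext => k; rewrite /f -expRD; congr expR; ring.
Qed.

Section palm_formula.
Context {R : realType} {X : ptopologicalType} (hX : polish R X) (rho : R -> R).
Context (rho_meas : measurable_fun [set s : R | 0 < s] rho)
  (rho_ge0 : forall s : R, 0 < s -> 0 <= rho s)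
  (rho_levy : (\int[@lebesgue_measure R]_(s in `]0%R, +oo[)
                 (Num.min 1%R s * rho s)%:E < +oo)%E).
Context (c zeta : R) (c_gt0 : 0 < c) (zeta01 : 0 < zeta < 1).
Context (x0 : borel X) (Pstar : probability (borel X) R) (Pd : diffuse Pstar).
Context (P0 : probability (borel X) R) (P0E : forall A, measurable A ->
  P0 A = (zeta%:E * \d_x0 A + (1 - zeta)%:E * Pstar A)%E).
Context {dO} {Om : measurableType dO} (Pr : probability Om R)
  (mu : R.-ker Om ~> borel X) (hmu : is_homogeneous_crm rho c P0 Pr mu).
Local Notation leb := (@lebesgue_measure R).
Local Notation Rpos := (`]0%R, +oo[%classic : set R).
Local Notation psi := (psi rho).
Local Notation dens := (urn_density rho c zeta x0 Pstar).

Let z_ge0 : 0 <= zeta. Proof. by case/andP: zeta01 => /ltW. Qed.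
Let z1_ge0 : 0 <= 1 - zeta. Proof. by case/andP: zeta01 => _ /ltW; rewrite subr_ge0. Qed.

Lemma integral_base_measure (F : borel X -> \bar R) :
  measurable_fun setT F -> (forall x, 0 <= F x)%E ->
  (\int[P0]_x F x = zeta%:E * F x0 + (1 - zeta)%:E * \int[Pstar]_x F x)%E.
Proof.
move=> mF F0.
rewrite (eq_measure_integral (measure_add (mscale (NngNum z_ge0) \d_x0)
  (mscale (NngNum z1_ge0) Pstar))); last first.
  move=> A mA _; etransitivity; first exact: (P0E mA).
  by symmetry; etransitivity; first exact: measure_addE.
rewrite ge0_integral_measure_add// !ge0_integral_mscale//=.
by rewrite integral_dirac// diracT mul1e.
Qed.

(** The almost sure event on which [fine] loses nothing; integrals over [Om] are restricted to
    it. *)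
Definition finite_mass : set Om := [set w | (mu w setT < +oo)%E].

Lemma finite_mass_measurable : measurable finite_mass.
Proof.
rewrite /finite_mass (_ : [set w | _] = setT `&` [set w | mu w setT < +oo]%E).
  apply: emeasurable_fun_infty_o => //; exact: measurable_kernel.
by rewrite setTI.
Qed.

Lemma finite_massC : Pr (~` finite_mass) = 0%E.
Proof.
have [_ H _] := hmu.
by apply: measure_negligible => //; apply: measurableC; exact: finite_mass_measurable.
Qed.

Lemma integral_finite_mass (F : Om -> \bar R) : measurable_fun setT F ->
  (forall w, 0 <= F w)%E -> (\int[Pr]_w F w = \int[Pr]_(w in finite_mass) F w)%E.
Proof.
move=> mF F0; have mD := finite_mass_measurable.
rewrite (ge0_negligible_integral (measurableC mD) measurableT mF
  (fun w _ => F0 w) finite_massC).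
by rewrite setTD setCK.
Qed.

Definition mass (A : set (borel X)) (w : Om) : R := fine (mu w A).

Definition laplace (g : borel X -> R) (w : Om) : R :=
  expR (- fine (\int[mu w]_x (g x)%:E)%E).

Lemma mass_ge0 A w : 0 <= mass A w.
Proof. exact: fine_ge0. Qed.

Lemma massE A w : measurable A -> finite_mass w -> (mass A w)%:E = mu w A.
Proof.
move=> mA Dw; rewrite fineK// ge0_fin_numE//; apply: le_lt_trans Dw.
by apply: le_measure; rewrite ?inE.
Qed.

Lemma measurable_mass A : measurable A -> measurable_fun setT (mass A).
Proof.
move=> mA; apply: (measurableT_comp (fine_measurable measurableT)) => //.
exact: measurable_kernel.
Qed.

Lemma measurable_mu_integral g u : admissible g u ->
  measurable_fun setT (fun w => (\int[mu w]_x (g x)%:E)%E).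
Proof.
move=> gu; have [mg _ _] := gu; apply: measurable_fun_integral_kernel.
- by move=> U; exact: measurable_kernel.
- by move=> x; rewrite lee_fin; apply: ltW; exact: admissible_gt0 gu.
- exact/measurable_EFinP.
Qed.

Lemma measurable_laplace g u : admissible g u -> measurable_fun setT (laplace g).
Proof.
move=> gu; apply: measurableT_comp => //; apply: measurableT_comp => //.
apply: (measurableT_comp (fine_measurable measurableT)) => //.
exact: measurable_mu_integral gu.
Qed.

Lemma mu_integral_bounds g u w : admissible g u -> finite_mass w ->
  ((u * mass setT w)%:E <= \int[mu w]_x (g x)%:E < +oo)%E.
Proof.
move=> gu Dw; have [mg u0 [K ugK]] := gu.
have g0 x := admissible_gt0 x gu.
have mgE : measurable_fun setT (EFin \o g) by exact/measurable_EFinP.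
have K0 : 0 <= K by have /andP[_] := ugK x0; apply: le_trans; exact: ltW.
apply/andP; split.
  rewrite EFinM massE// -integral_cst//.
  apply: ge0_le_integral => //.
  - by move=> x _; rewrite lee_fin ltW.
  - by move=> x _; have /andP[] := ugK x.
apply: (@le_lt_trans _ _ (\int[mu w]_x (cst K%:E x))%E).
  apply: ge0_le_integral => //.
  - by move=> x _; rewrite lee_fin ltW.
  - by move=> x _; have /andP[] := ugK x.
by rewrite integral_cst// -massE// -EFinM ltry.
Qed.

Lemma mu_integral_fin g u w : admissible g u -> finite_mass w ->
  (\int[mu w]_x (g x)%:E)%E \is a fin_num.
Proof.
move=> gu Dw; have /andP[h1 h2] := mu_integral_bounds gu Dw.
rewrite ge0_fin_numE//; apply: le_trans h1.
by rewrite lee_fin mulr_ge0 ?mass_ge0//; have [_ /ltW] := gu.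
Qed.

Lemma laplace_shift g u A (t : R) w : admissible g u -> measurable A -> 0 <= t ->
  finite_mass w ->
  laplace (fun x => g x + t * \1_A x) w = laplace g w * expR (- (t * mass A w)).
Proof.
move=> gu mA t0 Dw; rewrite /laplace -expRD -opprD; congr (expR (- _)).
have [mg _ _] := gu; have g0 x := admissible_gt0 x gu.
under eq_integral do rewrite EFinD.
rewrite ge0_integralD//; last 4 first.
- by move=> x _; rewrite lee_fin ltW.
- exact/measurable_EFinP.
- by move=> x _; rewrite lee_fin mulr_ge0.
- by apply/measurable_EFinP; apply: measurable_funM.
under [in X in fine (_ + X)]eq_integral do rewrite EFinM.
rewrite ge0_integralZl//; last by exact/measurable_EFinP.
rewrite integral_indic// setIT -massE// -EFinM fineD//.
exact: mu_integral_fin gu Dw.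
Qed.

(** From [y ^+ n * exp (- y) <= n!] at [y = u T], with [T] the total mass. The exponential factor
    keeps the moments finite although the random measure may have none. *)
Lemma laplace_bound (n : nat) g u w : admissible g u -> finite_mass w ->
  mass setT w ^+ n * laplace g w <= n`!%:R / u ^+ n.
Proof.
move=> gu Dw; have [_ u0 _] := gu.
have /andP[h1 h2] := mu_integral_bounds gu Dw.
rewrite -(fineK (mu_integral_fin gu Dw)) lee_fin in h1.
apply: (@le_trans _ _ (mass setT w ^+ n * expR (- (u * mass setT w)))).
  by rewrite ler_wpM2l ?exprn_ge0 ?mass_ge0// ler_expR lerN2.
set T := mass setT w; have T0 : 0 <= T by exact: mass_ge0.
rewrite expRN ler_pdivrMr ?expR_gt0// mulrAC ler_pdivlMr ?exprn_gt0//.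
rewrite -exprMn [T * u]mulrC.
case: n => [|n]; first by rewrite expr0 mul1r -expR0 ler_expR mulr_ge0// ltW.
have F0 : 0 < n.+1`!%:R :> R by rewrite ltr0n fact_gt0.
rewrite -ler_pdivrMl//.
have uT0 : 0 <= u * T by rewrite mulr_ge0// ltW.
by have := expR_ge1Dxn n uT0; apply: le_trans; rewrite [_^-1 * _]mulrC lerDr.
Qed.

(** The mixture [P0] splits the exponent into a bulk part under [Pstar] and a part at [x0], which is
    the weight of order 0 of the seed. This starts the induction on the sample size. *)
Lemma laplace_functional g u : admissible g u ->
  (\int[Pr]_(w in finite_mass) (laplace g w)%:E = (dens [:: x0] g)%:E)%E.
Proof.
move=> gu; have [mg u0 _] := gu; have g0 x := admissible_gt0 x gu.
have [_ _ /(_ g mg (fun x => ltW (g0 x)))] := hmu.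
set J := (\int[P0]_x _)%E => H.
have mpsi : measurable_fun setT (fun x => (psi (g x))%:E).
  apply/measurable_EFinP; apply: measurable_comp_gt0 => //.
  exact: psi_measurable.
have psi0 x : (0 <= (psi (g x))%:E)%E by rewrite lee_fin psi_ge0// ltW.
have JE : J = (zeta * psi (g x0) + (1 - zeta) * (\int[Pstar]_x psi (g x))%R)%:E.
  rewrite /J (eq_integral (fun x => (psi (g x))%:E)); last first.
    move=> x _; rewrite (psi_EFin rho_meas rho_ge0 rho_levy (ltW (g0 x))).
    by apply: eq_integral => s _; rewrite [s * _]mulrC.
  have IE : (\int[Pstar]_x (psi (g x))%:E = (\int[Pstar]_x psi (g x))%R%:E)%E.
    rewrite /Rintegral fineK//; apply: integrable_fin_num => //.
    exact: psi_comp_integrable gu.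
  by rewrite (integral_base_measure mpsi psi0) IE -!EFinM -EFinD.
rewrite JE -EFinM -EFinN /= in H.
transitivity (\int[Pr]_w expeR (- (\int[mu w]_x (g x)%:E)))%E.
  rewrite integral_finite_mass//; first last.
  - by move=> w; exact: expeR_ge0.
  - apply: measurableT_comp => //; first exact: expeR_measurable.
    apply: measurableT_comp => //; exact: measurable_mu_integral gu.
  apply: eq_integral => w; rewrite inE => Dw.
  by rewrite /laplace -[in RHS](fineK (mu_integral_fin gu Dw)).
rewrite H; congr EFin; rewrite /urn_density /bulk_weight /sites_weight /=.
rewrite big_seq1 eqxx /= /site_weight eqxx exp_bell0 divr1 -expRD; congr expR.
ring.
Qed.

Definition rect {n} (A : 'I_n -> set (borel X)) : set (n.-tuple (borel X)) :=
  [set x | forall i, A i (tnth x i)].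

Lemma measurable_rect {n} (A : 'I_n -> set (borel X)) :
  (forall i, measurable (A i)) -> measurable (rect A).
Proof.
move=> mA.
rewrite (_ : rect A = \bigcap_(i in [set: 'I_n]) (@tnth n _ ^~ i) @^-1` A i).
  apply: fin_bigcap_measurable => // i _.
  by rewrite -[X in measurable X]setTI; exact: measurable_tnth.
by apply/seteqP; split => [x Ax i _|x Ax i]; [exact: Ax|exact: (Ax i I)].
Qed.

Lemma measurable_sites_weight_tuple {d} {T : measurableType d} {n}
    (f : T -> n.-tuple (borel X)) (g : T -> borel X -> R) :
  measurable_fun setT f ->
  (forall h, measurable_fun setT h -> measurable_fun setT (fun t => g t (h t))) ->
  (forall t z, 0 < g t z) ->
  measurable_fun setT (fun t => sites_weight rho c zeta x0 (x0 :: f t) (g t)).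
Proof.
move=> mf mg g0.
pose fs := cst x0 :: [seq (fun t => tnth (f t) i) | i <- enum 'I_n].
rewrite (_ : (fun t => _) =
    fun t => sites_weight rho c zeta x0 [seq h t | h <- fs] (g t)).
  apply: measurable_sites_weight => //.
  move=> h; rewrite inE => /predU1P[->|/mapP[i _ ->]]; first exact: measurable_cst.
  by apply: (measurableT_comp (@measurable_tnth _ _ _ i)).
apply/funext => t; rewrite (_ : [seq h t | h <- fs] = x0 :: f t)//.
rewrite /fs /= -map_comp; congr (_ :: _).
exact: map_tnth_enum.
Qed.

Lemma measurable_dens_tuple {n} g u : admissible g u ->
  measurable_fun setT (fun x : n.-tuple (borel X) => dens (x0 :: x) g).
Proof.
move=> gu; have [mg _ _] := gu.
apply: measurable_funM; first exact: measurable_cst.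
apply: (@measurable_sites_weight_tuple _ (n.-tuple (borel X)) n id (fun=> g)).
- exact: measurable_id.
- by move=> h mh; exact: measurableT_comp.
- by move=> _ z; exact: admissible_gt0 gu.
Qed.

(** Quantified over [g], because the induction step differentiates in [g]. *)
Definition palm {n} (L : {finite_measure set (n.-tuple (borel X)) -> \bar R}) :=
  forall (A : 'I_n -> set (borel X)) g u, (forall i, measurable (A i)) ->
  admissible g u ->
  (\int[Pr]_(w in finite_mass) (\prod_(i < n) mass (A i) w * laplace g w)%:E =
   \int[L]_(x in rect A) (dens (x0 :: x) g)%:E)%E.

Lemma palm0 : palm (dirac [tuple] : {finite_measure set (0.-tuple (borel X)) -> \bar R}).
Proof.
move=> A g u mA gu.
under eq_integral do rewrite big_ord0 mul1r.
rewrite (laplace_functional gu) integral_dirac//.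
- by rewrite diracE mem_set ?mul1e// => -[].
- exact: measurable_rect.
- by apply/measurable_EFinP; apply: measurable_funTS; exact: measurable_dens_tuple gu.
Qed.

(** The hypothesis is used at [g] and at [g] plus [1/(k+1)] times the indicator of the first set.
    The scaled differences tend on one side to the moment with one more mass, on the other to the
    integrated drift, and limits are unique. *)
Lemma palm_step {n} (L : {finite_measure set (n.-tuple (borel X)) -> \bar R}) :
  palm L -> palm (urn_measure Pstar x0 L).
Proof.
move=> palmL A g u mA gu; have [mg u0 _] := gu.
have mD := finite_mass_measurable.
pose A0 := A ord0; pose A' i := A (lift ord0 i).
have mA0 : measurable A0 by exact: mA.
have mA' i : measurable (A' i) by exact: mA.
pose gk (k : nat) x := g x + k.+1%:R^-1 * \1_A0 x.
have gku k : admissible (gk k) u by apply: admissible_shift.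
pose F0 w := \prod_(i < n) mass (A' i) w * laplace g w.
pose Fk k w := \prod_(i < n) mass (A' i) w * laplace (gk k) w.
have mprod : measurable_fun setT (fun w => \prod_(i < n) mass (A' i) w).
  apply: measurable_prod => i _; exact: measurable_mass.
have mF0 : measurable_fun setT F0.
  by apply: measurable_funM => //; exact: measurable_laplace gu.
have mFk k : measurable_fun setT (Fk k).
  by apply: measurable_funM => //; exact: measurable_laplace (gku k).
have F0_ge0 w : 0 <= F0 w.
  by rewrite mulr_ge0 ?expR_ge0// prodr_ge0// => i _; exact: mass_ge0.
have F0oo : (\int[Pr]_(w in finite_mass) (F0 w)%:E < +oo)%E.
  apply: (@le_lt_trans _ _ (\int[Pr]_(w in finite_mass)
      (cst (n`!%:R / u ^+ n)%:E w))%E).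
    apply: ge0_le_integral => //.
    - by move=> w _; rewrite lee_fin.
    - by apply/measurable_EFinP; exact: measurable_funTS.
    - move=> w Dw; rewrite lee_fin; apply: le_trans (laplace_bound n gu Dw).
      rewrite ler_wpM2r ?expR_ge0// -[X in _ <= _ ^+ X]card_ord -prodr_const.
      apply: ler_prod => i _; rewrite mass_ge0/= -lee_fin !massE//.
      by apply: le_measure; rewrite ?inE.
  rewrite integral_cst//; apply: lte_mul_pinfty => //.
    by rewrite lee_fin divr_ge0// exprn_ge0// ltW.
  by rewrite (le_lt_trans (probability_le1 _ mD))// ltry.
have qF w : finite_mass w ->
    convex_quotients (F0 w) (Fk ^~ w) (\prod_(i < n) mass (A' i) w * mass A0 w * laplace g w).
  move=> Dw.
  (* The shift of [g] multiplies the Laplace factor by [exp (- mass A0 / (k+1))]; the rest is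
     constant in [k]. *)
  have := convex_quotientsM (convex_quotients_cst (F0_ge0 w))
    (convex_quotients_exp (mass_ge0 A0 w)).
  rewrite !mulr1 mul1r addr0 (_ : F0 w * _ =
    \prod_(i < n) mass (A' i) w * mass A0 w * laplace g w); last by rewrite /F0; ring.
  rewrite (_ : (fun k => _) = Fk ^~ w)//; apply/funext => k.
  by rewrite /Fk (laplace_shift gu)// /F0 mulrA.
have c1 := convex_quotients_integral mD (measurable_funTS mF0)
  (fun k => measurable_funTS (mFk k)) F0oo qF.
pose B := rect A'.
have mB : measurable B by exact: measurable_rect.
have qQ (x : n.-tuple (borel X)) : B x -> convex_quotients (dens (x0 :: x) g)
    (fun k => dens (x0 :: x) (gk k)) (urn_density_drift rho c zeta x0 Pstar (x0 :: x) g A0).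
  by move=> _; exact: urn_density_quotients gu mA0.
have EF0 : (\int[Pr]_(w in finite_mass) (F0 w)%:E =
    \int[L]_(x in B) (dens (x0 :: x) g)%:E)%E by exact: palmL gu.
have EFk k : (\int[Pr]_(w in finite_mass) (Fk k w)%:E =
    \int[L]_(x in B) (dens (x0 :: x) (gk k))%:E)%E by exact: palmL (gku k).
have F1oo : (\int[L]_(x in B) (dens (x0 :: x) g)%:E < +oo)%E.
  by move: F0oo; rewrite EF0.
have c2 := convex_quotients_integral mB (measurable_funTS (measurable_dens_tuple gu))
  (fun k => measurable_funTS (measurable_dens_tuple (gku k))) F1oo qQ.
rewrite (_ : (fun k => _) = (fun k => (\int[L]_(x in B) (dens (x0 :: x) g)%:E -
    \int[L]_(x in B) (dens (x0 :: x) (gk k))%:E) * k.+1%:R%:E)%E) in c1; last first.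
  by apply/funext => k; rewrite EF0 EFk.
have {c1 c2} e := cvg_unique (@ereal_hausdorff R) c1 c2.
transitivity (\int[Pr]_(w in finite_mass)
    (\prod_(i < n) mass (A' i) w * mass A0 w * laplace g w)%:E)%E.
  apply: eq_integral => w _; congr EFin; rewrite big_ord_recl.
  by congr (_ * _); rewrite mulrC.
rewrite e => {e}.
have mrA : measurable (rect A) by exact: measurable_rect.
pose F (z : n.+1.-tuple (borel X)) : \bar R :=
  ((fun z : n.+1.-tuple (borel X) => (dens (x0 :: z) g)%:E) \_ (rect A)) z.
have mF : measurable_fun setT F.
  apply/(measurable_restrictT _ mrA)/measurable_EFinP/measurable_funTS.
  exact: measurable_dens_tuple gu.
have F_ge0 z : (0 <= F z)%E.
  by rewrite /F patchE; case: ifP => // _; rewrite lee_fin; exact: urn_density_ge0.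
have rectE y (x : n.-tuple (borel X)) :
    ([tuple of y :: x] \in rect A) = (y \in A0) && (x \in B).
  apply/idP/andP => [|[]]; rewrite !inE.
    move=> yx; split; first exact: (yx ord0).
    by move=> i; have := yx (lift ord0 i); rewrite tnthS.
  move=> yA xB i; case: (unliftP ord0 i) => [j|] ->; last by rewrite tnth0.
  by rewrite tnthS; exact: xB.
(* The drift identity puts the new point before the seed, the urn puts it after. *)
have dperm y (x : seq (borel X)) : dens (x0 :: y :: x) g = dens (y :: x0 :: x) g.
  apply: urn_density_perm; rewrite -cat1s -[y :: x0 :: x]cat1s.
  by rewrite -[x0 :: x]cat1s -[y :: x]cat1s perm_catCA.
rewrite [RHS]integral_mkcond (integral_urn_measure Pstar x0 L mF F_ge0) [LHS]integral_mkcond.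
apply: eq_integral => x _; rewrite patchE.
case: ifP => xB; last first.
  rewrite integral0_eq; last by move=> y _; rewrite /F patchE rectE xB andbF.
  by rewrite add0e big1// => i _; rewrite /F patchE rectE xB andbF.
rewrite (urn_density_driftE hX rho_meas rho_ge0 rho_levy c zeta Pd _ gu mA0); last first.
  exact: mem_head.
congr (_ + _)%E.
  rewrite integral_mkcond; apply: eq_integral => y _.
  by rewrite /F !patchE rectE xB andbT dperm.
have sz : size (x0 :: x) = n.+1 by rewrite /= size_tuple.
rewrite (big_nth x0) sz big_mkord -sumEFin; apply: eq_bigr => i _.
rewrite /F patchE rectE xB andbT indicE dperm.
by case: (_ \in _); rewrite ?mul1r ?mul0r.
Qed.

End palm_formula.

(** * The law of the sample *)

Section density_measure.
Context {R : realType} {d} {T : measurableType d} (m : {measure set T -> \bar R}).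
Context (f : T -> \bar R) (mf : measurable_fun setT f) (f0 : forall x, (0 <= f x)%E).
Local Open Scope ereal_scope.

(** The two proofs are arguments so that the measure structure can be attached to the term. *)
Definition density of measurable_fun setT f & (forall x, 0 <= f x) : set T -> \bar R :=
  fun A => \int[m]_(x in A) f x.

Local Notation mu := (density mf f0).

Let density0 : mu set0 = 0.
Proof. exact: integral_set0. Qed.

Let density_ge0 A : 0 <= mu A.
Proof. by apply: integral_ge0 => x _; exact: f0. Qed.

Let density_sigma_additive : semi_sigma_additive mu.
Proof.
move=> F mF tF mUF; rewrite /density ge0_integral_bigcup//; last first.
  exact: measurable_funTS.
by apply: is_cvg_ereal_nneg_natsum => n _; apply: integral_ge0 => x _; exact: f0.
Qed.

HB.instance Definition _ := isMeasure.Build _ _ _ mu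
  density0 density_ge0 density_sigma_additive.

Import HBNNSimple.

Lemma integral_density (g : T -> \bar R) (B : set T) : measurable B ->
  measurable_fun setT g -> (forall x, 0 <= g x) ->
  \int[mu]_(x in B) g x = \int[m]_(x in B) (g x * f x).
Proof.
move=> mB mg g0.
have indic_case (A : set T) : measurable A ->
    \int[mu]_(x in B) (\1_A x)%:E = \int[m]_(x in B) ((\1_A x)%:E * f x).
  move=> mA; rewrite integral_indic// -[LHS]/(\int[m]_(x in A `&` B) f x).
  rewrite setIC integral_mkcondr.
  apply: eq_integral => x _; rewrite patchE indicE.
  by case: (x \in A); rewrite ?mul1e ?mul0e.
have mgB : measurable_fun B g by exact: measurable_funTS.
pose g_ := nnsfun_approx mB mgB.
have nd x : nondecreasing_seq (fun n => g_ n x).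
  by move=> a b ab; exact/lefP/nd_nnsfun_approx.
have sfun_case n : \int[mu]_(x in B) (g_ n x)%:E = \int[m]_(x in B) ((g_ n x)%:E * f x).
  under [LHS]eq_integral do rewrite fimfunE -fsumEFin//.
  rewrite ge0_integral_fsum//; last 2 first.
  - by move=> y; exact/measurable_EFinP/measurable_funTS/measurable_funM.
  - by move=> y x _; rewrite nnfun_muleindic_ge0.
  under [RHS]eq_integral do
    (rewrite fimfunE -fsumEFin// ge0_mule_fsuml; last by move=> y; rewrite nnfun_muleindic_ge0).
  rewrite ge0_integral_fsum//; last 2 first.
  - move=> y; apply: emeasurable_funM; last exact: measurable_funTS.
    exact/measurable_EFinP/measurable_funTS/measurable_funM.
  - by move=> y x _; rewrite mule_ge0// nnfun_muleindic_ge0.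
  apply: eq_fsbigr => y _.
  have [y0|y0] := ltP y 0%R.
    rewrite !integral0_eq// => x _; rewrite preimage_nnfun0// indicE in_set0 mulr0//.
    by rewrite mul0e.
  under [LHS]eq_integral do rewrite EFinM.
  under [RHS]eq_integral do rewrite EFinM -muleA.
  rewrite !ge0_integralZl//; last 3 first.
  - apply: emeasurable_funM; last exact: measurable_funTS.
    exact/measurable_EFinP/measurable_funTS.
  - by move=> x _; rewrite mule_ge0// lee_fin.
  - exact/measurable_EFinP/measurable_funTS.
  by rewrite indic_case.
transitivity (limn (fun n => \int[mu]_(x in B) (g_ n x)%:E)).
  rewrite -monotone_convergence//.
  - apply: eq_integral => y /[!inE] yD; apply/esym/cvg_lim => //.
    exact: cvg_nnsfun_approx.
  - by move=> n; exact/measurable_EFinP/measurable_funTS.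
  - by move=> n y _; rewrite lee_fin.
  - by move=> y _ a b ab; rewrite lee_fin; exact: nd.
under eq_fun do rewrite sfun_case.
rewrite -monotone_convergence//.
- apply: eq_integral => y /[!inE] yD; apply/cvg_lim => //.
  have gn := cvg_nnsfun_approx mB mgB (fun x _ => g0 x) yD.
  (* Zero values are treated apart, since multiplication is not continuous at a product of zero and
     infinity. *)
  have [fy0|fy0] := eqVneq (f y) 0.
    by rewrite fy0 mule0; under eq_fun do rewrite mule0; exact: cvg_cst.
  have [gy0|gy0] := eqVneq (g y) 0.
    rewrite gy0 mul0e (_ : (fun n => _) = cst 0); first exact: cvg_cst.
    apply/funext => n; rewrite (_ : (g_ n y)%:E = 0) ?mul0e//.
    apply/eqP; rewrite eq_le; apply/andP; split; last by rewrite lee_fin.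
    by rewrite -gy0 /g_ nnsfun_approxE; exact: le_approx.
  apply: cvgeM => //; last exact: cvg_cst.
  by move: fy0 gy0; case: (g y) => [r| |]; case: (f y) => [r'| |].
- move=> n; apply: emeasurable_funM; last exact: measurable_funTS.
  exact/measurable_EFinP/measurable_funTS.
- by move=> n x _; rewrite mule_ge0// lee_fin.
- by move=> x _ a b ab; rewrite lee_wpmul2r// lee_fin; exact: nd.
Qed.

End density_measure.

(** * The total mass of the random measure and the sample density *)

Section sample_law.
Context {R : realType} {X : ptopologicalType} (hX : polish R X) (rho : R -> R).
Context (rho_meas : measurable_fun [set s : R | 0 < s] rho)
  (rho_ge0 : forall s : R, 0 < s -> 0 <= rho s)
  (rho_levy : (\int[@lebesgue_measure R]_(s in `]0%R, +oo[)
                 (Num.min 1%R s * rho s)%:E < +oo)%E)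
  (rho_infinite : (\int[@lebesgue_measure R]_(s in `]0%R, +oo[)
                     (rho s)%:E = +oo)%E).
Context (c zeta : R) (c_gt0 : 0 < c) (zeta01 : 0 < zeta < 1).
Context (x0 : borel X) (Pstar : probability (borel X) R) (Pd : diffuse Pstar).
Context (P0 : probability (borel X) R) (P0E : forall A, measurable A ->
  P0 A = (zeta%:E * \d_x0 A + (1 - zeta)%:E * Pstar A)%E).
Context {dO} {Om : measurableType dO} (Pr : probability Om R)
  (mu : R.-ker Om ~> borel X) (hmu : is_homogeneous_crm rho c P0 Pr mu).
Local Notation leb := (@lebesgue_measure R).
Local Notation Rpos := (`]0%R, +oo[%classic : set R).
Local Notation psi := (psi rho).
Local Notation dens := (urn_density rho c zeta x0 Pstar).
Local Notation D := (finite_mass mu).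
Local Notation b := (c * (1 - zeta)).

Lemma admissible_cst (u : R) : 0 < u -> admissible (cst u : borel X -> R) u.
Proof. by move=> u0; split => //; exists u => x; rewrite lexx. Qed.

Lemma bulk_weight_cst (u : R) :
  bulk_weight rho c zeta Pstar (cst u) = expR (- (b * psi u)).
Proof.
rewrite /bulk_weight (_ : (fun y : borel X => _) = cst (psi u))//.
rewrite Rintegral_cst// [X in fine X](_ : _ = 1%E) ?mulr1//.
exact: probability_setT.
Qed.

Lemma dens_origin (u : R) : dens [:: x0] (cst u) = expR (- (c * psi u)).
Proof.
rewrite /urn_density bulk_weight_cst /sites_weight /= big_seq1 eqxx /=.
rewrite /site_weight eqxx exp_bell0 divr1 -expRD; congr expR; ring.
Qed.

Lemma laplace_cst (u : R) w : 0 < u -> D w ->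
  laplace mu (cst u) w = expR (- (u * mass mu setT w)).
Proof.
move=> u0 Dw; rewrite /laplace.
have -> : (\int[mu w]_x (cst u x)%:E = u%:E * mu w setT)%E.
  exact: (integral_cst (mu w) measurableT u%:E).
by rewrite -massE.
Qed.

(** Monotone convergence: the integrands increase to [rho], whose integral is infinite. *)
Lemma psi_cvgy : (psi k.+1%:R)%:E @[k --> \oo] --> +oo%E.
Proof.
rewrite -rho_infinite.
rewrite (_ : (fun k => _) = (fun k =>
    \int[leb]_(s in Rpos) ((1 - expR (- (k.+1%:R * s))) * rho s)%:E)%E); last first.
  by apply/funext => k; rewrite (psi_EFin rho_meas rho_ge0 rho_levy).
have -> : (\int[leb]_(s in Rpos) (rho s)%:E = \int[leb]_(s in Rpos) limn (fun k =>
    ((1 - expR (- (k.+1%:R * s))) * rho s)%:E))%E.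
  apply: eq_integral => s; rewrite inE => /Rpos_gt0 s0; apply/esym/cvg_lim => //.
  apply/fine_cvgP; split; first exact: nearW.
  rewrite -[X in _ --> X]mul1r -[X in X * _]subr0.
  apply: cvgM; last exact: cvg_cst.
  apply: cvgB; first exact: cvg_cst.
  apply: (@cvg_comp _ _ _ (fun k : nat => k.+1%:R) (fun x => expR (- (x * s))) _ +oo).
    by have := @cvgr_idn R; rewrite -(cvg_shiftS (fun n => n%:R : R)).
  by have := @cvg_expn_mul_exp R 0 s s0; under eq_fun do rewrite mul1r.
apply: cvg_monotone_convergence => //.
- move=> k; apply/measurable_EFinP; apply: measurable_funM; last exact: rho_measurable.
  by apply: measurable_funB => //; exact: measurable_exp_neg_mul.
- move=> k s /Rpos_gt0 s0; rewrite lee_fin.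
  have /andP[h _] := one_sub_exp_bound (ler0n _ k.+1) s0.
  by rewrite mulr_ge0 ?rho_ge0.
- move=> s /Rpos_gt0 s0 k l kl; rewrite lee_fin; apply: ler_wpM2r; first exact: rho_ge0.
  by rewrite lerD2l lerN2 ler_expR lerN2 ler_wpM2r ?(ltW s0)// ler_nat.
Qed.

(** On this event every Laplace factor is 1, so its probability is at most [exp (- c psi (k+1))] for
    every [k]. *)
Lemma total_mass_gt0 : Pr (D `&` [set w | mass mu setT w = 0]) = 0%E.
Proof.
set Z := D `&` _; have mD := finite_mass_measurable mu.
have mT : measurable_fun setT (mass mu setT) by exact: measurable_mass.
have mZ : measurable Z.
  apply: measurableI => //; rewrite -[X in measurable X]setTI.
  by rewrite (_ : [set w | _] = mass mu setT @^-1` [set 0])//; apply: mT.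
have bound k : (Pr Z <= (expR (- (c * psi k.+1%:R)))%:E)%E.
  have k0 : 0 < k.+1%:R :> R by [].
  have ak := admissible_cst k0.
  have ml := measurable_laplace mu ak.
  rewrite -dens_origin -(laplace_functional rho_meas rho_ge0 rho_levy zeta01 P0E hmu ak).
  rewrite -[leLHS]mul1e -integral_cst//.
  apply: (@le_trans _ _ (\int[Pr]_(w in Z) (laplace mu (cst k.+1%:R) w)%:E)%E).
    rewrite le_eqVlt; apply/orP; left; apply/eqP/eq_integral => w.
    by rewrite inE => -[Dw Tw]; rewrite laplace_cst// Tw mulr0 oppr0 expR0.
  apply: ge0_subset_integral => //.
  - by apply/measurable_EFinP; exact: measurable_funTS.
  - by move=> w _; rewrite lee_fin expR_ge0.
  - by move=> w [].
apply/eqP; rewrite eq_le measure_ge0 andbT leNgt; apply/negP => Z0.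
have Zfin : Pr Z \is a fin_num by exact: fin_num_measure.
pose r := fine (Pr Z).
have r0 : 0 < r by rewrite -lte_fin fineK.
(* Above this threshold for [psi], the bound drops below the supposed positive probability [r]. *)
have /cvgeyPgt/(_ (- ln r / c))[N _ /(_ N (leqnn _))] := psi_cvgy.
rewrite /= lte_fin ltr_pdivrMr// mulrC => h.
have := bound N; rewrite -(fineK Zfin) lee_fin -/r leNgt => /negP; apply.
by rewrite -[ltRHS](lnK r0) ltr_expR ltrNl.
Qed.

(* [cst u] is only meaningful as a Laplace argument for [u > 0]; [pos] makes
   [dens] total in [u]. *)
Definition pos (u : R) : R := if 0 < u then u else 1.

Lemma pos_gt0 u : 0 < pos u. Proof. by rewrite /pos; case: ifP. Qed.

Lemma measurable_pos : measurable_fun setT pos.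
Proof.
apply: measurable_fun_ifT => //.
by apply: measurable_fun_ltr.
Qed.

Lemma measurable_dens_joint {n} : measurable_fun setT
  (fun z : n.-tuple (borel X) * R => dens (x0 :: z.1) (cst (pos z.2))).
Proof.
have mp : measurable_fun setT (fun z : n.-tuple (borel X) * R => pos z.2).
  exact: (measurableT_comp measurable_pos).
apply: measurable_funM.
  under eq_fun do rewrite bulk_weight_cst.
  apply: measurableT_comp => //; apply: measurableT_comp => //.
  apply: measurable_funM => //; apply: measurable_comp_gt0 => //.
    exact: psi_measurable.
  by move=> z; exact: pos_gt0.
apply: (measurable_sites_weight_tuple hX rho_meas rho_ge0 rho_levy c zeta x0
  (f := fst) (g := fun z => cst (pos z.2))) => //.
by move=> t z; exact: pos_gt0.
Qed.

(** Extended-real: finiteness is known only almost everywhere, once it is the density of a law. *)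
Definition sample_density (n : nat) (x : seq (borel X)) : \bar R :=
  (\int[leb]_(u in Rpos)
     ((n.-1)`!%:R^-1 * u ^+ n.-1 * dens (x0 :: x) (cst u))%:E)%E.

Lemma sample_density_ge0 n x : (0 <= sample_density n x)%E.
Proof.
apply: integral_ge0 => u /Rpos_gt0 u0; rewrite lee_fin.
apply: mulr_ge0; last exact: urn_density_ge0.
by rewrite mulr_ge0 ?invr_ge0 ?exprn_ge0// ltW.
Qed.

End sample_law.

Lemma tonelli_domain {R : realType} {d1 d2} {T1 : measurableType d1}
    {T2 : measurableType d2} (m1 : {sigma_finite_measure set T1 -> \bar R})
    (m2 : {sigma_finite_measure set T2 -> \bar R}) (D : set T1) (E : set T2)
    (f : T1 * T2 -> \bar R) : measurable D -> measurable E ->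
  measurable_fun setT f -> (forall z, 0 <= f z)%E ->
  (\int[m1]_(x in D) \int[m2]_(y in E) f (x, y) =
   \int[m2]_(y in E) \int[m1]_(x in D) f (x, y))%E.
Proof.
move=> mD mE mf f0.
pose g := f \_ (D `*` E).
have mg : measurable_fun setT g.
  by apply/(measurable_restrictT _ (measurableX mD mE)); exact: measurable_funTS.
have g0 z : (0 <= g z)%E by rewrite /g patchE; case: ifP.
have gE x y : g (x, y) = (if (x \in D) && (y \in E) then f (x, y) else 0)%E.
  rewrite /g patchE; congr (if _ then _ else _).
  by apply/idP/andP => [|[]]; rewrite !inE.
have := fubini_tonelli (m1 := m1) (m2 := m2) g mg g0.
congr (_ = _).
  rewrite [RHS]integral_mkcond; apply: eq_integral => x _; rewrite patchE.
  case: ifP => xD; last by apply: integral0_eq => y _; rewrite gE xD.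
  by rewrite [RHS]integral_mkcond; apply: eq_integral => y _; rewrite gE xD patchE.
rewrite [RHS]integral_mkcond; apply: eq_integral => y _; rewrite patchE.
case: ifP => yE; last by apply: integral0_eq => x _; rewrite gE yE andbF.
by rewrite [RHS]integral_mkcond; apply: eq_integral => x _; rewrite gE yE patchE andbT.
Qed.

Section sample_rect.
Context {R : realType} {X : ptopologicalType} (hX : polish R X) (rho : R -> R).
Context (rho_meas : measurable_fun [set s : R | 0 < s] rho)
  (rho_ge0 : forall s : R, 0 < s -> 0 <= rho s)
  (rho_levy : (\int[@lebesgue_measure R]_(s in `]0%R, +oo[)
                 (Num.min 1%R s * rho s)%:E < +oo)%E)
  (rho_infinite : (\int[@lebesgue_measure R]_(s in `]0%R, +oo[)
                     (rho s)%:E = +oo)%E).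
Context (c zeta : R) (c_gt0 : 0 < c) (zeta01 : 0 < zeta < 1).
Context (x0 : borel X) (Pstar : probability (borel X) R) (Pd : diffuse Pstar).
Context (P0 : probability (borel X) R) (P0E : forall A, measurable A ->
  P0 A = (zeta%:E * \d_x0 A + (1 - zeta)%:E * Pstar A)%E).
Context {dO} {Om : measurableType dO} (Pr : probability Om R)
  (mu : R.-ker Om ~> borel X) (hmu : is_homogeneous_crm rho c P0 Pr mu).
Local Notation leb := (@lebesgue_measure R).
Local Notation Rpos := (`]0%R, +oo[%classic : set R).
Local Notation dens := (urn_density rho c zeta x0 Pstar).
Local Notation D := (finite_mass mu).

Lemma mass_ratio_gamma n (A : 'I_n -> set (borel X)) w : (0 < n)%N ->
  (forall i, measurable (A i)) -> D w ->
  ((\prod_(i < n) mass mu (A i) w / mass mu setT w ^+ n)%:E =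
   \int[leb]_(u in Rpos) ((n.-1)`!%:R^-1 * u ^+ n.-1 *
     (\prod_(i < n) mass mu (A i) w * expR (- (u * mass mu setT w))))%:E)%E.
Proof.
case: n A => // n A _ mA Dw /=; set T := mass mu setT w; set M := \prod_(i < _) _.
have M0 : 0 <= M by apply: prodr_ge0 => i _; exact: mass_ge0.
have : 0 <= T by exact: mass_ge0.
rewrite le_eqVlt => /predU1P[T0|T0].
  (* For zero total mass both sides vanish: as [0 < n], the numerator has a factor, and that factor
     is at most [T]. *)
  have -> : M = 0.
    rewrite /M big_ord_recl (_ : mass mu (A ord0) w = 0) ?mul0r//.
    apply/eqP; rewrite eq_le mass_ge0 andbT T0 /T -lee_fin !massE//.
    by apply: le_measure; rewrite ?inE.
  by rewrite mul0r integral0_eq// => u _; rewrite mul0r mulr0.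
under eq_integral => u _.
  rewrite (_ : _ * _ * _ = (n`!%:R^-1 * M) * (u ^+ n * expR (- (u * T)))); last by ring.
  rewrite EFinM; over.
rewrite ge0_integralZl_EFin//.
- rewrite gamma_integral// -EFinM; congr EFin.
  have F0 : n`!%:R != 0 :> R by rewrite pnatr_eq0 -lt0n fact_gt0.
  by field; rewrite F0 expf_neq0// gt_eqF.
- by move=> u /Rpos_gt0 u0; rewrite lee_fin mulr_ge0 ?expR_ge0 ?exprn_ge0// ltW.
- apply/measurable_EFinP; apply: measurable_funM.
    by apply: measurable_funX; exact: measurable_id.
  apply: measurable_funTS; apply: measurableT_comp => //.
  by apply: measurableT_comp => //; exact: measurable_funM.
- by rewrite mulr_ge0 ?invr_ge0.
Qed.

(** The inverse power of the total mass becomes a gamma integral. Tonelli brings [u] outside, the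
    Palm formula applies at the constant [u], and Tonelli moves [u] back inside. *)
Lemma mass_ratio_density n (L : {finite_measure set (n.-tuple (borel X)) -> \bar R})
    (A : 'I_n -> set (borel X)) : (0 < n)%N -> palm rho c zeta x0 Pstar Pr mu L ->
  (forall i, measurable (A i)) ->
  (\int[Pr]_(w in D) (\prod_(i < n) mass mu (A i) w / mass mu setT w ^+ n)%:E =
   \int[L]_(x in rect A) sample_density rho c zeta x0 Pstar n x)%E.
Proof.
move=> n0 palmL mA; have mD := finite_mass_measurable mu.
have mrA : measurable (rect A) by exact: measurable_rect.
have mRpos : measurable Rpos by exact: Rpos_measurable.
pose K (u : R) := (n.-1)`!%:R^-1 * pos u ^+ n.-1.
have K0 u : 0 <= K u by rewrite mulr_ge0 ?invr_ge0 ?exprn_ge0// ltW ?pos_gt0.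
have mK : measurable_fun setT K.
  by apply: measurable_funM => //; apply: measurable_funX; exact: measurable_pos.
have posE u : Rpos u -> pos u = u by move=> /Rpos_gt0 u0; rewrite /pos u0.
pose f1 (z : Om * R) := (K z.2 * (\prod_(i < n) mass mu (A i) z.1 *
  expR (- (pos z.2 * mass mu setT z.1))))%:E.
pose f2 (z : n.-tuple (borel X) * R) := (K z.2 * dens (x0 :: z.1) (cst (pos z.2)))%:E.
have prod_ge0 w : 0 <= \prod_(i < n) mass mu (A i) w.
  by apply: prodr_ge0 => i _; exact: mass_ge0.
have mf1 : measurable_fun setT f1.
  apply/measurable_EFinP; apply: measurable_funM; first exact: measurableT_comp.
  apply: measurable_funM.
    apply: measurable_prod => i _.
    by apply: (measurableT_comp (measurable_mass _ (mA i))).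
  apply: measurableT_comp => //; apply: measurableT_comp => //.
  apply: measurable_funM; first exact: (measurableT_comp measurable_pos).
  exact: (measurableT_comp (measurable_mass _ measurableT)).
have mf2 : measurable_fun setT f2.
  apply/measurable_EFinP; apply: measurable_funM; first exact: measurableT_comp.
  exact: measurable_dens_joint.
have f1_0 z : (0 <= f1 z)%E.
  by rewrite lee_fin; apply: mulr_ge0; rewrite // mulr_ge0 ?expR_ge0.
have f2_0 z : (0 <= f2 z)%E.
  by rewrite lee_fin; apply: mulr_ge0; rewrite //; exact: urn_density_ge0.
transitivity (\int[Pr]_(w in D) \int[leb]_(u in Rpos) f1 (w, u))%E.
  apply: eq_integral => w; rewrite inE => Dw; rewrite (mass_ratio_gamma n0 mA Dw).
  by apply: eq_integral => u; rewrite inE => u0; rewrite /f1/= /K posE.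
rewrite (tonelli_domain Pr leb mD mRpos mf1 f1_0).
transitivity (\int[leb]_(u in Rpos) \int[L]_(x in rect A) f2 (x, u))%E; last first.
  rewrite -(tonelli_domain L leb mrA mRpos mf2 f2_0).
  apply: eq_integral => x _.
  by apply: eq_integral => u; rewrite inE => u0; rewrite /f2/= /K posE.
apply: eq_integral => u; rewrite inE => u0; have u_gt0 := Rpos_gt0 u0.
have au := @admissible_cst R X u u_gt0.
pose g1 w := (\prod_(i < n) mass mu (A i) w * laplace mu (cst u) w)%:E.
pose g2 (x : n.-tuple (borel X)) := (dens (x0 :: x) (cst u))%:E.
have g1_0 w : D w -> (0 <= g1 w)%E.
  by move=> _; rewrite lee_fin; apply: mulr_ge0; [exact: prod_ge0|exact: expR_ge0].
have g2_0 x : rect A x -> (0 <= g2 x)%E.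
  by move=> _; rewrite lee_fin; exact: urn_density_ge0.
have mg1 : measurable_fun D g1.
  apply/measurable_EFinP; apply: measurable_funTS; apply: measurable_funM.
    by apply: measurable_prod => i _; exact: measurable_mass.
  exact: measurable_laplace au.
have mg2 : measurable_fun (rect A) g2.
  by apply/measurable_EFinP; apply: measurable_funTS; exact: measurable_dens_tuple au.
transitivity (\int[Pr]_(w in D) ((K u)%:E * g1 w))%E.
  apply: eq_integral => w; rewrite inE => Dw; rewrite -EFinM.
  by rewrite (laplace_cst u_gt0 Dw) /f1/= posE.
rewrite (ge0_integralZl_EFin Pr mD g1_0 mg1 (K0 u)) (palmL A (cst u) u mA au).
rewrite -(ge0_integralZl_EFin L mrA g2_0 mg2 (K0 u)).
by apply: eq_integral => x _; rewrite /f2/= posE.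
Qed.

End sample_rect.

(** * Moments of the normalised measure *)

Section prior_moments.
Context {R : realType} {X : ptopologicalType} (rho : R -> R).
Context (rho_meas : measurable_fun [set s : R | 0 < s] rho)
  (rho_ge0 : forall s : R, 0 < s -> 0 <= rho s)
  (rho_levy : (\int[@lebesgue_measure R]_(s in `]0%R, +oo[)
                 (Num.min 1%R s * rho s)%:E < +oo)%E)
  (rho_infinite : (\int[@lebesgue_measure R]_(s in `]0%R, +oo[)
                     (rho s)%:E = +oo)%E).
Context (c zeta : R) (c_gt0 : 0 < c) (zeta01 : 0 < zeta < 1).
Context (x0 : borel X) (Pstar : probability (borel X) R).
Context (P0 : probability (borel X) R) (P0E : forall A, measurable A ->
  P0 A = (zeta%:E * \d_x0 A + (1 - zeta)%:E * Pstar A)%E).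
Context {dO} {Om : measurableType dO} (Pr : probability Om R)
  (mu : R.-ker Om ~> borel X) (hmu : is_homogeneous_crm rho c P0 Pr mu).
Context (Q : probability (pprobability (borel X) R) R)
  (QE : forall B : set (pprobability (borel X) R), measurable B ->
    Q B = Pr [set w | B (mnormalize (mu w) P0 : pprobability (borel X) R)]).
Local Notation D := (finite_mass mu).

Let Phi (w : Om) : pprobability (borel X) R := mnormalize (mu w) P0.

Let mPhi : measurable_fun setT Phi.
Proof.
apply: (measurability (@pset _ _ _ : set (set (pprobability (borel X) R)))) => //.
move=> _ -[_ [r r01] [U mU <-]] <-.
apply: emeasurable_fun_infty_o => //.
exact: (measurable_kernel (knormalize mu P0)).
Qed.

Lemma measurable_prob_eval (A : set (borel X)) : measurable A ->
  measurable_fun setT (fun p : pprobability (borel X) R => p A).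
Proof.
move=> mA; exact: (measurable_kernel (kprobability (P := id) (@measurable_id _ _ _)) A mA).
Qed.

Lemma measurable_prod_eval n (A : 'I_n -> set (borel X)) :
  (forall i, measurable (A i)) ->
  measurable_fun setT (fun p : pprobability (borel X) R => \prod_(i < n) p (A i))%E.
Proof.
move=> mA; rewrite (_ : (fun p => _) = fun p : pprobability (borel X) R =>
    (\prod_(i < n) fine (p (A i)))%:E).
  apply/measurable_EFinP; apply: measurable_prod => i _.
  by apply: (measurableT_comp (fine_measurable measurableT)) => //; exact: measurable_prob_eval.
apply/funext => p; rewrite -prodEFin; apply: eq_bigr => i _.
by rewrite fineK// fin_num_measure.
Qed.

Lemma prior_moment n (A : 'I_n -> set (borel X)) : (forall i, measurable (A i)) ->
  (\int[Q]_p \prod_(i < n) p (A i) =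
   \int[Pr]_(w in D) (\prod_(i < n) mass mu (A i) w / mass mu setT w ^+ n)%:E)%E.
Proof.
move=> mA; have mD := finite_mass_measurable mu.
have mprod := measurable_prod_eval mA.
have prod_ge0 (p : pprobability (borel X) R) : (0 <= \prod_(i < n) p (A i))%E.
  by apply: prode_ge0 => i _; exact: measure_ge0.
pose QP : {measure set (pprobability (borel X) R) -> \bar R} :=
  measure_function_pushforward__canonical__measure_function_Measure Pr mPhi.
rewrite (eq_measure_integral QP); last first.
  by move=> B mB _; etransitivity; first exact: (QE mB).
rewrite (ge0_integral_pushforward mPhi)//.
rewrite preimage_setT (integral_finite_mass hmu); first last.
- by move=> w; exact: prod_ge0.
- exact: (measurableT_comp mprod mPhi).
set Z := [set w | mass mu setT w = 0].
have mZ : measurable Z.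
  rewrite -[X in measurable X]setTI.
  rewrite (_ : Z = mass mu setT @^-1` [set 0])//.
  exact: (measurable_mass _ measurableT).
have mDZ : measurable (D `&` Z) by exact: measurableI.
(* At zero total mass [mnormalize] returns [P0] instead of the ratio; this null event is
   discarded. *)
have DZ0 : Pr (D `&` Z) = 0%E.
  exact: (total_mass_gt0 rho_meas rho_ge0 rho_levy rho_infinite c_gt0 zeta01 P0E hmu).
have mratio : measurable_fun setT
    (fun w => (\prod_(i < n) mass mu (A i) w / mass mu setT w ^+ n)%:E).
  apply/measurable_EFinP; apply: measurable_funM.
    by apply: measurable_prod => i _; exact: measurable_mass.
  rewrite (_ : (fun w => _) = fun w => (mass mu setT w ^+ n) `^ (-1)); last first.
    by apply/funext => w; rewrite powR_inv1// exprn_ge0// mass_ge0.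
  apply: (measurableT_comp (@measurable_powR R (-1))).
  by apply: measurable_funX; exact: measurable_mass.
rewrite (ge0_negligible_integral mDZ mD)//; first last.
- by move=> w _; exact: prod_ge0.
- by apply: measurable_funTS; exact: (measurableT_comp mprod mPhi).
rewrite [RHS](ge0_negligible_integral mDZ mD)//; first last.
- move=> w _; rewrite lee_fin; apply: divr_ge0; last by rewrite exprn_ge0 ?mass_ge0.
  by apply: prodr_ge0 => i _; exact: mass_ge0.
- exact: measurable_funTS.
apply: eq_integral => w; rewrite inE => -[Dw /not_andP[//|Tw]].
have Tw0 : mass mu setT w != 0 by apply/eqP.
have PhiE B : measurable B -> Phi w B = (mass mu B w / mass mu setT w)%:E.
  move=> mB; rewrite /Phi /= /mnormalize -massE//.
  rewrite ifF ?massE// -?massE//.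
  by rewrite eqe (negbTE Tw0).
rewrite /= (eq_bigr (fun i => (mass mu (A i) w / mass mu setT w)%:E)); last first.
  by move=> i _; exact: PhiE.
by rewrite prodEFin big_split/= prodr_const card_ord exprVn.
Qed.

End prior_moments.

(** Rectangles form a pi-system and contain the one-coordinate cylinders that generate the product
    sigma-algebra. *)
Lemma tuple_measure_ext {R : realType} {X : ptopologicalType} n
    (m1 m2 : {measure set (n.-tuple (borel X)) -> \bar R}) :
  (m1 setT < +oo)%E ->
  (forall A : 'I_n -> set (borel X), (forall i, measurable (A i)) ->
    m1 (rect A) = m2 (rect A)) ->
  forall B, measurable B -> m1 B = m2 B.
Proof.
move=> m1T m12 B mB.
pose G : set (set (n.-tuple (borel X))) :=
  [set rect A | A in [set A : 'I_n -> set (borel X) | forall i, measurable (A i)]].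
have rectT : rect (fun=> setT) = [set: n.-tuple (borel X)].
  by apply/seteqP; split.
apply: (measure_unique G (fun=> setT)) => //.
- rewrite eqEsubset; split.
    apply: smallest_sub; first exact: smallest_sigma_algebra.
    move=> S; rewrite -bigcup_seq/= => -[i _ [C mC <-]].
    apply: sub_sigma_algebra; exists (fun j => if j == i then C else setT).
      by move=> j; case: ifP.
    apply/seteqP; split => [x /(_ i)|x [_ xC] j]; first by rewrite eqxx.
    by case: eqP => // ->.
  apply: smallest_sub; first exact: sigma_algebra_measurable.
  by move=> _ [A mA <-]; exact: measurable_rect.
- move=> _ _ [A mA <-] [A' mA' <-]; exists (fun i => A i `&` A' i).
    by move=> i; exact: measurableI.
  apply/seteqP; split => [x xAA'|x [xA xA'] i]; last by split.
  by split => i; have [] := xAA' i.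
- by move=> _; rewrite -rectT; exists (fun=> setT).
- by rewrite bigcup_const.
- by move=> _ [A mA <-]; exact: m12.
Qed.

(** * Conditioning on the sample *)

Section urn_kernel.
Context {R : realType} {d} {T : measurableType d} (P : probability T R) (x0 : T).
Context (n : nat) (f : n.+1.-tuple T -> \bar R) (mf : measurable_fun setT f)
  (f0 : forall z, (0 <= f z)%E).
Local Open Scope ereal_scope.

Let mfx (x : n.-tuple T) : measurable_fun setT (fun y => f [tuple of y :: x]).
Proof.
apply: (measurableT_comp mf); apply: measurable_cons; first exact: measurable_id.
exact: measurable_cst.
Qed.

Definition urn_kernel : n.-tuple T -> {measure set T -> \bar R} :=
  fun x => density (measure_add P (msum (fun i => \d_(nth x0 (x0 :: x) i)) n.+1))
    (mfx x) (fun y => f0 _).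

Local Notation J := urn_kernel.

Lemma urn_kernelE x A : measurable A ->
  J x A = \int[P]_(y in A) f [tuple of y :: x] +
    \sum_(i < n.+1) \d_(nth x0 (x0 :: x) i) A * f [tuple of nth x0 (x0 :: x) i :: x].
Proof.
move=> mA; rewrite -[LHS]/(\int[measure_add _ _]_(y in A) f [tuple of y :: x]).
rewrite ge0_integral_measure_add//; last exact: measurable_funTS.
rewrite ge0_integral_measure_sum//; last exact: measurable_funTS.
congr (_ + _); apply: eq_bigr => i _.
by rewrite integral_dirac//; exact: measurable_funTS.
Qed.

Let measurable_urn_kernel A : measurable A -> measurable_fun setT (J ^~ A).
Proof.
move=> mA; under eq_fun do rewrite urn_kernelE//.
apply: emeasurable_funD.
  pose F (p : n.-tuple T * T) := f [tuple of p.2 :: p.1] * (\1_A p.2)%:E.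
  have mF : measurable_fun setT F.
    apply: emeasurable_funM.
      by apply: (measurableT_comp mf); exact: measurable_cons.
    by apply/measurable_EFinP; apply: (measurableT_comp (measurable_indic mA)).
  have := @measurable_fun_fubini_tonelli_F _ _ _ _ _ P F mF
    (fun p => mule_ge0 (f0 _) _).
  rewrite (_ : fubini_F P F = fun x => \int[P]_(y in A) f [tuple of y :: x]).
    by apply => p; rewrite lee_fin.
  apply/funext => x; rewrite /fubini_F [RHS]integral_mkcond.
  apply: eq_integral => y _; rewrite /F patchE indicE.
  by case: (y \in A); rewrite ?mule1 ?mule0.
apply: emeasurable_sum => i; apply: emeasurable_funM.
  rewrite (_ : (fun x => _) = fun x : n.-tuple T => (\1_A (nth x0 (x0 :: x) i))%:E)//.
  apply/measurable_EFinP; apply: (measurableT_comp (measurable_indic mA)).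
  exact: measurable_nth_cons.
by apply: (measurableT_comp mf); apply: measurable_cons => //; exact: measurable_nth_cons.
Qed.

HB.instance Definition _ := isKernel.Build _ _ _ _ _ J measurable_urn_kernel.

(** Disintegration of the weighted urn measure along the earlier points, which are the tail of the
    tuple. *)
Lemma integral_urn_kernel (L : {finite_measure set (n.-tuple T) -> \bar R}) A B :
  measurable A -> measurable B ->
  \int[urn_measure P x0 L]_(z in [set z | A (tnth z ord0) /\ B [tuple of behead z]]) f z =
  \int[L]_(x in B) J x A.
Proof.
move=> mA mB; set S := [set z | _].
have mS : measurable S.
  rewrite (_ : S = (@tnth _ _ ^~ ord0) @^-1` A `&`
      (fun z : n.+1.-tuple T => [tuple of behead z]) @^-1` B)//.
  apply: measurableI; rewrite -[X in measurable X]setTI.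
    exact: measurable_tnth.
  exact: measurable_behead.
have mfS : measurable_fun setT (f \_ S).
  by apply/(measurable_restrictT _ mS); exact: measurable_funTS.
have fS0 z : 0 <= (f \_ S) z by rewrite patchE; case: ifP.
rewrite [LHS]integral_mkcond (integral_urn_measure P x0 L mfS fS0) [RHS]integral_mkcond.
have SE y (x : n.-tuple T) : ([tuple of y :: x] \in S) = (y \in A) && (x \in B).
  have bx : [tuple of behead [tuple of y :: x]] = x by apply/val_inj.
  apply/idP/andP => [|[]]; rewrite !inE /S /= tnth0 bx; first by case.
  by split.
apply: eq_integral => x _; rewrite patchE; case: ifP => xB; last first.
  rewrite integral0_eq; last by move=> y _; rewrite patchE SE xB andbF.
  by rewrite add0e big1// => i _; rewrite patchE SE xB andbF.
rewrite urn_kernelE//; congr (_ + _).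
  by rewrite [RHS]integral_mkcond; apply: eq_integral => y _; rewrite !patchE SE xB andbT.
apply: eq_bigr => i _; rewrite patchE SE xB andbT diracE.
by case: (_ \in A); rewrite ?mul1e ?mul0e.
Qed.

End urn_kernel.

(** * Regular conditional distributions from a joint density *)

Section predictive.
Context {R : realType} {X : ptopologicalType} (hX : polish R X).
Context (P : probability (borel X) R) (x0 : borel X) (n : nat).
Context (L : {finite_measure set (n.-tuple (borel X)) -> \bar R}).
Context (fn : n.-tuple (borel X) -> \bar R) (mfn : measurable_fun setT fn)
  (fn0 : forall x, (0 <= fn x)%E).
Context (f1 : n.+1.-tuple (borel X) -> \bar R) (mf1 : measurable_fun setT f1)
  (f10 : forall z, (0 <= f1 z)%E).
Context {dO} {Om : measurableType dO} (Pr : probability Om R).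
Context (Z : Om -> n.-tuple (borel X)) (mZ : measurable_fun setT Z)
  (Y : Om -> borel X) (mY : measurable_fun setT Y).
Context (lawZ_rect : forall A : 'I_n -> set (borel X), (forall i, measurable (A i)) ->
    Pr (Z @^-1` rect A) = (\int[L]_(x in rect A) fn x)%E)
  (lawYZ_rect : forall A : 'I_n.+1 -> set (borel X), (forall i, measurable (A i)) ->
    Pr ((fun w => [tuple of Y w :: Z w]) @^-1` rect A) =
    (\int[urn_measure P x0 L]_(z in rect A) f1 z)%E).
Local Open Scope ereal_scope.
Local Notation J := (urn_kernel P x0 mf1 f10).

Let push {d2} {T2 : measurableType d2} (h : Om -> T2) (mh : measurable_fun setT h) :
    {measure set T2 -> \bar R} :=
  measure_function_pushforward__canonical__measure_function_Measure Pr mh.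

Lemma conditioning_law B : measurable B -> Pr (Z @^-1` B) = \int[L]_(x in B) fn x.
Proof.
move=> mB; apply: (@tuple_measure_ext _ _ _ (push mZ) (density L mfn fn0)) => //.
by rewrite /= /pushforward preimage_setT probability_setT ltry.
Qed.

Lemma joint_law A B : measurable A -> measurable B ->
  Pr (Y @^-1` A `&` Z @^-1` B) = \int[L]_(x in B) J x A.
Proof.
move=> mA mB; rewrite -integral_urn_kernel//.
have mYZ : measurable_fun setT (fun w => [tuple of Y w :: Z w] : n.+1.-tuple _).
  exact: measurable_cons.
set S := [set z | _].
have mS : measurable S.
  rewrite (_ : S = (@tnth _ _ ^~ ord0) @^-1` A `&`
      (fun z : n.+1.-tuple _ => [tuple of behead z]) @^-1` B)//.
  apply: measurableI; rewrite -[X in measurable X]setTI.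
    exact: measurable_tnth.
  exact: measurable_behead.
rewrite (_ : _ `&` _ = (fun w => [tuple of Y w :: Z w]) @^-1` S).
  apply: (@tuple_measure_ext _ _ _ (push mYZ) (density (urn_measure P x0 L) mf1 f10)) => //.
  by rewrite /= /pushforward preimage_setT probability_setT ltry.
have bx w : [tuple of behead [tuple of Y w :: Z w]] = Z w by apply/val_inj.
by apply/seteqP; split => w; rewrite /S /= tnth0 bx.
Qed.

Lemma integral_conditioning (h : n.-tuple (borel X) -> \bar R) B : measurable B ->
  measurable_fun setT h -> (forall x, 0 <= h x) ->
  \int[Pr]_(w in Z @^-1` B) h (Z w) = \int[L]_(x in B) (h x * fn x).
Proof.
move=> mB mh h0; rewrite -(integral_density L mfn fn0 mB mh h0).
transitivity (\int[push mZ]_(x in B) h x).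
  apply/esym; apply: (ge0_integral_pushforward mZ) => //.
  exact: measurable_funTS.
apply: eq_measure_integral => A mA _.
exact: conditioning_law.
Qed.

Lemma ae_conditioning (Q : n.-tuple (borel X) -> Prop) :
  (\forall x \ae L, Q x) -> \forall w \ae Pr, Q (Z w).
Proof.
move=> [N [mN N0 QN]]; exists (Z @^-1` N); split.
- by rewrite -[X in measurable X]setTI; exact: mZ.
- by rewrite conditioning_law// null_set_integral// ; apply/measurable_funTS.
- by move=> w /= nQ; exact: QN.
Qed.

Lemma conditioning_integrable : L.-integrable setT fn.
Proof.
apply/integrableP; split => //; under eq_integral do rewrite gee0_abs//.
by rewrite -conditioning_law// preimage_setT probability_setT ltry.
Qed.

Lemma urn_kernel_total : \forall x \ae L, J x setT = fn x /\ fn x \is a fin_num.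
Proof.
have h1 : ae_eq L setT fn (J ^~ setT).
  apply: integral_ae_eq => //.
  - exact: conditioning_integrable.
  - exact: measurable_kernel.
  - move=> E _ mE; rewrite -conditioning_law// -joint_law//.
    by rewrite preimage_setT setTI.
have h2 := integrable_ae measurableT conditioning_integrable.
by move: h1 h2; apply: filterS2 => x /(_ I) -> /(_ I).
Qed.

Lemma conditioning_density_gt0 : \forall w \ae Pr, 0 < fn (Z w).
Proof.
have mN : measurable (fn @^-1` [set 0]) by rewrite -[X in measurable X]setTI; exact: mfn.
exists (Z @^-1` (fn @^-1` [set 0])); split.
- by rewrite -[X in measurable X]setTI; exact: mZ.
- by rewrite conditioning_law// integral0_eq.
- by move=> w /= /negP; rewrite lt_neqAle fn0 andbT negbK => /eqP.
Qed.

Lemma regular_cond_dist_exists :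
  exists kappa : R.-pker (n.-tuple (borel X)) ~> (borel X),
    is_regular_cond_dist Pr Y Z kappa.
Proof.
exists (knormalize J P) => A mA; split; first exact: measurable_kernel.
move=> B mB; rewrite joint_law//.
have mkA : measurable_fun setT (knormalize J P ^~ A) by exact: measurable_kernel.
rewrite [RHS](integral_conditioning mB mkA (fun x => measure_ge0 _ _)).
apply: ge0_ae_eq_integral => //.
- by apply: measurable_funTS; exact: measurable_kernel.
- apply: measurable_funTS; apply: emeasurable_funM => //; exact: measurable_kernel.
- by move=> x _; rewrite mule_ge0.
move: urn_kernel_total; apply: filterS => x [JT fin] _.
(* Normalisation falls back on [P] when the total is 0 or [+oo]. In the first case [J x A] is 0 as
   well; the second is excluded by finiteness. *)
rewrite /knormalize /= /mnormalize JT; case: ifPn => [/orP[/eqP f0|/eqP foo]|].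
- rewrite f0 mule0; apply/eqP; rewrite -measure_le0 -f0 -JT.
  by apply: le_measure; rewrite ?inE.
- by rewrite foo in fin.
- rewrite negb_or => /andP[f0 _]; rewrite -[X in _ * X](fineK fin) -muleA -EFinM.
  by rewrite mulVf ?mule1// fine_eq0.
Qed.

(** For a fixed set two densities of the same law agree almost everywhere. The exceptional sets are
    united over the countable pi-system, which determines both measures. *)
Lemma regular_cond_dist_unique (kappa : R.-pker (n.-tuple (borel X)) ~> (borel X)) :
  is_regular_cond_dist Pr Y Z kappa ->
  \forall w \ae Pr, [/\ 0 < fn (Z w), fn (Z w) \is a fin_num,
    J (Z w) setT = fn (Z w) &
    forall A, measurable A -> J (Z w) A = fn (Z w) * kappa (Z w) A].
Proof.
move=> hk; have [U hU _] := polish_base hX.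
have mk A (mA : measurable A) : measurable_fun setT (kappa ^~ A).
  exact: measurable_kernel.
have k_le1 x A : measurable A -> kappa x A <= 1.
  by move=> mA; rewrite -(@prob_kernel _ _ _ _ _ kappa x); apply: le_measure; rewrite ?inE.
have ae_cap l : \forall x \ae L, fn x * kappa x (base_cap U l) = J x (base_cap U l).
  have mA : measurable (base_cap U l : set (borel X)) by exact: base_cap_measurable.
  have : ae_eq L setT (fun x => fn x * kappa x (base_cap U l)) (J ^~ (base_cap U l)).
    apply: integral_ae_eq => //.
    - apply: le_integrable conditioning_integrable => //.
        by apply: emeasurable_funM => //; exact: mk.
      move=> x _; rewrite !gee0_abs ?mule_ge0//.
      by rewrite -[leRHS]mule1 lee_wpmul2l// k_le1.
    - exact: measurable_kernel.
    - move=> E _ mE; rewrite -joint_law//; have [_ ->//] := hk _ mA.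
      rewrite (integral_conditioning mE (mk _ mA) (fun x => measure_ge0 _ _)).
      by apply: eq_integral => x _; rewrite muleC.
  by apply: filterS => x /(_ I).
have ae_all : \forall x \ae L, forall l, fn x * kappa x (base_cap U l) = J x (base_cap U l).
  (* Lists are enumerated through their codes, so that countably many null sets are united. *)
  have /ae_foralln : forall m, \forall x \ae L, forall l, pickle l = m ->
      fn x * kappa x (base_cap U l) = J x (base_cap U l).
    move=> m; case Em : (unpickle m : option (seq nat)) => [l|].
      apply: filterS (ae_cap l) => x h l' l'm.
      by move: Em; rewrite -l'm pickleK => -[->].
    by apply: nearW => x l lm; move: Em; rewrite -lm pickleK.
  by apply: filterS => x h l; exact: (h (pickle l)).
have h1 := ae_conditioning urn_kernel_total.
have h2 := ae_conditioning ae_all.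
apply: filterS3 conditioning_density_gt0 h1 h2 => w fpos [JT fin] Jall.
split => // A mA.
have r0 : (0 <= fine (fn (Z w)))%R by rewrite fine_ge0.
(* Rescaling [kappa] by the finite value of [fn] gives a finite measure to compare with [J]. *)
have := @borel_measure_ext R X U (mscale (NngNum r0) (kappa (Z w))) (J (Z w)) hU.
have mE B : mscale (NngNum r0) (kappa (Z w)) B = fn (Z w) * kappa (Z w) B.
  by rewrite -{2}(fineK fin).
have kT : kappa (Z w) setT = 1 by exact: (@prob_kernel _ _ _ _ _ kappa).
move=> h; rewrite -(h _ _ A mA); first exact: mE.
  suff : fn (Z w) * kappa (Z w) setT < +oo by rewrite -mE.
  by rewrite kT mule1 ltey_eq fin.
by move=> l; rewrite -Jall; exact: mE.
Qed.

End predictive.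

(** * The law of a conditionally i.i.d. sample *)

Section exchangeable_sample.
Context {R : realType} {X : ptopologicalType} (hX : polish R X) (rho : R -> R).
Context (rho_meas : measurable_fun [set s : R | 0 < s] rho)
  (rho_ge0 : forall s : R, 0 < s -> 0 <= rho s)
  (rho_levy : (\int[@lebesgue_measure R]_(s in `]0%R, +oo[)
                 (Num.min 1%R s * rho s)%:E < +oo)%E)
  (rho_infinite : (\int[@lebesgue_measure R]_(s in `]0%R, +oo[)
                     (rho s)%:E = +oo)%E).
Context (c zeta : R) (c_gt0 : 0 < c) (zeta01 : 0 < zeta < 1).
Context (x0 : borel X) (Pstar : probability (borel X) R) (Pd : diffuse Pstar).
Local Notation leb := (@lebesgue_measure R).
Local Notation Rpos := (`]0%R, +oo[%classic : set R).
Local Notation fdens := (sample_density rho c zeta x0 Pstar).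

Lemma measurable_sample_density m n :
  measurable_fun setT (fun x : n.-tuple (borel X) => fdens m x).
Proof.
pose F (z : n.-tuple (borel X) * R) := ((m.-1)`!%:R^-1 * pos z.2 ^+ m.-1 *
  urn_density rho c zeta x0 Pstar (x0 :: z.1) (cst (pos z.2)))%:E.
have mF : measurable_fun setT F.
  apply/measurable_EFinP; apply: measurable_funM; last exact: measurable_dens_joint.
  apply: measurable_funM => //; apply: measurable_funX.
  exact: (measurableT_comp measurable_pos).
pose G z := (F z * (\1_Rpos z.2)%:E)%E.
have mG : measurable_fun setT G.
  apply: emeasurable_funM => //; apply/measurable_EFinP.
  exact: (measurableT_comp (measurable_indic Rpos_measurable)).
have G0 z : (0 <= G z)%E.
  apply: mule_ge0; last by rewrite lee_fin.
  rewrite lee_fin; apply: mulr_ge0; last exact: urn_density_ge0.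
  by apply: mulr_ge0; [rewrite invr_ge0|rewrite exprn_ge0// ltW ?pos_gt0].
have := @measurable_fun_fubini_tonelli_F _ _ _ _ _ leb G mG G0.
rewrite (_ : fubini_F leb G = fun x : n.-tuple (borel X) => fdens m x)//.
apply/funext => x; rewrite /fubini_F /sample_density [RHS]integral_mkcond.
apply: eq_integral => u _; rewrite /G /F patchE indicE /=.
case: ifPn => [|_]; last by rewrite mule0.
by rewrite inE => /Rpos_gt0 u0; rewrite mule1 /pos u0.
Qed.

Fixpoint urn_law n : {finite_measure set (n.-tuple (borel X)) -> \bar R} :=
  if n is n'.+1 then urn_measure Pstar x0 (urn_law n') else dirac [tuple].

Context (P0 : probability (borel X) R) (P0E : forall A, measurable A ->
  P0 A = (zeta%:E * \d_x0 A + (1 - zeta)%:E * Pstar A)%E).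
Context {dO} {Omega : measurableType dO} (Pr : probability Omega R)
  (Pt : {RV Pr >-> pprobability (borel X) R})
  (Pt_hNRMI : is_hNRMI rho c P0 (distribution Pr Pt))
  (Xs : nat -> {RV Pr >-> borel X})
  (Xs_iid : cond_iid Pr (fun i => Xs i) Pt).

Lemma moment_density n (A : 'I_n -> set (borel X)) : (0 < n)%N ->
  (forall i, measurable (A i)) ->
  (\int[distribution Pr Pt]_p \prod_(i < n) p (A i) =
   \int[urn_law n]_(x in rect A) fdens n x)%E.
Proof.
move=> n0 mA; have [dO' [Om' [Pr' [mu [hmu QE]]]]] := Pt_hNRMI.
have palmL m : palm rho c zeta x0 Pstar Pr' mu (urn_law m).
  elim: m => [|m ih]; first exact: (palm0 hX rho_meas rho_ge0 rho_levy zeta01 P0E hmu).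
  exact: (palm_step hX rho_meas rho_ge0 rho_levy c_gt0 zeta01 Pd ih).
rewrite -(mass_ratio_density hX rho_meas rho_ge0 rho_levy c_gt0 zeta01 n0 (palmL n) mA).
exact: (prior_moment rho_meas rho_ge0 rho_levy rho_infinite c_gt0 zeta01 P0E hmu QE mA).
Qed.

Lemma sample_moment n (A : 'I_n -> set (borel X)) : (forall i, measurable (A i)) ->
  (Pr (\bigcap_(i in [set: 'I_n]) (Xs i @^-1` A i)) =
   \int[distribution Pr Pt]_p \prod_(i < n) p (A i))%E.
Proof.
move=> mA; have [_ /(_ setT measurableT)] := Xs_iid mA.
rewrite preimage_setT setIT => ->.
have mPt : measurable_fun setT Pt by exact: measurable_funPT.
apply/esym; apply: (ge0_integral_pushforward mPt) => //.
- exact: measurable_prod_eval.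
- by move=> p _; apply: prode_ge0 => i _; exact: measure_ge0.
Qed.

Lemma measurable_sample n : measurable_fun setT (sample (fun i => Xs i) n).
Proof.
apply/measurable_fun_tnthP => i.
rewrite (_ : _ \o _ = Xs i); first exact: measurable_funPT.
by apply/funext => w /=; rewrite /sample tnth_mktuple.
Qed.

Lemma sample_tuple_law n (A : 'I_n -> set (borel X)) : (0 < n)%N ->
  (forall i, measurable (A i)) ->
  Pr (sample (fun i => Xs i) n @^-1` rect A) =
  (\int[urn_law n]_(x in rect A) fdens n x)%E.
Proof.
move=> n0 mA; rewrite -moment_density// -sample_moment//; congr (Pr _).
apply/seteqP; split => w h i; first by move=> _; have := h i; rewrite tnth_mktuple.
by rewrite /sample tnth_mktuple; exact: h.
Qed.

(** The last observation stands at the head here, but last in the order of the sample. Moments are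
    symmetric in the sets, so the sets may be rotated by [ordS], which sends the last index to 0. *)
Lemma sample_cons_law n (A : 'I_n.+1 -> set (borel X)) :
  (forall i, measurable (A i)) ->
  Pr ((fun w => [tuple of Xs n w :: sample (fun i => Xs i) n w]) @^-1` rect A) =
  (\int[urn_measure Pstar x0 (urn_law n)]_(x in rect A) fdens n.+1 x)%E.
Proof.
move=> mA; transitivity (\int[urn_law n.+1]_(x in rect A) fdens n.+1 x)%E => //.
rewrite -moment_density//.
transitivity (\int[distribution Pr Pt]_p \prod_(i < n.+1) p (A (ordS i)))%E; last first.
  apply: eq_integral => p _; apply/esym.
  by rewrite (reindex_inj (@ordS_inj n.+1)).
rewrite -(sample_moment (fun i => mA (ordS i))).
congr (Pr _); apply/seteqP; split => w h i; last first.
  have [->|i0] := eqVneq i ord0.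
    have := h ord_max I; rewrite tnth0 (_ : ordS ord_max = ord0)//.
    by apply/val_inj; rewrite /= modnn.
  have [j ->] : exists j, i = lift ord0 j.
    by case: (unliftP ord0 i) => [j ->|ie]; [exists j|rewrite ie eqxx in i0].
  rewrite tnthS tnth_mktuple.
  have := h (widen_ord (leqnSn n) j) I; rewrite (_ : ordS _ = lift ord0 j)//.
  by apply/val_inj; rewrite /= modn_small// ltnS.
move=> _; have := h (ordS i); rewrite /preimage /=.
case: (ltnP i n) => [ni|ni].
  rewrite (_ : ordS i = lift ord0 (Ordinal ni)); last first.
    by apply/val_inj; rewrite /= modn_small// ltnS.
  by rewrite tnthS tnth_mktuple.
have -> : i = ord_max by apply/val_inj/eqP; rewrite eqn_leq -ltnS ltn_ord.
rewrite (_ : ordS ord_max = ord0) ?tnth0//.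
by apply/val_inj; rewrite /= modnn.
Qed.

End exchangeable_sample.

(** * Evaluation of the predictive distribution *)

Lemma big_displays {T : eqType} {n k : nat} {x : n.-tuple T} {xs : 'I_k -> T}
    {nu : 'I_k -> nat} : displays x xs nu ->
  forall (M : Type) (idx : M) (op : Monoid.com_law idx) (P : pred T) (G : T -> M),
  \big[op/idx]_(z <- undup x | P z) G z = \big[op/idx]_(m < k | P (xs m)) G (xs m).
Proof.
move=> [xs_inj xsE _] M idx op P G.
have px : perm_eq (undup x) [seq xs m | m <- enum 'I_k].
  apply: uniq_perm; first exact: undup_uniq.
    by rewrite map_inj_uniq ?enum_uniq.
  move=> z; rewrite mem_undup; apply/idP/mapP => [/xsE[m <-]|[m _ ->]].
    by exists m => //; rewrite mem_enum.
  by apply/xsE; exists m.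
by rewrite (perm_big _ px) big_map big_enum_cond.
Qed.

Section predictive_weights.
Context {R : realType} {X : ptopologicalType} (hX : polish R X) (rho : R -> R).
Context (rho_meas : measurable_fun [set s : R | 0 < s] rho)
  (rho_ge0 : forall s : R, 0 < s -> 0 <= rho s)
  (rho_levy : (\int[@lebesgue_measure R]_(s in `]0%R, +oo[)
                 (Num.min 1%R s * rho s)%:E < +oo)%E).
Context (c zeta : R) (c_gt0 : 0 < c) (zeta01 : 0 < zeta < 1).
Context (x0 : borel X) (Pstar : probability (borel X) R) (Pd : diffuse Pstar).
Local Notation leb := (@lebesgue_measure R).
Local Notation Rpos := (`]0%R, +oo[%classic : set R).
Local Notation psi := (psi rho).
Local Notation tau := (tau rho).
Local Notation b := (c * (1 - zeta)).
Local Notation dens := (urn_density rho c zeta x0 Pstar).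
Local Notation fdens := (sample_density rho c zeta x0 Pstar).

(** [exp_bell] at [a = c zeta] without its exponential, which merges with the bulk weight into
    [exp (- c psi)]. *)
Definition bell_sum (q : nat) (u : R) : R :=
  \sum_(i < q.+1) (c * zeta) ^+ i * bell (tau^~ u) i q.

Lemma urn_density_cst (s : seq (borel X)) (u : R) :
  dens (x0 :: s) (cst u) = expR (- (c * psi u)) *
    (bell_sum (count_mem x0 s) u / (count_mem x0 s)`!%:R) *
    \prod_(z <- undup s | z != x0)
       (b * tau (count_mem z s) u / ((count_mem z s).-1)`!%:R).
Proof.
rewrite /urn_density bulk_weight_cst.
have -> : sites_weight rho c zeta x0 (x0 :: s) (cst u) =
    site_weight rho c zeta x0 x0 (count_mem x0 s) u *
    \prod_(z <- undup s | z != x0)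
       (b * tau (count_mem z s) u / ((count_mem z s).-1)`!%:R).
  rewrite /sites_weight (bigD1_seq x0) ?undup_uniq ?mem_undup ?mem_head//= eqxx add1n.
  congr (_ * _).
  transitivity (\prod_(z <- undup s | z != x0)
      site_weight rho c zeta x0 z (count_mem z (x0 :: s)).-1 u).
    case: ifP => _ //; by rewrite big_cons eqxx.
  rewrite big_seq_cond [RHS]big_seq_cond; apply: eq_bigr => z.
  rewrite mem_undup => /andP[zs zx0].
  rewrite /site_weight (negbTE zx0) /= eq_sym (negbTE zx0) add0n prednK//.
  by rewrite -has_count has_pred1.
rewrite /site_weight eqxx /exp_bell -/(bell_sum _ u) mulrA; congr (_ * _).
rewrite !mulrA -expRD; congr (expR _ * _ * _); ring.
Qed.

Context (n k : nat) (x : n.-tuple (borel X)) (xs : 'I_k -> borel X)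
  (nu : 'I_k -> nat) (xD : displays x xs nu).
Local Notation p := (count_mem x0 x).

(** Collects the factors independent of [u]; it cancels from the predictive ratio. *)
Let K : R := (\prod_(m < k | xs m != x0) (b / ((nu m).-1)`!%:R)) / p`!%:R.

Let K_gt0 : 0 < K.
Proof.
case/andP: zeta01 => z0 z1; have bp : 0 < b by rewrite mulr_gt0// subr_gt0.
apply: divr_gt0; last by rewrite ltr0n fact_gt0.
by apply: prodr_gt0 => m _; rewrite divr_gt0// ltr0n fact_gt0.
Qed.

Definition core (q r : nat) (T : R -> R) (u : R) : R :=
  u ^+ q * expR (- (c * psi u)) * bell_sum r u * T u.

Lemma core_sample (u : R) : dens (x0 :: x) (cst u) =
  K * core 0 p (fun u => \prod_(m < k | xs m != x0) tau (nu m) u) u.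
Proof.
have [_ _ nuE] := xD.
rewrite urn_density_cst (big_displays xD) /core /K expr0.
under eq_bigr do rewrite -nuE mulrAC.
by rewrite big_split/=; ring.
Qed.

Lemma core_new y (u : R) : y \notin x -> y != x0 ->
  dens [:: x0, y & x] (cst u) = b * K *
    core 0 p (fun u => tau 1 u * \prod_(m < k | xs m != x0) tau (nu m) u) u.
Proof.
move=> yx yx0; rewrite (@urn_density_perm _ _ _ _ _ _ _ _ [:: y, x0 & x]); last first.
  by rewrite -cat1s -[X in perm_eq _ X]cat1s -(cat1s x0) -(cat1s y x) perm_catCA.
rewrite /urn_density sites_weight_new//; last by rewrite inE negb_or yx0.
rewrite mulrCA -/(dens (x0 :: x) (cst u)) core_sample /core; ring.
Qed.

(** The divisor [p.+1] here, like [nu l] in [core_old], will be compensated by the number of list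
    entries at the site. *)
Lemma core_origin (u : R) : dens [:: x0, x0 & x] (cst u) = K / p.+1%:R *
    core 0 p.+1 (fun u => \prod_(m < k | xs m != x0) tau (nu m) u) u.
Proof.
have [_ _ nuE] := xD.
have h : \prod_(z <- undup (x0 :: x) | z != x0)
      (b * tau (count_mem z (x0 :: x)) u / ((count_mem z (x0 :: x)).-1)`!%:R) =
    \prod_(z <- undup x | z != x0)
      (b * tau (count_mem z x) u / ((count_mem z x).-1)`!%:R).
  transitivity (\prod_(z <- undup x | z != x0)
      (b * tau (count_mem z (x0 :: x)) u / ((count_mem z (x0 :: x)).-1)`!%:R)).
    by rewrite /=; case: ifP => _ //; rewrite big_cons eqxx.
  by apply: eq_bigr => z zx0; rewrite /= eq_sym (negbTE zx0).
rewrite urn_density_cst h (big_displays xD) /core /K expr0 /= eqxx add1n.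
under eq_bigr do rewrite -nuE mulrAC.
rewrite big_split/= factS natrM invfM; ring.
Qed.

Lemma core_old l (u : R) : xs l != x0 ->
  dens [:: x0, xs l & x] (cst u) = K / (nu l)%:R *
    core 0 p (fun u => tau (nu l).+1 u *
      \prod_(m < k | (xs m != x0) && (m != l)) tau (nu m) u) u.
Proof.
move=> lx0; have [xs_inj xsE nuE] := xD.
have lx : xs l \in x by apply/xsE; exists l.
have nul : (0 < nu l)%N by rewrite nuE -has_count has_pred1.
have h : \prod_(z <- undup (xs l :: x) | z != x0)
      (b * tau (count_mem z (xs l :: x)) u / ((count_mem z (xs l :: x)).-1)`!%:R) =
    b * tau (nu l).+1 u / (nu l)`!%:R *
      \prod_(m < k | (xs m != x0) && (m != l)) (b * tau (nu m) u / ((nu m).-1)`!%:R).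
  rewrite [undup _]/= lx (big_displays xD) (bigD1 l)//=.
  rewrite eqxx -nuE add1n; congr (_ * _); apply: eq_bigr => m /andP[_ ml].
  by rewrite (inj_eq xs_inj) eq_sym (negbTE ml) add0n -nuE.
rewrite urn_density_cst h /core /K expr0 /= (negbTE lx0) add0n [in RHS](bigD1 l)//=.
under eq_bigr do rewrite mulrAC.
have -> : (nu l)`!%:R = (nu l)%:R * ((nu l).-1)`!%:R :> R.
  by rewrite -{1}(prednK nul) factS prednK// natrM.
rewrite big_split/= invfM; ring.
Qed.

Let b_gt0 : 0 < b.
Proof. by case/andP: zeta01 => _ z1; rewrite mulr_gt0// subr_gt0. Qed.

Let a_ge0 : 0 <= c * zeta.
Proof. by case/andP: zeta01 => z0 _; rewrite mulr_ge0 ?(ltW c_gt0)// ltW. Qed.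

Lemma bell_sum_ge0 q u : 0 <= bell_sum q u.
Proof.
apply: sumr_ge0 => i _; apply: mulr_ge0; first exact: exprn_ge0.
by apply: bell_ge0 => r; exact: tau_ge0.
Qed.

Lemma measurable_bell i q : measurable_fun Rpos (fun u => bell (tau^~ u) i q).
Proof.
apply: differentiable_measurable_gt0 => u u0; eexists.
exact: (bell_derive (fun q v => tau_derive rho_meas rho_ge0 rho_levy (q := q) (v := v)) i q u0).
Qed.

Lemma measurable_bell_sum q : measurable_fun Rpos (bell_sum q).
Proof.
apply: measurable_sum => i; apply: measurable_funM; first exact: measurable_cst.
exact: measurable_bell.
Qed.

Lemma measurable_exp_psi : measurable_fun Rpos (fun u => expR (- (c * psi u))).
Proof.
apply: measurableT_comp => //; apply: measurableT_comp => //.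
by apply: measurable_funM => //; exact: psi_measurable.
Qed.

Definition weight (T : R -> R) := measurable_fun Rpos T /\ forall u, 0 <= T u.

Lemma weight_prod_tau (P : pred 'I_k) (F : 'I_k -> nat) :
  (forall m, (0 < F m)%N) -> weight (fun u => \prod_(m < k | P m) tau (F m) u).
Proof.
move=> F0; split; last by move=> u; apply: prodr_ge0 => m _; exact: tau_ge0.
rewrite (_ : (fun u => _) =
    fun u => \prod_(m < k) (if P m then tau (F m) u else 1)); last first.
  by apply/funext => u; rewrite big_mkcond.
by apply: measurable_prod => m _; case: (P m) => //; exact: tau_measurable.
Qed.

Lemma weight_tauM q T : (0 < q)%N -> weight T -> weight (fun u => tau q u * T u).
Proof.
move=> q0 [mT T0]; split; last by move=> u; apply: mulr_ge0; [exact: tau_ge0|].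
by apply: measurable_funM => //; exact: tau_measurable.
Qed.

Definition coreI (q r : nat) (T : R -> R) : \bar R :=
  (\int[leb]_(u in Rpos) (core q r T u)%:E)%E.

Lemma core_ge0 q r T u : weight T -> 0 < u -> 0 <= core q r T u.
Proof.
move=> [_ T0] u0; apply: mulr_ge0; last exact: T0.
apply: mulr_ge0; last exact: bell_sum_ge0.
by apply: mulr_ge0; [rewrite exprn_ge0// ltW|exact: expR_ge0].
Qed.

Lemma coreI_ge0 q r T : weight T -> (0 <= coreI q r T)%E.
Proof.
by move=> wT; apply: integral_ge0 => u /Rpos_gt0 u0; rewrite lee_fin; exact: core_ge0.
Qed.

Lemma measurable_core q r T : weight T -> measurable_fun Rpos (core q r T).
Proof.
move=> [mT _]; apply: measurable_funM => //; apply: measurable_funM.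
  apply: measurable_funM; last exact: measurable_exp_psi.
  by apply: measurable_funX; exact: measurable_id.
exact: measurable_bell_sum.
Qed.

Lemma sample_density_core (s : seq (borel X)) (M : R) q r T : 0 <= M -> weight T ->
  (forall u, dens (x0 :: s) (cst u) = M * core 0 r T u) ->
  fdens q.+1 s = ((M / q`!%:R)%:E * coreI q r T)%E.
Proof.
move=> M0 wT densE; rewrite /sample_density /coreI -ge0_integralZl_EFin//.
- apply: eq_integral => u _; rewrite -EFinM densE /core expr0 /=; congr EFin; ring.
- by move=> u /Rpos_gt0 u0; rewrite lee_fin; exact: core_ge0.
- by apply/measurable_EFinP; exact: measurable_core.
- by rewrite divr_ge0.
Qed.

Let nu_gt0 m : (0 < nu m)%N.
Proof.
have [_ xsE ->] := xD; rewrite -has_count has_pred1.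
by apply/xsE; exists m.
Qed.

Lemma xi_bell i q u : (i <= q)%N -> 0 < u -> xi rho q i u = bell (tau^~ u) i q.
Proof.
move=> iq u0; exact: (bell_inversion
  (fun q v => tau_derive rho_meas rho_ge0 rho_levy (q := q) (v := v))
  (psi_derive rho_meas rho_ge0 rho_levy) iq u0).
Qed.

(** [int0oo] is 0 on divergent integrals, so splitting it over a sum requires finite terms; by
    positivity this follows from finiteness of the whole. [G] leaves the order of the factors
    free. *)
Lemma int0oo_core_xi (q r : nat) (T : R -> R) (G : nat -> R -> R) : (0 < r)%N ->
  weight T -> (coreI q r T < +oo)%E ->
  (forall i u, (0 < i <= r)%N -> 0 < u ->
     G i u = u ^+ q * expR (- (c * psi u)) * xi rho r i u * T u) ->
  int0oo (core q r T) = \sum_(1 <= i < r.+1) c ^+ i * zeta ^+ i * int0oo (G i).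
Proof.
move=> r0 wT Ioo GE; have [mT T0] := wT.
pose w i u := u ^+ q * expR (- (c * psi u)) * bell (tau^~ u) i r * T u.
have w0 i u : Rpos u -> 0 <= w i u.
  move=> /Rpos_gt0 u0; apply: mulr_ge0; last exact: T0.
  apply: mulr_ge0; last by apply: bell_ge0 => m; exact: tau_ge0.
  by apply: mulr_ge0; [rewrite exprn_ge0// ltW|exact: expR_ge0].
have mw i : measurable_fun Rpos (w i).
  apply: measurable_funM => //; apply: measurable_funM; last exact: measurable_bell.
  apply: measurable_funM; last exact: measurable_exp_psi.
  by apply: measurable_funX; exact: measurable_id.
have a_gt0 i : 0 < (c * zeta) ^+ i by case/andP: zeta01 => z0 _; rewrite exprn_gt0// mulr_gt0.
have coreE : coreI q r T = (\sum_(i < r.+1) ((c * zeta) ^+ i)%:E * \int[leb]_(u in Rpos) (w i u)%:E)%E.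
  transitivity (\int[leb]_(u in Rpos) \sum_(i < r.+1) ((c * zeta) ^+ i * w i u)%:E)%E.
    apply: eq_integral => u _; rewrite sumEFin; congr EFin.
    rewrite /core /bell_sum mulr_sumr mulr_suml; apply: eq_bigr => i _; rewrite /w; ring.
  rewrite ge0_integral_sum//.
  - apply: eq_bigr => i _; under eq_integral do rewrite EFinM.
    rewrite (ge0_integralZl_EFin leb Rpos_measurable _ _ (ltW (a_gt0 i)))//.
    + by move=> u Ru; rewrite lee_fin; exact: w0.
    + by apply/measurable_EFinP; exact: mw.
  - move=> i; apply/measurable_EFinP; apply: measurable_funM; last exact: mw.
    exact: measurable_cst.
  - by move=> i u Ru; rewrite lee_fin; apply: mulr_ge0; [exact: ltW|exact: w0].
have Iw0 i : (0 <= \int[leb]_(u in Rpos) (w i u)%:E)%E.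
  by apply: integral_ge0 => u Ru; rewrite lee_fin; exact: w0.
have Iwoo (i : 'I_r.+1) : (\int[leb]_(u in Rpos) (w i u)%:E < +oo)%E.
  have : (((c * zeta) ^+ i)%:E * \int[leb]_(u in Rpos) (w i u)%:E < +oo)%E.
    apply: le_lt_trans Ioo; rewrite coreE (bigD1 i)//= leeDl//.
    apply: sume_ge0 => m _; apply: mule_ge0; last exact: Iw0.
    by rewrite lee_fin ltW.
  move: (Iw0 i); case: (\int[leb]_(u in _) _)%E => [y _ _|_|//]; rewrite ?ltry//.
  by rewrite gt0_muley// lte_fin.
have : int0oo (core q r T) = \sum_(0 <= i < r.+1) (c * zeta) ^+ i * int0oo (w i).
  apply: EFin_inj; rewrite [LHS]fineK; last first.
    by rewrite ge0_fin_numE; [exact: Ioo|exact: coreI_ge0].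
  rewrite -/(coreI q r T) coreE big_mkord -sumEFin; apply: eq_bigr => i _.
  rewrite EFinM; congr (_ * _)%E.
  by rewrite [RHS]fineK// ge0_fin_numE.
(* The term [i = 0] vanishes: a nonempty set has no partition into zero blocks. *)
move=> ->; rewrite big_ltn// (_ : int0oo (w 0%N) = 0) ?mulr0 ?add0r; last first.
  rewrite (_ : w 0%N = cst 0) /int0oo ?Rintegral_cst ?mul0r//.
  by apply/funext => u; rewrite /w /= (gtn_eqF r0) mulr0 mul0r.
rewrite big_nat_cond [RHS]big_nat_cond; apply: eq_bigr => i; rewrite andbT ltnS => ir.
rewrite exprMn; congr (_ * _); apply: eq_Rintegral => u; rewrite inE => /Rpos_gt0 u0.
by rewrite (GE i u ir u0) (xi_bell _ u0)//; case/andP: ir.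
Qed.

Definition rest u := \prod_(m < k | xs m != x0) tau (nu m) u.
Definition rest_without l u := \prod_(m < k | (xs m != x0) && (m != l)) tau (nu m) u.

Let weight_rest : weight rest. Proof. exact: weight_prod_tau. Qed.
Let weight_rest_without l : weight (rest_without l). Proof. exact: weight_prod_tau. Qed.

Definition origin_mass := coreI n p.+1 rest.
Definition bulk_mass := coreI n p (fun u => tau 1 u * rest u).
Definition site_mass l := coreI n p (fun u => tau (nu l).+1 u * rest_without l u).

Context (mf1 : measurable_fun setT (fun z : n.+1.-tuple (borel X) => fdens n.+1 z))
  (f10 : forall z : n.+1.-tuple (borel X), (0 <= fdens n.+1 z)%E).

Let bulk_mass_ge0 : (0 <= bulk_mass)%E.
Proof. by apply: coreI_ge0; exact: weight_tauM. Qed.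

Let origin_mass_ge0 : (0 <= origin_mass)%E.
Proof. exact: coreI_ge0. Qed.

Let site_mass_ge0 l : (0 <= site_mass l)%E.
Proof. by apply: coreI_ge0; exact: weight_tauM. Qed.

(** A repeated site occurs in [x0 :: x] as often as its multiplicity, which removes the divisors
    [p.+1] and [nu l]. All moves then share the constant [K / n!]. *)
Lemma urn_kernel_core A : measurable A ->
  (urn_kernel Pstar x0 mf1 f10 x A = (K / n`!%:R)%:E *
    (b%:E * bulk_mass * Pstar A + origin_mass * \d_x0 A +
     \sum_(l < k | xs l != x0) site_mass l * \d_(xs l) A))%E.
Proof.
move=> mA; rewrite urn_kernelE//.
have Kn0 : 0 <= K / n`!%:R by rewrite divr_ge0 ?(ltW K_gt0).
have Fn0 : n`!%:R != 0 :> R by rewrite pnatr_eq0 -lt0n fact_gt0.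
have iterE q (y : \bar R) : iter q (adde y) 0%E = (q%:R%:E * y)%E.
  elim: q => [|q ih]; first by rewrite mul0e.
  by rewrite iterS ih -nat1r EFinD ge0_muleDl ?mul1e ?lee_fin.
have newE : (\int[Pstar]_(y in A) fdens n.+1 [tuple of y :: x] =
    (K / n`!%:R)%:E * (b%:E * bulk_mass * Pstar A))%E.
  transitivity (\int[Pstar]_(y in A) ((K / n`!%:R)%:E * (b%:E * bulk_mass)))%E.
    apply: ae_eq_integral => //.
    - apply: measurable_funTS; apply: (measurableT_comp mf1).
      by apply: measurable_cons; [exact: measurable_id|exact: measurable_cst].
    apply: (negligibleS _ (diffuse_negligible_seq hX (x0 :: x) Pd)).
    move=> y /= /not_implyP[Ay]; apply: contra_notP => /negP.
    rewrite inE negb_or => /andP[yx0 yx].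
    have bK0 : 0 <= b * K by rewrite mulr_ge0// ltW.
    rewrite (sample_density_core n bK0 (weight_tauM _ weight_rest) (fun u => core_new u yx yx0))//.
    by rewrite muleA -EFinM; congr (_%:E * _)%E; ring.
  by rewrite integral_cst// !muleA.
pose G z := (\d_z A * fdens n.+1 (z :: x))%E.
have sumE : (\sum_(i < n.+1) \d_(nth x0 (x0 :: x) i) A *
      fdens n.+1 [tuple of nth x0 (x0 :: x) i :: x] = \sum_(z <- x0 :: x) G z)%E.
  by rewrite (big_nth x0) big_mkord /= size_tuple.
rewrite newE sumE (bigID (pred1 x0))/=.
have originE : (\sum_(z <- x0 :: x | z == x0) G z =
    (K / n`!%:R)%:E * (origin_mass * \d_x0 A))%E.
  transitivity (\sum_(z <- x0 :: x | z == x0) G x0)%E.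
    by apply: eq_bigr => z /eqP ->.
  (* The seed adds one to the [p] observations equal to [x0]. *)
  rewrite big_const_seq /= eqxx add1n.
  have Kp0 : 0 <= K / p.+1%:R by rewrite divr_ge0 ?(ltW K_gt0).
  have -> : G x0 = (\d_x0 A * ((K / p.+1%:R / n`!%:R)%:E * origin_mass))%E.
    by rewrite /G (sample_density_core n Kp0 weight_rest core_origin).
  rewrite (_ : iter _ _ _ = (p.+1%:R%:E * (\d_x0 A *
      ((K / p.+1%:R / n`!%:R)%:E * origin_mass)))%E); last first.
    exact: iterE.
  rewrite (muleC (\d_x0 A)) !muleA -EFinM; congr (_%:E * _ * _)%E.
  by field; rewrite nat1r Fn0 pnatr_eq0.
have siteE : (\sum_(z <- x0 :: x | z != x0) G z =
    \sum_(l < k | xs l != x0) (K / n`!%:R)%:E * (site_mass l * \d_(xs l) A))%E.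
  rewrite big_cons eqxx /= -big_undup_iterop_count (big_displays xD).
  apply: eq_bigr => l lx0; have [_ _ <-] := xD.
  have Kl0 : 0 <= K / (nu l)%:R by rewrite divr_ge0 ?(ltW K_gt0).
  rewrite /G (sample_density_core n Kl0 (weight_tauM _ (weight_rest_without l)) (fun u => core_old u lx0))//.
  rewrite -[iterop _ _ _ _]/(_ *+ nu l)%E -mule_natl.
  rewrite (muleC (\d_(xs l) A)) !muleA -EFinM; congr (_%:E * _ * _)%E.
  by field; rewrite Fn0 pnatr_eq0 -lt0n nu_gt0.
rewrite originE siteE -ge0_sume_distrr; last first.
  by move=> l _; apply: mule_ge0; [exact: site_mass_ge0|].
have b0 : (0 <= b%:E * bulk_mass * Pstar A)%E.
  apply: mule_ge0; last exact: measure_ge0.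
  by apply: mule_ge0; [rewrite lee_fin ltW|exact: bulk_mass_ge0].
have o0 : (0 <= origin_mass * \d_x0 A)%E.
  by apply: mule_ge0; [exact: origin_mass_ge0|exact: measure_ge0].
have s0 : (0 <= \sum_(l < k | xs l != x0) site_mass l * \d_(xs l) A)%E.
  apply: sume_ge0 => l _.
  by apply: mule_ge0; [exact: site_mass_ge0|exact: measure_ge0].
by rewrite (ge0_muleDr _ (adde_ge0 b0 o0) s0) (ge0_muleDr _ b0 o0) addeA.
Qed.

Context (kA : set (borel X) -> \bar R) (n_gt0 : (0 < n)%N)
  (f_gt0 : (0 < fdens n x)%E) (f_fin : fdens n x \is a fin_num)
  (JT : urn_kernel Pstar x0 mf1 f10 x setT = fdens n x)
  (JA : forall A, measurable A ->
     urn_kernel Pstar x0 mf1 f10 x A = (fdens n x * kA A)%E).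

(** Each mass integral enters the finite total of the urn kernel as a nonnegative summand with a
    positive coefficient, and [D] is positive since the sample density is. Of the constants [K / n!]
    and [K / (n-1)!] the ratio keeps only [1 / n]. *)
Lemma predictive_formula : let D := int0oo (core n.-1 p rest) in
  [/\ (coreI n.-1 p rest < +oo)%E,
      (bulk_mass < +oo)%E,
      (origin_mass < +oo)%E,
      forall l, xs l != x0 -> (site_mass l < +oo)%E &
      forall A, measurable A -> kA A =
        ((n%:R^-1)%:E *
         ((b * (int0oo (core n p (fun u => tau 1 u * rest u)) / D))%:E * Pstar A +
          (int0oo (core n p.+1 rest) / D)%:E * \d_x0 A +
          \sum_(l < k | xs l != x0)
            (int0oo (core n p (fun u => tau (nu l).+1 u * rest_without l u)) / D)%:E *
            \d_(xs l) A))%E].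
Proof.
move=> D.
have Fn0 q : 0 < q`!%:R :> R by rewrite ltr0n fact_gt0.
have fE : fdens n x = ((K / (n.-1)`!%:R)%:E * coreI n.-1 p rest)%E.
  by rewrite -{1}(prednK n_gt0) (sample_density_core n.-1 (ltW K_gt0) weight_rest core_sample).
have KI (q : nat) (I : \bar R) : (0 <= I)%E -> ((K / q`!%:R)%:E * I < +oo)%E -> (I < +oo)%E.
  have Kq : 0 < K / q`!%:R by exact: divr_gt0.
  by move: I => [r _ _|_|//]; rewrite ?ltry// gt0_muley// ltxx.
have Doo : (coreI n.-1 p rest < +oo)%E.
  by apply: (@KI n.-1); [exact: coreI_ge0|rewrite -fE ltey_eq f_fin].
have DE : coreI n.-1 p rest = D%:E.
  by rewrite [RHS]fineK// ge0_fin_numE; [exact: Doo|exact: coreI_ge0].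
have D0 : 0 < D.
  move: f_gt0; rewrite fE DE -EFinM lte_fin pmulr_rgt0//; exact: divr_gt0.
have PT : Pstar setT = 1%E by exact: probability_setT.
have s0 A : (0 <= \sum_(l < k | xs l != x0) site_mass l * \d_(xs l) A)%E.
  apply: sume_ge0 => l _.
  by apply: mule_ge0; [exact: site_mass_ge0|exact: measure_ge0].
have bm0 : (0 <= b%:E * bulk_mass)%E.
  by apply: mule_ge0; [rewrite lee_fin ltW|exact: bulk_mass_ge0].
have tot : (b%:E * bulk_mass + origin_mass +
    \sum_(l < k | xs l != x0) site_mass l * \d_(xs l) setT < +oo)%E.
  apply: (@KI n); first exact: (adde_ge0 (adde_ge0 bm0 origin_mass_ge0) (s0 setT)).
  have := urn_kernel_core measurableT; rewrite PT diracT !mule1 JT => <-.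
  by rewrite ltey_eq f_fin.
have bo : (b%:E * bulk_mass + origin_mass < +oo)%E.
  by apply: le_lt_trans tot; rewrite leeDl.
have oo : (origin_mass < +oo)%E by apply: le_lt_trans bo; rewrite leeDr.
have boo : (bulk_mass < +oo)%E.
  have : (b%:E * bulk_mass < +oo)%E by apply: le_lt_trans bo; rewrite leeDl.
  move: bulk_mass_ge0; case: bulk_mass => [r _ _|_|//]; rewrite ?ltry// gt0_muley//.
have soo l : xs l != x0 -> (site_mass l < +oo)%E.
  move=> lx0; have : (\sum_(l < k | xs l != x0) site_mass l * \d_(xs l) setT < +oo)%E.
    by apply: le_lt_trans tot; rewrite leeDr// adde_ge0.
  apply: le_lt_trans; rewrite (bigD1 l)//= diracT mule1 leeDl//.
  apply: sume_ge0 => m _.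
  by apply: mule_ge0; [exact: site_mass_ge0|exact: measure_ge0].
split => // A mA.
have fineI (q r : nat) T : weight T -> (coreI q r T < +oo)%E ->
    coreI q r T = (int0oo (core q r T))%:E.
  by move=> wT h; rewrite [RHS]fineK// ge0_fin_numE; [exact: h|exact: coreI_ge0].
have -> : kA A = ((n%:R^-1)%:E * ((D^-1)%:E * (b%:E * bulk_mass * Pstar A +
    origin_mass * \d_x0 A + \sum_(l < k | xs l != x0) site_mass l * \d_(xs l) A)))%E.
  have r0 : K / (n.-1)`!%:R * D != 0.
    by rewrite gt_eqF// mulr_gt0// divr_gt0.
  have := JA mA; rewrite urn_kernel_core// fE DE -EFinM => e.
  rewrite -[LHS]mul1e (_ : 1%E = (((K / (n.-1)`!%:R * D)^-1)%:E *
      (K / (n.-1)`!%:R * D)%:E)%E); last by rewrite -EFinM mulVf.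
  rewrite -muleA -e muleA -EFinM [RHS]muleA -EFinM; congr (_%:E * _)%E.
  have -> : n`!%:R = n%:R * ((n.-1)`!)%:R :> R.
    by rewrite -{1}(prednK n_gt0) factS prednK// natrM.
  by field; rewrite !gt_eqF ?ltr0n ?fact_gt0.
congr (_ * _)%E.
have V0 : (0 <= D^-1%:E)%E by rewrite lee_fin invr_ge0 ltW.
have bp0 : (0 <= b%:E * bulk_mass * Pstar A)%E by rewrite mule_ge0.
have op0 : (0 <= origin_mass * \d_x0 A)%E.
  by apply: mule_ge0; [exact: origin_mass_ge0|exact: measure_ge0].
rewrite (ge0_muleDr _ (adde_ge0 bp0 op0) (s0 A)) (ge0_muleDr _ bp0 op0).
congr (_ + _ + _)%E.
- rewrite !muleA; congr (_ * _)%E.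
  rewrite /bulk_mass fineI//; last exact: weight_tauM.
  by rewrite -!EFinM; congr EFin; ring.
- rewrite muleA; congr (_ * _)%E.
  by rewrite /origin_mass fineI// -EFinM mulrC.
- rewrite ge0_sume_distrr; last first.
    by move=> l _; apply: mule_ge0; [exact: site_mass_ge0|exact: measure_ge0].
  apply: eq_bigr => l lx0; rewrite muleA; congr (_ * _)%E.
  rewrite /site_mass fineI; [by rewrite -EFinM mulrC|exact: weight_tauM|exact: soo].
Qed.


(** With [x0] unobserved, [bell_sum] of order 0 is 1 and of order 1 is [c zeta tau 1]. The integral
    for a draw of [x0] is thus [c zeta] times that for a fresh point, and the two terms recombine
    into a multiple of [P0]. *)
Lemma predictive_new (P0 : probability (borel X) R) A :
  (forall A, measurable A ->
     P0 A = (zeta%:E * \d_x0 A + (1 - zeta)%:E * Pstar A)%E) ->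
  (forall m, xs m <> x0) -> measurable A ->
  let D := int0oo (fun u => u ^+ n.-1 * expR (- (c * psi u)) *
                            \prod_(m < k) tau (nu m) u) in
  kA A =
  ((c / n%:R *
     (int0oo (fun u => u ^+ n * expR (- (c * psi u)) * tau 1 u *
                       \prod_(m < k) tau (nu m) u) / D))%:E * P0 A +
   (n%:R^-1)%:E * \sum_(l < k)
     (int0oo (fun u => u ^+ n * expR (- (c * psi u)) * tau (nu l).+1 u *
                       \prod_(m < k | m != l) tau (nu m) u) / D)%:E *
     \d_(xs l) A)%E.
Proof.
move=> P0E xs_new mA D; have [_ xsE _] := xD.
have new m : (xs m != x0) = true by apply/eqP; exact: xs_new.
have p0 : p = 0%N.
  apply/count_memPn; apply/negP => /xsE[m e]; exact: (xs_new m).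
have restE u : rest u = \prod_(m < k) tau (nu m) u by apply: eq_bigl => m; exact: new.
have core0 q T u : core q 0 T u = u ^+ q * expR (- (c * psi u)) * T u.
  by rewrite /core /bell_sum big_ord1 expr0 /= !mulr1.
have [_ boo _ _ /(_ A mA)->] := predictive_formula.
have DE : int0oo (core n.-1 p rest) = D.
  by congr int0oo; apply/funext => u; rewrite p0 core0 restE.
pose I1 := int0oo (fun u => u ^+ n * expR (- (c * psi u)) * tau 1 u *
                       \prod_(m < k) tau (nu m) u).
have I1E : int0oo (core n p (fun u => tau 1 u * rest u)) = I1.
  by congr int0oo; apply/funext => u; rewrite p0 core0 restE mulrA.
have I0E : int0oo (core n p.+1 rest) = c * zeta * I1.
  rewrite -I1E -RintegralZl//.
  - congr int0oo; apply/funext => u; rewrite p0 core0 /core /bell_sum.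
    by rewrite big_ord_recr big_ord1 bell1 /= expr0 mulr0 add0r expr1; ring.
  - apply/integrableP; split.
      by apply/measurable_EFinP; apply: measurable_core; exact: weight_tauM.
    apply: le_lt_trans boo; rewrite le_eqVlt; apply/orP; left; apply/eqP.
    apply: eq_integral.
    move=> u; rewrite inE => /Rpos_gt0 u0; rewrite /= ger0_norm//.
    by apply: core_ge0 => //; exact: weight_tauM.
rewrite DE I0E I1E -/I1 P0E//.
have -> : (\sum_(l < k | xs l != x0)
      (int0oo (core n p (fun u => tau (nu l).+1 u * rest_without l u)) / D)%:E *
      \d_(xs l) A)%E =
    (\sum_(l < k)
     (int0oo (fun u => u ^+ n * expR (- (c * psi u)) * tau (nu l).+1 u *
                       \prod_(m < k | m != l) tau (nu m) u) / D)%:E *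
     \d_(xs l) A)%E.
  apply: eq_big => l; first exact: new.
  move=> _; congr ((_ / _)%:E * _)%E; congr int0oo; apply/funext => u.
  rewrite p0 core0 mulrA; congr (_ * _); apply: eq_bigl => m.
  by rewrite new.
have Pfin : Pstar A \is a fin_num by exact: fin_num_measure.
rewrite -(fineK Pfin) diracE -!EFinM -!EFinD.
rewrite [LHS]muleDr ?fin_num_adde_defr//; congr (_ + _)%E.
rewrite -EFinM; congr EFin; ring.
Qed.

(** Now [p = nu j], and the sites other than [x0] are the indices other than [j]. Each integral is
    expanded by [int0oo_core_xi], at order [nu j + 1] for the draw of [x0]. *)
Lemma predictive_origin j A : xs j = x0 -> measurable A ->
  let D := \sum_(1 <= i < (nu j).+1) c ^+ i * zeta ^+ i *
             int0oo (fun u => u ^+ n.-1 * expR (- (c * psi u)) * xi rho (nu j) i u *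
                              \prod_(m < k | m != j) tau (nu m) u) in
  kA A =
  ((c * (1 - zeta) / n%:R *
     ((\sum_(1 <= i < (nu j).+1) c ^+ i * zeta ^+ i *
        int0oo (fun u => u ^+ n * expR (- (c * psi u)) * tau 1 u *
                         xi rho (nu j) i u *
                         \prod_(m < k | m != j) tau (nu m) u)) / D))%:E * Pstar A +
   (n%:R^-1 *
     ((\sum_(1 <= i < (nu j).+2) c ^+ i * zeta ^+ i *
        int0oo (fun u => u ^+ n * expR (- (c * psi u)) * xi rho (nu j).+1 i u *
                         \prod_(m < k | m != j) tau (nu m) u)) / D))%:E * \d_x0 A +
   (n%:R^-1)%:E * \sum_(l < k | l != j)
     ((\sum_(1 <= i < (nu j).+1) c ^+ i * zeta ^+ i *
        int0oo (fun u => u ^+ n * expR (- (c * psi u)) * tau (nu l).+1 u *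
                         xi rho (nu j) i u *
                         \prod_(m < k | (m != l) && (m != j)) tau (nu m) u)) / D)%:E *
     \d_(xs l) A)%E.
Proof.
move=> xsj mA D; have [xs_inj xsE nuE] := xD.
have pE : p = nu j by rewrite nuE xsj.
have newE m : (xs m != x0) = (m != j) by rewrite -xsj (inj_eq xs_inj).
have restE u : rest u = \prod_(m < k | m != j) tau (nu m) u.
  by apply: eq_bigl => m; exact: newE.
have restlE l u : rest_without l u = \prod_(m < k | (m != l) && (m != j)) tau (nu m) u.
  by apply: eq_bigl => m; rewrite newE andbC.
have [Doo boo oo soo /(_ A mA)->] := predictive_formula.
have wb : weight (fun u => tau 1 u * rest u) by exact: weight_tauM.
have -> : int0oo (core n.-1 p rest) = D.
  rewrite (int0oo_core_xi _ weight_rest Doo (G := fun i u =>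
    u ^+ n.-1 * expR (- (c * psi u)) * xi rho (nu j) i u *
                              \prod_(m < k | m != j) tau (nu m) u)); first by rewrite pE.
    by rewrite pE.
  by move=> i u _ _; rewrite restE pE.
rewrite (int0oo_core_xi _ wb boo (G := fun i u =>
    u ^+ n * expR (- (c * psi u)) * tau 1 u * xi rho (nu j) i u *
                         \prod_(m < k | m != j) tau (nu m) u)); first last.
- by move=> i u _ _; rewrite restE pE; ring.
- by rewrite pE.
rewrite (int0oo_core_xi _ weight_rest oo (G := fun i u =>
    u ^+ n * expR (- (c * psi u)) * xi rho (nu j).+1 i u *
                         \prod_(m < k | m != j) tau (nu m) u)); first last.
- by move=> i u _ _; rewrite restE pE; ring.
- by [].
rewrite pE.
have -> : (\sum_(l < k | xs l != x0)
      (int0oo (core n (nu j) (fun u => tau (nu l).+1 u * rest_without l u)) / D)%:E *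
      \d_(xs l) A)%E = (\sum_(l < k | l != j)
     ((\sum_(1 <= i < (nu j).+1) c ^+ i * zeta ^+ i *
        int0oo (fun u => u ^+ n * expR (- (c * psi u)) * tau (nu l).+1 u *
                         xi rho (nu j) i u *
                         \prod_(m < k | (m != l) && (m != j)) tau (nu m) u)) / D)%:E *
     \d_(xs l) A)%E.
  apply: eq_big => l; first exact: newE.
  move=> lx0; congr ((_ / _)%:E * _)%E.
  rewrite -pE (int0oo_core_xi _ (weight_tauM _ (weight_rest_without l)) (soo l lx0) (G := fun i u =>
    u ^+ n * expR (- (c * psi u)) * tau (nu l).+1 u * xi rho (nu j) i u *
                         \prod_(m < k | (m != l) && (m != j)) tau (nu m) u)) ?pE//.
  by move=> i u _ _; rewrite restlE; ring.
set S := (\sum_(l < k | _) _)%E.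
have Pfin : Pstar A \is a fin_num by exact: fin_num_measure.
rewrite -(fineK Pfin) diracE -!EFinM -!EFinD.
rewrite [LHS]muleDr ?fin_num_adde_defr//; congr (_ + _)%E.
rewrite -EFinM; congr EFin; ring.
Qed.

End predictive_weights.

Theorem theorem3 (R : realType) (X : ptopologicalType) (hX : polish R X)
  (rho : R -> R)
  (rho_meas : measurable_fun [set s : R | 0 < s] rho)
  (rho_ge0 : forall s, 0 < s -> 0 <= rho s)
  (rho_levy : (\int[@lebesgue_measure R]_(s in `]0%R, +oo[)
                 (Num.min 1%R s * rho s)%:E < +oo)%E)
  (rho_infinite : (\int[@lebesgue_measure R]_(s in `]0%R, +oo[)
                     (rho s)%:E = +oo)%E)
  (zeta : R) (zeta01 : 0 < zeta < 1) (c : R) (c_gt0 : 0 < c)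
  (x0 : borel X)
  (Pstar : probability (borel X) R) (Pstar_diffuse : diffuse Pstar)
  (P0 : probability (borel X) R)
  (P0E : forall A, measurable A ->
     P0 A = (zeta%:E * \d_x0 A + (1 - zeta)%:E * Pstar A)%E)
  (dO : measure_display) (Omega : measurableType dO)
  (Pr : probability Omega R)
  (Pt : {RV Pr >-> pprobability (borel X) R})
  (Pt_hNRMI : is_hNRMI rho c P0 (distribution Pr Pt))
  (Xs : nat -> {RV Pr >-> borel X})
  (Xs_iid : cond_iid Pr (fun i => Xs i) Pt)
  (n : nat) (n_gt0 : (0 < n)%N) :
  (exists kappa : R.-pker (n.-tuple (borel X)) ~> (borel X),
     is_regular_cond_dist Pr (Xs n) (sample (fun i => Xs i) n) kappa) /\
  forall kappa : R.-pker (n.-tuple (borel X)) ~> (borel X),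
    is_regular_cond_dist Pr (Xs n) (sample (fun i => Xs i) n) kappa ->
    \forall w \ae Pr,
      forall (k : nat) (xs : 'I_k -> borel X) (nu : 'I_k -> nat),
      displays (sample (fun i => Xs i) n w) xs nu ->
      ((forall m, xs m <> x0) ->
       forall A : set (borel X), measurable A ->
       let D := int0oo (fun u => u ^+ n.-1 * expR (- (c * psi rho u)) *
                                 \prod_(m < k) tau rho (nu m) u) in
       kappa (sample (fun i => Xs i) n w) A =
       ((c / n%:R *
          (int0oo (fun u => u ^+ n * expR (- (c * psi rho u)) * tau rho 1 u *
                            \prod_(m < k) tau rho (nu m) u) / D))%:E * P0 A +
        (n%:R^-1)%:E * \sum_(l < k)
          (int0oo (fun u => u ^+ n * expR (- (c * psi rho u)) *
                            tau rho (nu l).+1 u *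
                            \prod_(m < k | m != l) tau rho (nu m) u) / D)%:E *
          \d_(xs l) A)%E)
      /\
      (forall j : 'I_k, xs j = x0 ->
       forall A : set (borel X), measurable A ->
       let D := \sum_(1 <= i < (nu j).+1) c ^+ i * zeta ^+ i *
                  int0oo (fun u => u ^+ n.-1 * expR (- (c * psi rho u)) *
                                   xi rho (nu j) i u *
                                   \prod_(m < k | m != j) tau rho (nu m) u) in
       kappa (sample (fun i => Xs i) n w) A =
       ((c * (1 - zeta) / n%:R *
          ((\sum_(1 <= i < (nu j).+1) c ^+ i * zeta ^+ i *
             int0oo (fun u => u ^+ n * expR (- (c * psi rho u)) * tau rho 1 u *
                              xi rho (nu j) i u *
                              \prod_(m < k | m != j) tau rho (nu m) u)) /
           D))%:E * Pstar A +
        (n%:R^-1 *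
          ((\sum_(1 <= i < (nu j).+2) c ^+ i * zeta ^+ i *
             int0oo (fun u => u ^+ n * expR (- (c * psi rho u)) *
                              xi rho (nu j).+1 i u *
                              \prod_(m < k | m != j) tau rho (nu m) u)) /
           D))%:E * \d_x0 A +
        (n%:R^-1)%:E * \sum_(l < k | l != j)
          ((\sum_(1 <= i < (nu j).+1) c ^+ i * zeta ^+ i *
             int0oo (fun u => u ^+ n * expR (- (c * psi rho u)) *
                              tau rho (nu l).+1 u * xi rho (nu j) i u *
                              \prod_(m < k | (m != l) && (m != j))
                                 tau rho (nu m) u)) /
           D)%:E * \d_(xs l) A)%E).

Proof.
have fn0 (x : n.-tuple (borel X)) : (0 <= sample_density rho c zeta x0 Pstar n x)%E.
  exact: sample_density_ge0.
have f10 (z : n.+1.-tuple (borel X)) : (0 <= sample_density rho c zeta x0 Pstar n.+1 z)%E.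
  exact: sample_density_ge0.
have mfn : measurable_fun setT (fun x : n.-tuple (borel X) =>
    sample_density rho c zeta x0 Pstar n x).
  exact: measurable_sample_density.
have mf1 : measurable_fun setT (fun z : n.+1.-tuple (borel X) =>
    sample_density rho c zeta x0 Pstar n.+1 z).
  exact: measurable_sample_density.
have mZ : measurable_fun setT (sample (fun i => Xs i) n) by exact: measurable_sample.
have mY : measurable_fun setT (Xs n) by exact: measurable_funPT.
have lawZ (A : 'I_n -> set (borel X)) : (forall i, measurable (A i)) ->
    Pr (sample (fun i => Xs i) n @^-1` rect A) =
    (\int[urn_law x0 Pstar n]_(x in rect A) sample_density rho c zeta x0 Pstar n x)%E.
  move=> mA; exact: (sample_tuple_law hX rho_meas rho_ge0 rho_levy rho_infinite c_gt0
    zeta01 Pstar_diffuse P0E Pt_hNRMI Xs_iid n_gt0 mA).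
have lawYZ (A : 'I_n.+1 -> set (borel X)) : (forall i, measurable (A i)) ->
    Pr ((fun w => [tuple of Xs n w :: sample (fun i => Xs i) n w]) @^-1` rect A) =
    (\int[urn_measure Pstar x0 (urn_law x0 Pstar n)]_(x in rect A)
       sample_density rho c zeta x0 Pstar n.+1 x)%E.
  move=> mA; exact: (sample_cons_law hX rho_meas rho_ge0 rho_levy rho_infinite c_gt0
    zeta01 Pstar_diffuse P0E Pt_hNRMI Xs_iid mA).
split.
  exact: (regular_cond_dist_exists mfn fn0 mf1 f10 mZ mY lawZ lawYZ).
move=> kappa hkappa.
have := regular_cond_dist_unique hX mfn fn0 mf1 f10 mZ mY lawZ lawYZ hkappa.
(* The exceptional set is fixed before the description [k], [xs], [nu] of the sample and the set [A]
   are chosen. *)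
apply: filterS => w [f_gt0 f_fin JT JA] k xs nu xD; split.
- move=> xs_new A mA.
  exact: (predictive_new hX rho_meas rho_ge0 rho_levy c_gt0 zeta01 Pstar_diffuse xD
    n_gt0 f_gt0 f_fin JT JA P0E xs_new mA).
- move=> j xsj A mA.
  exact: (predictive_origin hX rho_meas rho_ge0 rho_levy c_gt0 zeta01 Pstar_diffuse xD
    n_gt0 f_gt0 f_fin JT JA xsj mA).
Qed.
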